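(* Let $\Omega\subset\mathbb{R}^n$ ($n\ge1$) be a uniformly smooth domain, let $f\in C^1([0,\infty))$ satisfy $f(0)\ge0$ and $f(s)>0$ for $s>0$, and let $u_0\in L^\infty(\Omega)$, $u_0\ge0$. Let $u$ be the solution of $u_t-\Delta u=f(u)$ in $\Omega\times(0,T)$, $u=0$ on $\partial\Omega\times(0,T)$ (boundary condition omitted if $\Omega=\mathbb{R}^n$), $u(\cdot,0)=u_0$, with maximal existence time $T=T(u_0)$. Let $F(z)=\int_0^zf(s)\,ds$, $U(t)=\|u(\cdot,t)\|_\infty$, $M(t_0)=\sup_{t\in[0,t_0]}U(t)$, and let $0\le t_1<t_0<T$. (i) If $$\tfrac12|\nabla u|^2+F(u)\le F(U(t_0))\quad\text{in }\overline\Omega\times\{t_1\},$$ then $U(t_1)\le U(t_0)$. (ii) Assume in addition that $\Omega$ is convex, $u_0\in Y$ and $$\tfrac12|\nabla u_0|^2+F(u_0)\le F(U(t_0))\quad\text{in }\overline\Omega.$$ Then the property $$\tfrac12|\nabla u|^2+F(u)\le F(U(t_0))\quad\text{in }\overline\Omega\times[0,t_0]$$ is satisfied if and only if $M(t_0)=U(t_0)$.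
   Context: $Y:=\{v\in C^1(\overline\Omega): v\ge0\text{ and }v=0\text{ on }\partial\Omega\}$, equipped with $\|v\|_Y=\|v\|_\infty+\|\nabla v\|_\infty$ (this norm being finite for elements of $Y$; the boundary condition is void if $\Omega=\mathbb{R}^n$). For $u_0\in L^\infty(\Omega)$, $u_0\ge0$, the solution and its maximal existence time $T(u_0)\in(0,\infty]$ are understood as follows: there exist a unique $T=T(u_0)\in(0,\infty]$ and a unique function $u\ge 0$ with $u\in C^{2,1}(\overline\Omega\times(0,T))\cap C((0,T),L^\infty(\Omega))$, $\lim_{t\to0}\|u(t)-e^{-tA}u_0\|_\infty=0$ (where $e^{-tA}$ is the Dirichlet heat semigroup in $\Omega$), $u$ solves the equation and the boundary condition classically for $t\in(0,T)$, and either $T=\infty$ or $\lim_{t\to T}\|u(\cdot,t)\|_\infty=\infty$. At $t=0$, $u(\cdot,0)=u_0$ and $U(0)=\|u_0\|_\infty$. *)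

(* Defs.v *)
From HB Require Import structures.
From mathcomp Require Import all_boot all_order all_algebra.
From mathcomp Require Import all_classical all_reals all_analysis.

Set Implicit Arguments.
Unset Strict Implicit.
Unset Printing Implicit Defensive.

Import Order.TTheory GRing.Theory Num.Theory.
Import numFieldNormedType.Exports.

Local Open Scope classical_set_scope.
Local Open Scope ring_scope.

Definition rV_display : measure_display.
Proof. exact: default_measure_display. Qed.

Definition rV_coord {R : realType} {n : nat} (i : 'I_n) (x : 'rV[R]_n) :
  measurableTypeR R := x 0 i.

(* The sigma-algebra generated by the coordinates, i.e., the Borel sets. *)
HB.instance Definition _ (R : realType) (n : nat) :=
  @isMeasurable.Build rV_display 'rV[R]_n
    (g_sigma_preimage (@rV_coord R n)) (@sigma_algebra0 _ _ _)
    (@sigma_algebraC _ _) (@sigma_algebra_bigcup _ _ _).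

Lemma measurable_rV_coord (R : realType) (n : nat) (i : 'I_n) :
  measurable_fun [set: 'rV[R]_n] (rV_coord i).
Proof.
move=> _ Y mY; rewrite setTI; apply: sub_sigma_algebra => /=.
rewrite -bigcup_seq/=; exists i => /=; first by rewrite mem_index_enum.
by exists Y => //; rewrite setTI.
Qed.

Lemma measurable_fun_rV d (T : measurableType d) (R : realType) (n : nat)
    (f : T -> 'rV[R]_n) :
  (forall i, measurable_fun [set: T] (rV_coord i \o f)) ->
  measurable_fun [set: T] f.
Proof.
move=> mf.
suff h : g_sigma_preimage (fun i => rV_coord i \o f) `<=` measurable.
  rewrite g_sigma_preimage_comp in h.
  by move=> _ A mA; apply: h; exists A.
apply: smallest_sub; first exact: sigma_algebra_measurable.
case: n => [|m] in f mf *; first by rewrite big_ord0.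
rewrite -bigcup_mkord_ord; apply: bigcup_sub => i Ii.
by move=> A [B mB <-]; exact: mf.
Qed.

Section lebesgue_measure_rV.
Context {R : realType}.

Definition rV_cons {m : nat} (p : measurableTypeR R * 'rV[R]_m) : 'rV[R]_m.+1 :=
  row_mx (p.1 : R)%:M p.2 : 'rV_(1 + m).

Definition rV_behead {m : nat} (x : 'rV[R]_m.+1) : 'rV[R]_m :=
  rsubmx (x : 'rV_(1 + m)).

Lemma rV_cons_coord0 {m : nat} (p : measurableTypeR R * 'rV[R]_m) :
  rV_cons p 0 ord0 = p.1.
Proof.
transitivity (row_mx (p.1 : R)%:M p.2 (0 : 'I_1) (lshift m (0 : 'I_1))).
  by congr (rV_cons p 0 _); exact/val_inj.
by rewrite row_mxEl mxE eqxx mulr1n.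
Qed.

Lemma rV_consK {m : nat} (p : measurableTypeR R * 'rV[R]_m) :
  rV_behead (rV_cons p) = p.2.
Proof. by rewrite /rV_behead /rV_cons row_mxKr. Qed.

Lemma rV_beheadE {m : nat} (x : 'rV[R]_m.+1) (i : 'I_m) :
  rV_behead x 0 i = x 0 (rshift 1 i : 'I_(1 + m)).
Proof. by rewrite mxE. Qed.

Lemma measurable_rV_cons {m : nat} : measurable_fun setT (@rV_cons m).
Proof.
apply: measurable_fun_rV => i.
have [->|i0] := eqVneq i ord0.
  rewrite (_ : _ \o _ = fst)//; apply/funext => p /=.
  exact: rV_cons_coord0.
have i1m : (i.-1 < m)%N by rewrite prednK ?lt0n// -ltnS.
rewrite (_ : _ \o _ = rV_coord (Ordinal i1m) \o snd).
  by apply: measurableT_comp => //; exact: measurable_rV_coord.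
apply/funext => p /=; rewrite -[in RHS](rV_consK p) /rV_coord rV_beheadE.
by congr (rV_cons p 0 _); apply/val_inj; rewrite /= add1n prednK// lt0n.
Qed.

Lemma measurable_rV_behead {m : nat} : measurable_fun setT (@rV_behead m).
Proof.
apply: measurable_fun_rV => i.
rewrite (_ : _ \o _ = rV_coord (rshift 1 i)); first exact: measurable_rV_coord.
by apply/funext => x; rewrite /= /rV_coord mxE.
Qed.

Section step.
Context {m : nat} (mu : {sigma_finite_measure set 'rV[R]_m -> \bar R}).

Definition lebesgue_rV_step : set 'rV[R]_m.+1 -> \bar R :=
  pushforward (@lebesgue_measure R \x mu)%E rV_cons.

Let step0 : lebesgue_rV_step set0 = 0%E.
Proof. by rewrite /lebesgue_rV_step /pushforward preimage_set0 measure0. Qed.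

Let step_ge0 A : (0 <= lebesgue_rV_step A)%E.
Proof. by rewrite /lebesgue_rV_step /pushforward measure_ge0. Qed.

Let step_sigma_additive : semi_sigma_additive lebesgue_rV_step.
Proof.
move=> F mF tF mUF; rewrite /lebesgue_rV_step.
apply: (@measure_semi_sigma_additive _ _ _
  (pushforward (@lebesgue_measure R \x mu)%E rV_cons)) => //.
exact: measurable_rV_cons.
Qed.

HB.instance Definition _ := isMeasure.Build _ _ _ lebesgue_rV_step
  step0 step_ge0 step_sigma_additive.

Let step_sigma_finite : sigma_finite setT lebesgue_rV_step.
Proof.
have /sigma_finiteP[F [TF ndF Foo]] := sigma_finiteT (@lebesgue_measure R).
have /sigma_finiteP[G [TG ndG Goo]] := sigma_finiteT mu.
pose ht (x : 'rV[R]_m.+1) : measurableTypeR R * 'rV[R]_m :=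
  (rV_coord ord0 x, rV_behead x).
have mht : measurable_fun setT ht.
  by apply: measurable_fun_pair; [exact: measurable_rV_coord|
                                  exact: measurable_rV_behead].
have consK p : ht (rV_cons p) = p.
  by rewrite /ht rV_consK [rV_coord _ _]rV_cons_coord0; case: p.
exists (fun k => ht @^-1` (F k `*` G k)).
  rewrite -preimage_bigcup -[LHS](preimage_setT ht); congr (_ @^-1` _).
  rewrite -setXTT TF TG; apply/seteqP; split => [[x y]|[x y] [k _ [? ?]]].
    move=> [/= [k _ Fkx] [l _ Gly]]; exists (maxn k l) => //; split.
    - by move: x Fkx; exact/subsetPset/ndF/leq_maxl.
    - by move: y Gly; exact/subsetPset/ndG/leq_maxr.
  by split; exists k.
move=> k; have [? ?] := Foo k; have [? ?] := Goo k; split.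
  by rewrite -[X in measurable X]setTI; apply: mht => //; exact: measurableX.
rewrite /lebesgue_rV_step /pushforward.
rewrite (_ : _ @^-1` _ = F k `*` G k); last first.
  by apply/funext => p; rewrite -[LHS]/((F k `*` G k) (ht (rV_cons p))) consK.
by rewrite product_measure1E// lte_mul_pinfty// ge0_fin_numE.
Qed.

HB.instance Definition _ := Measure_isSigmaFinite.Build _ _ _ lebesgue_rV_step
  step_sigma_finite.

End step.

Fixpoint lebesgue_rV (n : nat) : {sigma_finite_measure set 'rV[R]_n -> \bar R} :=
  match n with
  | 0 => \d_(0 : 'rV[R]_0)
  | m.+1 => lebesgue_rV_step (lebesgue_rV m)
  end.

End lebesgue_measure_rV.

Section calculus.
Context {R : realType}.

Definition unit_vec {n : nat} (i : 'I_n) : 'rV[R]_n := delta_mx 0 i.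

Definition sqnorm {n : nat} (p : 'rV[R]_n) : R := \sum_i p 0 i ^+ 2.

Definition boundary {T : topologicalType} (Omega : set T) : set T :=
  closure Omega `\` interior Omega.

Definition iter_partial {n : nat} (s : seq 'I_n) (phi : 'rV[R]_n -> R) :
  'rV[R]_n -> R := foldr (fun i g => 'D_(unit_vec i) g) phi s.

Definition smooth {n : nat} (phi : 'rV[R]_n -> R) : Prop :=
  forall s : seq 'I_n, continuous (iter_partial s phi) /\
    forall i y, derivable (iter_partial s phi) y (unit_vec i).

(* Uniformly C^oo domain: with a radius r and constants C that do not depend on
   the boundary point x0, in some orthonormal frame Q centred at x0 the set
   Omega is, within distance r of x0, the strict epigraph of a smooth function
   phi whose partial derivatives of every multi-index s are bounded by C s.
   The frame coordinate of index 0 plays the role of the vertical one. *)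
Definition uniformly_smooth_domain {n : nat} (Omega : set 'rV[R]_n.+1) : Prop :=
  [/\ open Omega, connected Omega, Omega !=set0 &
    exists (r : R) (C : seq 'I_n -> R), 0 < r /\
      forall x0, boundary Omega x0 ->
        exists (Q : 'M[R]_n.+1) (phi : 'rV[R]_n -> R),
          [/\ Q *m Q^T = 1%:M, smooth phi,
              forall s y, `|iter_partial s phi y| <= C s &
              forall z : 'rV[R]_n.+1, sqnorm z < r ^+ 2 ->
                (Omega (x0 + z *m Q) <-> phi (rV_behead z) < z 0 ord0)]].

Definition extends_continuously {X : topologicalType} (D E : set X)
    (g : X -> R) : Prop :=
  exists2 h : X -> R, {within E, continuous h} & {in D, g =1 h}.

(* v is C^1 in the open set Omega and v and its first derivatives extend
   continuously to the closure; only the values of v on the closure matter. *)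
Definition C1_closure {n : nat} (Omega : set 'rV[R]_n) (v : 'rV[R]_n -> R) :=
  [/\ {within closure Omega, continuous v},
      forall i x, Omega x -> derivable v x (unit_vec i) &
      forall i, extends_continuously Omega (closure Omega) ('D_(unit_vec i) v)].

(* The gradient on the closure of Omega; at boundary points it is the limit of
   the interior gradients. *)
Definition gradient {n : nat} (Omega : set 'rV[R]_n) (v : 'rV[R]_n -> R)
    (x : 'rV[R]_n) : 'rV[R]_n :=
  \row_i lim ('D_(unit_vec i) v y @[y --> within Omega (nbhs x)]).

Definition laplacian {n : nat} (v : 'rV[R]_n -> R) (x : 'rV[R]_n) : R :=
  \sum_i 'D_(unit_vec i) ('D_(unit_vec i) v) x.

Definition dt {n : nat} (u : R -> 'rV[R]_n -> R) (t : R) (x : 'rV[R]_n) : R :=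
  derive1 (u^~ x) t.

(* C^{2,1} up to the lateral boundary, on closure Omega x I, I an open time
   interval: two derivatives in space, one in time. *)
Definition C21_closure {n : nat} (Omega : set 'rV[R]_n) (I : set R)
    (u : R -> 'rV[R]_n -> R) : Prop :=
  let ext g := extends_continuously (I `*` Omega) (I `*` closure Omega) g in
  [/\ {within I `*` closure Omega, continuous (fun p => u p.1 p.2)},
      forall t x, I t -> Omega x -> derivable (u^~ x) t 1,
      forall t x i, I t -> Omega x -> derivable (u t) x (unit_vec i),
      forall t x i j, I t -> Omega x ->
        derivable ('D_(unit_vec i) (u t)) x (unit_vec j) &
      [/\ ext (fun p => dt u p.1 p.2),
          forall i, ext (fun p => 'D_(unit_vec i) (u p.1) p.2) &
          forall i j,
            ext (fun p => 'D_(unit_vec j) ('D_(unit_vec i) (u p.1)) p.2)]].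

(* f in C^1([0,oo)), with the one-sided derivative at 0. *)
Definition C1_nonneg (f : R -> R) : Prop :=
  exists2 f' : R -> R, {within `[0, +oo[, continuous f'} &
    forall s : R, 0 <= s ->
      h^-1 * (f (s + h) - f s) @[h --> within [set h | 0 <= s + h] 0^'] --> f' s.

Definition primitive (f : R -> R) (z : R) : R :=
  \int[lebesgue_measure]_(s in `[0, z]) f s.

End calculus.

Section equation.
Context {R : realType} {n : nat}.
Implicit Types (Omega : set 'rV[R]_n) (v : 'rV[R]_n -> R)
  (u : R -> 'rV[R]_n -> R).

Definition Linfty_norm Omega v : \bar R :=
  'N[lebesgue_rV n]_+oo [EFin \o (v \_ Omega)].

Definition in_Linfty Omega v : Prop :=
  measurable_fun setT (v \_ Omega) /\ (Linfty_norm Omega v < +oo)%E.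

Definition in_Y Omega v : Prop :=
  [/\ C1_closure Omega v,
      forall x, closure Omega x -> 0 <= v x,
      forall x, boundary Omega x -> v x = 0 &
      exists K : R, forall x, closure Omega x ->
        `|v x| <= K /\ sqnorm (gradient Omega v x) <= K ^+ 2].

(* v t = e^{-tA} u0 for t > 0, where e^{-tA} is the Dirichlet heat semigroup of
   Omega: v is the bounded classical solution of the heat equation in
   Omega x (0,oo) with zero lateral boundary values and initial values u0.  The
   initial values are attained almost everywhere: on L^oo the semigroup is not
   strongly continuous at t = 0. *)
Definition Dirichlet_heat_flow Omega (u0 : 'rV[R]_n -> R) (v : R -> 'rV[R]_n -> R) : Prop :=
  [/\ C21_closure Omega `]0, +oo[ v,
      exists K : R, forall (t : R) x, 0 < t -> closure Omega x -> `|v t x| <= K,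
      forall (t : R) x, 0 < t -> Omega x -> dt v t x = laplacian (v t) x,
      forall (t : R) x, 0 < t -> boundary Omega x -> v t x = 0 &
      {ae lebesgue_rV n, forall x, Omega x -> v t x @[t --> 0^'+] --> u0 x}].

Record maximal_solution Omega (f : R -> R) (u0 : 'rV[R]_n -> R)
    (T : \bar R) u : Prop := {
  sol_T_gt0 : (0 < T)%E;
  sol_init : u 0 = u0;
  sol_regular : C21_closure Omega [set t | 0 < t /\ (t%:E < T)%E] u;
  sol_ge0 : forall (t : R) x, 0 < t -> (t%:E < T)%E -> closure Omega x -> 0 <= u t x;
  sol_eq : forall (t : R) x, 0 < t -> (t%:E < T)%E -> Omega x ->
    dt u t x - laplacian (u t) x = f (u t x);
  sol_boundary : forall (t : R) x, 0 < t -> (t%:E < T)%E -> boundary Omega x ->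
    u t x = 0;
  sol_Linfty : forall t : R, 0 < t -> (t%:E < T)%E -> in_Linfty Omega (u t);
  sol_continuous : forall t : R, 0 < t -> (t%:E < T)%E ->
    Linfty_norm Omega (u s \- u t) @[s --> t] --> 0%E;
  sol_initial_limit : exists2 v, Dirichlet_heat_flow Omega u0 v &
    Linfty_norm Omega (u t \- v t) @[t --> 0^'+] --> 0%E;
  sol_maximal : T = +oo%E \/
    Linfty_norm Omega (u t) @[t --> (fine T)^'-] --> +oo%E
}.

(* |grad v|^2 / 2 + F(v) <= c on the closure of Omega.  The inequality
   presupposes that the gradient exists up to the boundary. *)
Definition energy_le Omega (F : R -> R) v (c : R) : Prop :=
  C1_closure Omega v /\
  forall x, closure Omega x ->
    2^-1 * sqnorm (gradient Omega v x) + F (v x) <= c.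

End equation.

(* Main.v *)
Require Import Defs.
From mathcomp Require Import all_boot all_order all_algebra.
From mathcomp Require Import all_classical all_reals all_analysis.
From mathcomp Require Import measurable_realfun ess_sup_inf ring lra.

Set Implicit Arguments.
Unset Strict Implicit.
Unset Printing Implicit Defensive.

Import Order.TTheory GRing.Theory Num.Theory.
Import numFieldNormedType.Exports.

Local Open Scope classical_set_scope.
Local Open Scope ring_scope.

(** Write [m = U(t0)].  One half is immediate: an energy inequality at level [F(m)]
    gives [F(u) <= F(m)], and [F] is strictly increasing, so [u <= m] at that
    time; applied at all times up to [t0], this is also one direction of the
    equivalence.

    For the converse, take [E > F(m)] and let [phi] be the solution of
    [phi'' + f(phi) = 0], [phi(0) = 0], of energy [phi'^2 / 2 + F(phi) = E].  Its
    inverse [G] satisfies [G'(z) = (2 (E - F(z)))^(-1/2)] for [0 <= z <= m]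
    ([slope_inv], [travel]), so that
    [|grad G(u)|^2 = |grad u|^2 / (2 (E - F(u)))]: the energy inequality at level [E]
    says exactly that [|grad G(u)| <= 1], which on a convex set means that [G(u)] is
    [1]-Lipschitz ([lipschitz_of_partials], [partials_of_lipschitz]).  As long as
    [u <= m], the function [g = G(u)] solves
    [g_t = Lap g + a (1 - |grad g|^2)] with [a = f(u) G'(u)] bounded,
    and this flow preserves the Lipschitz constant [1]
    ([gradient_equation_lipschitz]).  The proof doubles the variables: at a positive
    interior maximum of [g(t,y) - g(t,x) - |y - x|] both gradients equal the unit
    vector [(y - x) / |y - x|], which kills the terms in [a], and translating [x] and
    [y] together gives [Lap g(y) <= Lap g(x)] ([two_point_bound]).  If [x] is on the
    boundary, [g(x) = 0] and [g(y)] is at most the distance from [y] to a hyperplane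
    supporting the convex set [Omega] near [x], because that distance is a stationary
    solution of the equation ([halfspace_bound]).  Finally [E] decreases to [F(m)].

    Comparing pointwise from time [0] on requires that [u(t)] tends to [u0]
    uniformly.  By the definition of solutions it is enough that the heat flow does,
    while the heat flow is only known to attain [u0] almost everywhere.  Now [u0] is
    Lipschitz and vanishes on the boundary, so around each point it is trapped between
    quadratic barriers ([heat_flow_cone]); the comparison with them uses integrals
    of powers of the positive part, for which initial values almost everywhere
    suffice ([weak_max_principle]). *)

(** * Derivatives along lines and maxima in one variable *)

Section derivatives_along_lines.
Context {R : realType} {V : normedModType R}.
Implicit Types (w : V -> R) (x v : V).

Lemma derive_lineE w x v (s : R) :
  (fun h : R => h^-1 *: (((fun r => w (x + r *: v)) \o shift s) (h *: 1) -
                         w (x + s *: v)))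
  = (fun h => h^-1 *: ((w \o shift (x + s *: v)) (h *: v) - w (x + s *: v))).
Proof.
apply/funext => h /=.
by rewrite [h *: 1]mulr1 scalerDl addrCA.
Qed.

Lemma is_derive_line w x v (s l : R) :
  is_derive (x + s *: v) v w l -> is_derive s 1 (fun r => w (x + r *: v)) l.
Proof.
case=> dw <-.
have E := derive_lineE w x v s.
by split; [rewrite /derivable E|rewrite /derive E].
Qed.

Lemma line_is_derive w x v (s l : R) :
  is_derive s 1 (fun r => w (x + r *: v)) l -> is_derive (x + s *: v) v w l.
Proof.
case=> dw <-.
have E := derive_lineE w x v s.
by split; [rewrite /derivable -E|rewrite /derive -E].
Qed.

Lemma is_derive_line0 w x v (l : R) :
  is_derive x v w l -> is_derive (0 : R) 1 (fun r => w (x + r *: v)) l.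
Proof.
by move=> dw; apply: is_derive_line; rewrite scale0r addr0.
Qed.

Lemma line0_is_derive w x v (l : R) :
  is_derive (0 : R) 1 (fun r => w (x + r *: v)) l -> is_derive x v w l.
Proof. by move/line_is_derive; rewrite scale0r addr0. Qed.

Lemma is_derive_compl (G : R -> R) w x v (dG l : R) :
  is_derive (w x) 1 G dG -> is_derive x v w l ->
  is_derive x v (G \o w) (dG * l).
Proof.
move=> hG hw; apply: line0_is_derive.
have hl := is_derive_line0 hw.
have hG' : is_derive ((fun r : R => w (x + r *: v)) 0) 1 G dG.
  by rewrite scale0r addr0.
exact: (is_derive1_comp (f := G) (g := fun r : R => w (x + r *: v))).
Qed.

End derivatives_along_lines.

Section one_variable_maxima.
Context {R : realType}.
Implicit Types (phi dphi : R -> R).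

Lemma is_derive_near_gt phi (c l : R) : is_derive c 1 phi l -> 0 < l ->
  \forall h \near 0^'+, phi c < phi (c + h) /\ phi (c - h) < phi c.
Proof.
move=> [dphi lE] l0.
have lim : h^-1 * (phi (h + c) - phi c) @[h --> 0^'] --> l.
  move: dphi; rewrite /derivable -lE /derive.
  under eq_fun do rewrite /= [_ *: 1]mulr1.
  by [].
have pos : \forall h \near 0^', 0 < h^-1 * (phi (h + c) - phi c).
  by apply: (cvgr_gt l).
have [e /= e0 He] := pos.
exists e => //= h /=; rewrite sub0r normrN => he h0; split.
  have := He h; rewrite /= sub0r normrN => /(_ he (lt0r_neq0 h0)).
  by rewrite pmulr_rgt0 ?invr_gt0// subr_gt0 addrC.
have := He (- h); rewrite /= sub0r opprK => /(_ he).
rewrite oppr_eq0 => /(_ (lt0r_neq0 h0)).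
by rewrite nmulr_rgt0 ?invr_lt0 ?oppr_lt0// subr_lt0 addrC.
Qed.

Lemma is_derive_ge0_left_max phi (c l : R) : is_derive c 1 phi l ->
  (\forall h \near 0^'+, phi (c - h) <= phi c) -> 0 <= l.
Proof.
move=> dphi hm; rewrite leNgt; apply/negP => l0.
have dN : is_derive c 1 (- phi) (- l) by apply: is_deriveN.
have := is_derive_near_gt dN; rewrite oppr_gt0 => /(_ l0) hl.
suff : \forall h \near (0 : R)^'+, False by move=> /filter_ex[].
near=> h.
have [_] : (- phi) c < (- phi) (c + h) /\ (- phi) (c - h) < (- phi) c
  by near: h.
rewrite ltrN2 ltNge => /negP; apply.
by near: h.
Unshelve. all: by end_near. Qed.

Lemma is_derive_max0 phi (c l : R) : is_derive c 1 phi l ->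
  (\forall s \near c, phi s <= phi c) -> l = 0.
Proof.
move=> dphi hm.
have hm2 : \forall h \near (0:R), phi (c + h) <= phi c /\ phi (c - h) <= phi c.
  have [e /= e0 He] := hm.
  exists e => //= h /=; rewrite sub0r normrN => he.
  split; apply: He => /=; first by rewrite opprD addrA subrr sub0r normrN.
  by rewrite opprB addrC subrK.
have {}hm2 : \forall h \near (0:R)^'+, phi (c + h) <= phi c /\ phi (c - h) <= phi c.
  by apply: cvg_within.
apply/eqP; rewrite eq_le; apply/andP; split.
  rewrite leNgt; apply/negP => l0.
  have hl := is_derive_near_gt dphi l0.
  suff : \forall h \near (0 : R)^'+, False by move=> /filter_ex[].
  near=> h.
  have [+ _] : phi c < phi (c + h) /\ phi (c - h) < phi c by near: h.
  rewrite ltNge => /negP; apply.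
  by have [] : phi (c + h) <= phi c /\ phi (c - h) <= phi c by near: h.
apply: is_derive_ge0_left_max dphi _.
by near=> h; have [] : phi (c + h) <= phi c /\ phi (c - h) <= phi c by near: h.
Unshelve. all: by end_near. Qed.

(** If [l] were positive then [dphi] would be positive just after [c], and [phi] would
    increase there by the mean value theorem. *)
Lemma is_derive2_max phi dphi (c l : R) :
  (\forall s \near c, is_derive (s : R) 1 phi (dphi s)) -> is_derive c 1 dphi l ->
  (\forall s \near c, phi s <= phi c) -> dphi c = 0 /\ l <= 0.
Proof.
move=> hphi hdphi hm.
have d0 : dphi c = 0 := is_derive_max0 (nbhs_singleton hphi) hm.
split=> //; rewrite leNgt; apply/negP => l0.
have := is_derive_near_gt hdphi l0.
rewrite d0 => hpos.
have [e /= e0 He] := hphi.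
have [e' /= e'0 He'] := hm.
have [e1 /= e10 He1] := hpos.
pose h := Num.min (Num.min e e') e1 / 2.
have m0 : 0 < Num.min (Num.min e e') e1 by rewrite !lt_min e0 e'0 e10.
have h0 : 0 < h by rewrite divr_gt0.
have hlt : h < Num.min (Num.min e e') e1 by rewrite /h; lra.
move: (hlt); rewrite !lt_min => /andP[/andP[he he']] he1.
have [s sI] : exists2 s, s \in `]c, (c + h)[%R & phi (c + h) - phi c = dphi s * (c + h - c).
  apply: MVT.
  - by rewrite ltrDl.
  - move=> s /[!in_itv]/= /andP[cs sc]; apply: He => /=.
    by rewrite distrC ger0_norm; lra.
  - apply: derivable_within_continuous => s /[!in_itv]/= /andP[cs sc].
    have : is_derive s 1 phi (dphi s).
      by apply: He => /=; rewrite distrC ger0_norm; lra.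
    by case.
have : phi (c + h) <= phi c.
  by apply: He' => /=; rewrite distrC ger0_norm; lra.
move: sI => /[!in_itv]/= /andP[cs sc].
have ds : 0 < dphi s.
  have := He1 (s - c); rewrite /= sub0r normrN gtr0_norm ?subr_gt0//.
  by rewrite (_ : c + (s - c) = s); [case=> //; lra|ring].
move=> hle E.
have : 0 < dphi s * (c + h - c) by rewrite addrAC subrr add0r mulr_gt0.
by rewrite -E; lra.
Qed.

End one_variable_maxima.

Lemma cvg_sumr {R : realType} {T I : Type} (F : set_system T) {FF : Filter F}
    (r : seq I) (f : I -> T -> R) (l : I -> R) :
  (forall i, f i x @[x --> F] --> l i) ->
  \sum_(i <- r) f i x @[x --> F] --> \sum_(i <- r) l i.
Proof.
move=> fl; elim: r => [|i r IH].
  by rewrite big_nil; under eq_fun do rewrite big_nil; exact: cvg_cst.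
rewrite big_cons; under eq_fun do rewrite big_cons.
by apply: cvgD; [exact: fl|exact: IH].
Qed.

(** * The Euclidean norm *)

Section continuous_affine.
Context {R : realType} {V : normedModType R}.

Lemma continuous_affine (c : V) (k : R) :
  continuous (fun y : V => c + k *: y).
Proof.
by move=> y; apply: cvgD; [exact: cvg_cst|apply: cvgZr; exact: cvg_id].
Qed.

Lemma continuous_line (x v : V) : continuous (fun s : R => x + s *: v).
Proof.
by move=> s; apply: cvgD; [exact: cvg_cst|apply: cvgZl; exact: cvg_id].
Qed.

Lemma continuous_translation (c : V) : continuous (fun y : V => y + c).
Proof. by move=> y; apply: cvgD; [exact: cvg_id|exact: cvg_cst]. Qed.

End continuous_affine.

Definition vdot {R : realType} {n : nat} (a b : 'rV[R]_n) : R :=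
  \sum_i a 0 i * b 0 i.

Definition enorm {R : realType} {n : nat} (x : 'rV[R]_n) : R :=
  Num.sqrt (sqnorm x).

Section euclidean_norm.
Context {R : realType} {n : nat}.
Implicit Types (a b x y z : 'rV[R]_n) (s t : R).

Lemma sqnorm_vdot a : sqnorm a = vdot a a.
Proof. by apply: eq_bigr => i _; rewrite expr2. Qed.

Lemma vdotC a b : vdot a b = vdot b a.
Proof. by apply: eq_bigr => i _; rewrite mulrC. Qed.

Lemma vdotDr a x y : vdot a (x + y) = vdot a x + vdot a y.
Proof. by rewrite -big_split; apply: eq_bigr => i _; rewrite mxE mulrDr. Qed.

Lemma vdotZr a s x : vdot a (s *: x) = s * vdot a x.
Proof. by rewrite mulr_sumr; apply: eq_bigr => i _; rewrite mxE mulrCA. Qed.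

Lemma vdotNr a x : vdot a (- x) = - vdot a x.
Proof. by rewrite -scaleN1r vdotZr mulN1r. Qed.

Lemma vdotDl a x y : vdot (x + y) a = vdot x a + vdot y a.
Proof. by rewrite ![vdot _ a]vdotC vdotDr. Qed.

Lemma vdotZl a s x : vdot (s *: x) a = s * vdot x a.
Proof. by rewrite ![vdot _ a]vdotC vdotZr. Qed.

Lemma sqnorm_ge0 x : 0 <= sqnorm x.
Proof. by apply: sumr_ge0 => i _; rewrite sqr_ge0. Qed.

Lemma sqnormD x y : sqnorm (x + y) = sqnorm x + 2 * vdot x y + sqnorm y.
Proof.
rewrite !sqnorm_vdot !vdotDr !vdotDl (vdotC y x).
by ring.
Qed.

Lemma sqnormZ s x : sqnorm (s *: x) = s ^+ 2 * sqnorm x.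
Proof. by rewrite !sqnorm_vdot vdotZr vdotZl mulrA expr2. Qed.

Lemma sqnormN x : sqnorm (- x) = sqnorm x.
Proof. by rewrite -scaleN1r sqnormZ sqrrN expr1n mul1r. Qed.

Lemma sqnorm0 : sqnorm (0 : 'rV[R]_n) = 0.
Proof. by rewrite -(scale0r (0 : 'rV[R]_n)) sqnormZ expr2 !mul0r. Qed.

Lemma coord_le_sqnorm x i : x 0 i ^+ 2 <= sqnorm x.
Proof.
rewrite /sqnorm (bigD1 i)//= lerDl.
by apply: sumr_ge0 => j _; rewrite sqr_ge0.
Qed.

Lemma sqnorm_eq0 x : sqnorm x = 0 -> x = 0.
Proof.
move=> x0; apply/rowP => i; rewrite mxE; apply/eqP.
by rewrite -sqrf_eq0 eq_le sqr_ge0 andbT -x0 coord_le_sqnorm.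
Qed.

(** Expand the square of [|b|^2 a - (a.b) b]. *)
Lemma cauchy_schwarz a b : vdot a b ^+ 2 <= sqnorm a * sqnorm b.
Proof.
have [b0|b0] := eqVneq (sqnorm b) 0.
  by rewrite (sqnorm_eq0 b0) sqnorm0 -(scale0r b) vdotZr mul0r mulr0 expr2 mul0r.
have bp : 0 < sqnorm b by rewrite lt_def b0 sqnorm_ge0.
have := sqnorm_ge0 (sqnorm b *: a + (- vdot a b) *: b).
rewrite sqnormD !sqnormZ vdotZr vdotZl => h.
rewrite -(ler_pM2l bp) -subr_ge0; apply: le_trans h _.
by rewrite le_eqVlt; apply/orP; left; apply/eqP; ring.
Qed.

Lemma enorm_ge0 x : 0 <= enorm x. Proof. exact: sqrtr_ge0. Qed.

Lemma enorm_sqr x : enorm x ^+ 2 = sqnorm x.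
Proof. by rewrite sqr_sqrtr// sqnorm_ge0. Qed.

Lemma vdot_le_enorm a b : vdot a b <= enorm a * enorm b.
Proof.
rewrite -sqrtrM ?sqnorm_ge0// (le_trans (ler_norm _))//.
by rewrite -sqrtr_sqr ler_wsqrtr// cauchy_schwarz.
Qed.

Lemma enormD x y : enorm (x + y) <= enorm x + enorm y.
Proof.
rewrite -[leRHS]ger0_norm ?addr_ge0 ?enorm_ge0// -[leRHS]sqrtr_sqr.
rewrite ler_wsqrtr// sqnormD sqrrD !enorm_sqr.
by have := vdot_le_enorm x y; lra.
Qed.

Lemma enormN x : enorm (- x) = enorm x.
Proof. by rewrite /enorm sqnormN. Qed.

Lemma enormB x y : enorm (x - y) = enorm (y - x).
Proof. by rewrite -enormN opprB. Qed.

Lemma enormZ s x : enorm (s *: x) = `|s| * enorm x.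
Proof. by rewrite /enorm sqnormZ sqrtrM ?sqr_ge0// sqrtr_sqr. Qed.

Lemma enorm0 : enorm (0 : 'rV[R]_n) = 0.
Proof. by rewrite /enorm sqnorm0 sqrtr0. Qed.

Lemma enorm_eq0 x : enorm x = 0 -> x = 0.
Proof. by move=> x0; apply: sqnorm_eq0; rewrite -enorm_sqr x0 expr2 mul0r. Qed.

Lemma enorm_gt0 x : x != 0 -> 0 < enorm x.
Proof.
move=> x0; rewrite lt_def enorm_ge0 andbT; apply: contra x0 => /eqP/enorm_eq0.
by move=> ->.
Qed.

Lemma enorm_triangle y x z : enorm (x - z) <= enorm (x - y) + enorm (y - z).
Proof. by rewrite (le_trans _ (enormD _ _))// addrA subrK. Qed.

Lemma mx_norm_le_enorm x : `|x| <= enorm x.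
Proof.
rewrite [leLHS]/Num.norm/= mx_normrE; apply/bigmax_leP; split=> [|[j i] _ /=].
  exact: enorm_ge0.
by rewrite (ord1 j) -sqrtr_sqr ler_wsqrtr// coord_le_sqnorm.
Qed.

Lemma vdot_unit x i : vdot x (unit_vec i) = x 0 i.
Proof.
rewrite /vdot (bigD1 i)//= big1 => [|j ji]; last first.
  by rewrite mxE (negbTE ji) andbF mulr0.
by rewrite mxE !eqxx mulr1 addr0.
Qed.

Lemma sqnormD_unit x i s :
  sqnorm (x + s *: unit_vec i) = sqnorm x + 2 * s * x 0 i + s ^+ 2.
Proof.
have d2 : sqnorm (unit_vec i) = 1 :> R.
  rewrite /sqnorm (bigD1 i)//= big1 => [|j ji]; last first.
    by rewrite mxE (negbTE ji) andbF expr0n.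
  by rewrite mxE !eqxx expr1n addr0.
by rewrite sqnormD sqnormZ vdotZr vdot_unit d2 mulr1 mulrA.
Qed.

Lemma continuous_sqnorm : continuous (@sqnorm R n).
Proof.
move=> x; rewrite /sqnorm; apply: (@cvg_sumr _ _ _ (nbhs x)) => i.
by rewrite expr2; apply: cvgM; exact: coord_continuous.
Qed.

Lemma continuous_enorm : continuous (@enorm R n).
Proof.
move=> x; apply: (continuous_comp (f := @sqnorm R n) (g := @Num.sqrt R)).
  exact: continuous_sqnorm.
exact: sqrt_continuous.
Qed.

Lemma continuous_enormB a : continuous (fun y : 'rV[R]_n => enorm (y - a)).
Proof.
move=> x.
apply: (continuous_comp (f := fun y : 'rV[R]_n => y - a) (g := @enorm R n)).
  exact: continuous_translation.
exact: continuous_enorm.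
Qed.

Lemma continuous_vdot a : continuous (vdot a).
Proof.
move=> x; rewrite /vdot; apply: (@cvg_sumr _ _ _ (nbhs x)) => i.
by apply: cvgM; [exact: cvg_cst|exact: coord_continuous].
Qed.

End euclidean_norm.

(** * Convex open sets *)

Definition segment_closed {R : realType} {V : lmodType R} (A : set V) :=
  forall x y (l : R), A x -> A y -> 0 <= l <= 1 -> A (x + l *: (y - x)).

Section convex_sets.
Context {R : realType} {n : nat}.
Implicit Types (A Omega : set 'rV[R]_n) (x y z c : 'rV[R]_n).

Lemma convex_segment_closed A :
  convex_set (A : set (convex_lmodType 'rV[R]_n)) -> segment_closed A.
Proof.
move=> cA x y l Ax Ay /andP[l0 l1].
have l01 : 0 <= 1 - l <= 1 by rewrite subr_ge0 l1 gerBl.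
have := cA x y (Itv01 (proj1 (andP l01)) (proj2 (andP l01))) (mem_set Ax) (mem_set Ay).
rewrite inE; congr A.
rewrite /conv/= /GRing.scale/=.
by apply/rowP => i; rewrite !mxE /=; rewrite ?/unstable.onem; ring.
Qed.

Lemma continuous_segment (l : R) :
  continuous (fun p : 'rV[R]_n * 'rV[R]_n => p.1 + l *: (p.2 - p.1)).
Proof.
move=> p; apply: cvgD; first exact: cvg_fst.
by apply: cvgZr; apply: cvgB; [exact: cvg_snd|exact: cvg_fst].
Qed.

Lemma closure_segment_closed A : segment_closed A -> segment_closed (closure A).
Proof.
move=> cA x y l Ax Ay l01 B nB.
have [[U V]/= [Ux Vy] UV] := @continuous_segment l (x, y) _ nB.
have [x' [Ax' Ux']] := Ax _ Ux.
have [y' [Ay' Vy']] := Ay _ Vy.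
exists (x' + l *: (y' - x')); split; first exact: cA.
by apply: (UV (x', y')).
Qed.

(** Otherwise [x] would lie strictly between the interior point [c] and a point of
    the closure, hence in [Omega]. *)
Lemma exterior_point Omega c x (k : R) : open Omega -> segment_closed Omega ->
  Omega c -> ~ Omega x -> 0 < k -> ~ closure Omega (x + k *: (x - c)).
Proof.
move=> oO cO Oc nOx k0 cl; apply: nOx.
set z := x + _ in cl.
(* For [z'] in [Omega] near [z], the point [x] divides the segment from [h z'] to [z']
   in the ratio [l], and [h z'] is near [c]. *)
pose l := (1 + k)^-1.
have k1 : 1 + k != 0 by rewrite lt0r_neq0// addr_gt0.
have l01 : 0 <= l <= 1.
  by apply/andP; rewrite invr_ge0 invf_le1 ?addr_gt0//; split; lra.
pose h (z' : 'rV[R]_n) : 'rV[R]_n := c + k^-1 *: (z - z').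
have hc : continuous h.
  rewrite (_ : h = fun z' => (c + k^-1 *: z) + (- k^-1) *: z').
    exact: continuous_affine.
  by apply/funext => z'; rewrite /h scalerBr scaleNr addrA.
have hz : h z = c by rewrite /h subrr scaler0 addr0.
have nz : nbhs z (h @^-1` Omega).
  by apply: hc; rewrite hz; apply: open_nbhs_nbhs; split.
have [z' [Oz' /= Ohz']] := cl _ nz.
have -> : x = h z' + l *: (z' - h z').
  apply/rowP => i; rewrite /h /z !mxE /l.
  by field; rewrite k1 lt0r_neq0.
exact: cO.
Qed.

Lemma closest_point A z : closed A -> A !=set0 ->
  exists2 p, A p & forall y, A y -> sqnorm (p - z) <= sqnorm (y - z).
Proof.
move=> clA [y0 Ay0].
pose K := A `&` [set y | sqnorm (y - z) <= sqnorm (y0 - z)].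
have cz : continuous (fun y => sqnorm (y - z)).
  move=> y; apply: (continuous_comp (f := fun y => y - z) (g := @sqnorm R n)).
    exact: continuous_translation.
  exact: continuous_sqnorm.
have clK : closed K.
  apply: closedI => //.
  rewrite (_ : [set y | _] = (fun y => sqnorm (y - z)) @^-1` [set r | r <= sqnorm (y0 - z)])//.
  by apply: preimage_closed; [move=> y _; exact: cz|exact: closed_le].
have bK : bounded_set K.
  exists (enorm (y0 - z) + enorm z); split; first by rewrite num_real.
  move=> M hM y [_ /= hy].
  apply: le_trans (ltW hM); apply: le_trans (mx_norm_le_enorm _) _.
  rewrite -[y in leLHS](subrK z); apply: le_trans (enormD _ _) _.
  by rewrite lerD2r ler_wsqrtr.
have K0 : K !=set0 by exists y0; split => /=.
have [p pK pmin] := compact_EVT_min K0 (bounded_closed_compact bK clK)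
  (continuous_subspaceT cz).
have [Ap /= hp] := set_mem pK.
exists p => // y Ay.
have [hy|/ltW hy] := leP (sqnorm (y - z)) (sqnorm (y0 - z)).
  by apply: pmin; rewrite inE; split.
exact: le_trans hp hy.
Qed.

(** Otherwise a small step from [p] towards [y] would come closer to [z]. *)
Lemma closest_point_vdot A z p : segment_closed A -> A p ->
  (forall y, A y -> sqnorm (p - z) <= sqnorm (y - z)) ->
  forall y, A y -> 0 <= vdot (p - z) (y - p).
Proof.
move=> cA Ap pmin y Ay; rewrite leNgt; apply/negP => neg.
pose d := vdot (p - z) (y - p); pose q := sqnorm (y - p).
have q0 : 0 <= q by exact: sqnorm_ge0.
have [l [l0 l1 hl]] : exists l : R, [/\ 0 < l, l <= 1 & l * q < - d].
  have q1 : 0 < q + 1 - d by rewrite -/d in neg; lra.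
  exists (- d / (q + 1 - d)); split.
  - by rewrite divr_gt0// oppr_gt0.
  - by rewrite ler_pdivrMr// mul1r; lra.
  - rewrite mulrAC ltr_pdivrMr// ltr_pM2l ?oppr_gt0//.
    by rewrite -/d in neg; lra.
have := pmin _ (cA p y l Ap Ay _).
rewrite (ltW l0) l1 => /(_ isT).
rewrite addrAC (sqnormD _ (_ *: _)) sqnormZ vdotZr -/d -/q.
have : l * (2 * d + l * q) < 0 by rewrite pmulr_rlt0// -/d in neg *; lra.
by rewrite expr2; lra.
Qed.

(** Project a point [z] outside the closure, close to [x], onto the closure.  The
    hyperplane passes as close to [x] as wanted, which is enough for the estimates and
    spares a limit of normal vectors. *)
Lemma supporting_halfspace Omega x (eps : R) : open Omega ->
  segment_closed Omega -> Omega !=set0 -> closure Omega x -> ~ Omega x ->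
  0 < eps -> exists p e, [/\ enorm (p - x) <= eps, sqnorm e = 1 &
    forall y, closure Omega y -> 0 <= vdot e (y - p)].
Proof.
move=> oO cO [c Oc] clx nOx eps0.
pose k := eps / (2 * (enorm (x - c) + 1)).
have N0 : 0 < enorm (x - c) + 1 by have := enorm_ge0 (x - c); lra.
have k0 : 0 < k by rewrite divr_gt0// mulr_gt0.
pose z := x + k *: (x - c).
have nz : ~ closure Omega z by exact: exterior_point.
have [p clp pmin] := @closest_point (closure Omega) z (@closed_closure _ _)
  (ex_intro _ x clx).
have zx : enorm (x - z) = k * enorm (x - c).
  by rewrite /z opprD addrA subrr sub0r enormN enormZ gtr0_norm.
have hk : k * enorm (x - c) <= eps / 2.
  rewrite /k mulrAC ler_pdivrMr ?mulr_gt0//.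
  rewrite mulrA divfK// ler_pM2l//; lra.
have pz0 : 0 < enorm (p - z).
  apply: enorm_gt0; rewrite subr_eq0; apply/eqP => pzE.
  by apply: nz; rewrite -pzE.
exists p, ((enorm (p - z))^-1 *: (p - z)); split.
- apply: le_trans (enorm_triangle z _ _) _.
  have : enorm (p - z) <= enorm (x - z) by rewrite ler_wsqrtr// pmin.
  by rewrite (enormB z x) zx; lra.
- by rewrite sqnormZ -enorm_sqr exprVn mulVf// lt0r_neq0// exprn_gt0.
- move=> y cly; rewrite vdotZl mulr_ge0 ?invr_ge0 ?enorm_ge0//.
  exact: closest_point_vdot (closure_segment_closed cO) clp pmin _ cly.
Qed.

(** The parameters outside [Omega] form a compact set; take the least one. *)
Lemma first_exit Omega z z' : open Omega -> Omega z -> ~ Omega z' ->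
  exists s : R, [/\ 0 < s <= 1, closure Omega (z + s *: (z' - z)) &
    ~ Omega (z + s *: (z' - z))].
Proof.
move=> oO Oz nOz'.
pose w (s : R) := z + s *: (z' - z).
have wc : continuous w.
  exact: continuous_line.
pose S := `[0, 1] `&` w @^-1` (~` Omega).
have cS : compact S.
  apply: subclosed_compact (@segment_compact _ 0 1) _ => //; last by move=> s [].
  apply: closedI; first exact: itv_closed.
  by apply: preimage_closed; [move=> s _; exact: wc|exact: open_closedC].
have S0 : S !=set0.
  exists 1; split; first by rewrite /= in_itv/= ler01 lexx.
  by rewrite /= /w scale1r addrC subrK.
have [s sS smin] := compact_EVT_min S0 cS
  (continuous_subspaceT (fun r : R => @cvg_id R (nbhs r))).
have [/= /[!in_itv]/= /andP[s0 s1] ws] := set_mem sS.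
have s0' : 0 < s.
  rewrite lt_def s0 andbT; apply/eqP => s0E.
  by apply: ws; rewrite s0E /w scale0r addr0.
exists s; split => //; first by rewrite s0' s1.
move=> B nB.
have /= [e /= e0 He] : nbhs s (w @^-1` B) by exact: wc.
pose r := s - Num.min e s / 2.
have m0 : 0 < Num.min e s by rewrite lt_min e0 s0'.
have hm : Num.min e s <= e /\ Num.min e s <= s by rewrite !ge_min !lexx orbT.
exists (w r); split; last first.
  by apply: He => /=; rewrite /r opprB addrCA subrr addr0 ger0_norm; lra.
apply: contrapT => nw.
have : s <= r.
  apply: smin; rewrite inE; split => //=; rewrite in_itv/= /r.
  by apply/andP; split; lra.
by rewrite /r; lra.
Qed.

End convex_sets.

(** * Gradient bounds and Lipschitz bounds *)

Lemma mvt_linear_bound {R : realType} (phi dphi : R -> R) (a b c eps : R) :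
  (forall s, Num.min a b <= s <= Num.max a b ->
    is_derive s 1 phi (dphi s) /\ `|dphi s - c| <= eps) ->
  `|phi b - phi a - c * (b - a)| <= eps * `|b - a|.
Proof.
wlog ab : a b / a <= b => [hw|] H.
  have [/hw|/ltW ba] := leP a b; first exact.
  have -> : phi b - phi a - c * (b - a) = - (phi a - phi b - c * (a - b)) by ring.
  by rewrite normrN (distrC b); apply: hw => // s sab; apply: H; rewrite minC maxC.
have {}H s : s \in `[a, b]%R -> is_derive s 1 phi (dphi s) /\ `|dphi s - c| <= eps.
  by move=> sab; apply: H; rewrite min_l// max_r//; move: sab; rewrite in_itv.
have [||s sI ->] := @MVT_segment _ phi dphi a b ab.
- by move=> s sab; apply: (H s _).1; apply: subset_itv_oo_cc.
- apply: derivable_within_continuous => s sab.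
  by have [[]] := H s sab.
- by rewrite -mulrBl normrM ler_wpM2r// (H s sI).2.
Qed.

Section C1_functions.
Context {R : realType} {n : nat}.
Implicit Types (Omega : set 'rV[R]_n) (v : 'rV[R]_n -> R).

Lemma coord_le_norm (x : 'rV[R]_n) i : `|x 0 i| <= `|x|.
Proof.
rewrite [leRHS]/Num.norm /= mx_normrE.
by apply/bigmax_geP; right => /=; exists (0, i).
Qed.

Lemma norm_unit_vec_le (i : 'I_n) : `|unit_vec i : 'rV[R]_n| <= 1.
Proof.
rewrite [leLHS]/Num.norm/= mx_normrE; apply/bigmax_leP; split=> // -[j k] _ /=.
by rewrite mxE; case: (_ && _); rewrite ?normr1 ?normr0.
Qed.

(** Continuous partial derivatives give all directional derivatives: move along
    the coordinate axes one after the other and apply the mean value theorem to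
    each move. *)
Lemma is_derive_partials Omega v (p : 'I_n -> 'rV[R]_n -> R) x h :
  open Omega -> Omega x ->
  (forall i y, Omega y -> is_derive y (unit_vec i) v (p i y)) ->
  (forall i, {for x, continuous (p i)}) ->
  is_derive x h v (\sum_i p i x * h 0 i).
Proof.
move=> oO Ox dv cp.
have nO : nbhs x Omega by apply: open_nbhs_nbhs.
have key (r : seq 'I_n) : forall eps : R, 0 < eps -> \forall s \near (0 : R),
    `|v (x + s *: (\sum_(i <- r) h 0 i *: unit_vec i)) - v x
      - s * (\sum_(i <- r) p i x * h 0 i)| <= eps * `|s|.
  elim: r => [|i r IH] eps eps0.
    near=> s; rewrite !big_nil scaler0 addr0 subrr sub0r mulr0 oppr0 normr0.
    by rewrite mulr_ge0// ltW.
  set hr := \sum_(j <- r) h 0 j *: unit_vec j in IH.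
  pose eps' := eps / (2 * (`|h 0 i| + 1)).
  have hi1 : 0 < `|h 0 i| + 1 by rewrite ltr_wpDl.
  have eps'0 : 0 < eps' by rewrite divr_gt0// mulr_gt0.
  have : nbhs x (Omega `&` [set y | `|p i y - p i x| <= eps']).
    apply: filterI => //.
    have := cp i; rewrite /prop_for /continuous_at => /cvgrPdist_le/(_ _ eps'0).
    by apply: filterS => y /=; rewrite distrC.
  move=> /nbhs_ballP[d /= d0 Hd].
  have hr1 : 0 < `|hr| + (`|h 0 i| + 1) by rewrite ltr_wpDl.
  have eps20 : 0 < eps / 2 by rewrite divr_gt0.
  near=> s.
  rewrite !big_cons -/hr.
  have sd : `|s| * (`|hr| + (`|h 0 i| + 1)) < d.
    rewrite -ltr_pdivlMr//; near: s.
    exists (d / (`|hr| + (`|h 0 i| + 1))); first by rewrite /= divr_gt0.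
    by move=> s /=; rewrite sub0r normrN.
  have ind : `|v (x + s *: hr) - v x - s * (\sum_(j <- r) p j x * h 0 j)|
      <= eps / 2 * `|s|.
    by near: s; exact: IH.
  have step : `|v (x + s *: hr + (s * h 0 i) *: unit_vec i)
      - v (x + s *: hr + 0 *: unit_vec i)
      - p i x * (s * h 0 i - 0)| <= eps' * `|s * h 0 i - 0|.
    apply: (@mvt_linear_bound _ (fun r => v (x + s *: hr + r *: unit_vec i))
      (fun r => p i (x + s *: hr + r *: unit_vec i))).
    move=> t t0s.
    have ht : `|t| <= `|s| * `|h 0 i|.
      rewrite -normrM; move: t0s; case: (leP 0 (s * h 0 i)) => sh.
        by rewrite ger0_norm// => /andP[t0 ts]; rewrite ger0_norm.
      by rewrite ltr0_norm// => /andP[t0 ts]; rewrite ler0_norm//; lra.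
    have [Oy py] : (Omega `&` [set y | `|p i y - p i x| <= eps'])
        (x + s *: hr + t *: unit_vec i).
      apply: Hd; rewrite -ball_normE /= !opprD !addrA subrr sub0r -opprD normrN.
      apply: le_lt_trans sd; apply: le_trans (ler_normD _ _) _.
      rewrite !normrZ mulrDr lerD2l mulrDr mulr1.
      have := norm_unit_vec_le i; move: ht.
      have := normr_ge0 s; have := normr_ge0 t.
      move: `|t| `|s| `|unit_vec i| (`|s| * _) => a b c e.
      by nra.
    by split=> //; apply: is_derive_line; exact: dv.
  rewrite scale0r addr0 subr0 in step.
  have -> : x + s *: (h 0 i *: unit_vec i + hr)
      = x + s *: hr + (s * h 0 i) *: unit_vec i.
    by rewrite scalerDr scalerA -addrA (addrC (s *: hr)).
  have {}step : `|v (x + s *: hr + (s * h 0 i) *: unit_vec i) - v (x + s *: hr)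
      - p i x * (s * h 0 i)| <= eps / 2 * `|s|.
    have e'h : eps' * `|h 0 i| <= eps / 2.
      rewrite /eps' mulrAC ler_pdivrMr ?mulr_gt0//.
      by have := normr_ge0 (h 0 i); move: `|h 0 i| => a a0; nra.
    by apply: le_trans step _; rewrite normrM (mulrC `|s|) mulrA ler_wpM2r.
  move: ind step; set A := v (_ + _ *: unit_vec i); set B := v (x + s *: hr).
  move: (\sum_(j <- r) _) => S ind step.
  rewrite (_ : A - v x - _ = (A - B - p i x * (s * h 0 i)) + (B - v x - s * S)).
    apply: le_trans (ler_normD _ _) _.
    by apply: le_trans (lerD step ind) _; rewrite -mulrDl -splitr.
  by ring.
have hE : h = \sum_i h 0 i *: unit_vec i by exact: row_sum_delta.
have lim : (fun s : R => s^-1 *: (v (s *: h + x) - v x)) @ 0^' -->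
    (\sum_i p i x * h 0 i).
  apply/cvgrPdist_le => eps eps0.
  have [e /= e0 He] := key (index_enum 'I_n) eps eps0.
  exists e => //= s hs s0; have := He s hs; rewrite -hE.
  move: (\sum_i _) => S; rewrite (addrC (s *: h)) => hS.
  have sp : 0 < `|s| by rewrite normr_gt0.
  rewrite -(ler_pM2l sp) mulrC (mulrC _ eps); apply: le_trans hS.
  rewrite -normrM -normrN /GRing.scale/=.
  rewrite le_eqVlt; apply/orP; left; apply/eqP; congr (`| _ |).
  by field.
by split; [exact: cvgP lim|exact: cvg_lim lim].
Unshelve. all: by end_near. Qed.

End C1_functions.

Lemma continuous_near_eq {X Y : topologicalType} (f h : X -> Y) (x : X) :
  {for x, continuous h} -> (\forall y \near x, f y = h y) ->
  {for x, continuous f}.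
Proof.
move=> ch fh; rewrite /prop_for /continuous_at (nbhs_singleton fh).
apply: cvg_trans ch; apply: near_eq_cvg.
by apply: filterS fh => y ->.
Qed.

Lemma continuous_interior {X Y : topologicalType} (U : set X) (h : X -> Y) x :
  open U -> {within closure U, continuous h} -> U x -> {for x, continuous h}.
Proof.
move=> oU ch Ux; have : {within U, continuous h}.
  exact: continuous_subspaceW (@subset_closure _ _) ch.
by rewrite continuous_open_subspace// => /(_ x (mem_set Ux)).
Qed.

Section gradient_and_lipschitz.
Context {R : realType} {n : nat}.
Implicit Types (Omega : set 'rV[R]_n) (v f : 'rV[R]_n -> R).

(** The mean value theorem along the segment from [x] to [y], which stays in
    [Omega]. *)
Lemma lipschitz_of_partials Omega v (p : 'I_n -> 'rV[R]_n -> R) (L : R) :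
  open Omega -> segment_closed Omega -> 0 <= L ->
  (forall i y, Omega y -> is_derive y (unit_vec i) v (p i y)) ->
  (forall i y, Omega y -> {for y, continuous (p i)}) ->
  (forall y, Omega y -> \sum_i p i y ^+ 2 <= L ^+ 2) ->
  forall x y, Omega x -> Omega y -> `|v y - v x| <= L * enorm (y - x).
Proof.
move=> oO cO L0 dv cp pL x y Ox Oy.
have := @mvt_linear_bound R (fun s => v (x + s *: (y - x)))
  (fun s => \sum_i p i (x + s *: (y - x)) * (y - x) 0 i) 0 1 0 (L * enorm (y - x)).
have -> : x + 1 *: (y - x) = y by rewrite scale1r addrC subrK.
rewrite scale0r addr0 mul0r !subr0 normr1 mulr1; apply.
move=> s; rewrite min_l// max_r// => s01.
have Os : Omega (x + s *: (y - x)) by exact: cO.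
split => /=.
  apply: is_derive_line.
  exact: (is_derive_partials (y - x) oO Os dv (fun i => cp i _ Os)).
rewrite subr0.
set z := x + _ in Os *; set h := y - x.
have -> : \sum_i p i z * h 0 i = vdot (\row_i p i z) h.
  by apply: eq_bigr => i _; rewrite mxE.
have pz : enorm (\row_i p i z) <= L.
  rewrite -(ger0_norm L0) -sqrtr_sqr ler_wsqrtr//.
  apply: le_trans (pL _ Os); rewrite le_eqVlt; apply/orP; left; apply/eqP.
  by apply: eq_bigr => i _; rewrite mxE.
have B k : vdot (\row_i p i z) k <= L * enorm k.
  by apply: le_trans (vdot_le_enorm _ _) _; rewrite ler_wpM2r// enorm_ge0.
by rewrite ler_norml lerNl -vdotNr B andbT -(enormN h) B.
Qed.

(** In the direction of the gradient, [v] grows at the rate [|grad v|]. *)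
Lemma partials_of_lipschitz Omega v (p : 'I_n -> 'rV[R]_n -> R) (L : R) x :
  open Omega -> Omega x -> 0 <= L ->
  (forall i y, Omega y -> is_derive y (unit_vec i) v (p i y)) ->
  (forall i, {for x, continuous (p i)}) ->
  (forall y, Omega y -> v y - v x <= L * enorm (y - x)) ->
  \sum_i p i x ^+ 2 <= L ^+ 2.
Proof.
move=> oO Ox L0 dv cp vL.
pose h : 'rV[R]_n := \row_i p i x.
have SE : \sum_i p i x * h 0 i = enorm h ^+ 2.
  by rewrite enorm_sqr; apply: eq_bigr => i _; rewrite mxE expr2.
have -> : \sum_i p i x ^+ 2 = enorm h ^+ 2.
  by rewrite -SE; apply: eq_bigr => i _; rewrite mxE expr2.
have dh := is_derive_line0 (is_derive_partials h oO Ox dv cp).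
rewrite SE in dh.
suff hL : enorm h <= L by rewrite lerXn2r// nnegrE enorm_ge0.
rewrite leNgt; apply/negP => Lh.
have h0 : 0 < enorm h by exact: le_lt_trans Lh.
have dphi : is_derive (0 : R) 1 (fun s => v (x + s *: h) - s * (L * enorm h))
    (enorm h ^+ 2 - L * enorm h).
  apply: is_deriveB; rewrite -[X in is_derive _ _ _ X]mul1r.
  have -> : (fun s : R => s * (L * enorm h)) = (L * enorm h) \*: id.
    by apply/funext => s; rewrite /GRing.scale/= mulrC.
  by apply: is_derive_eq; rewrite /GRing.scale/= mulr1 mul1r.
have pos : 0 < enorm h ^+ 2 - L * enorm h.
  by rewrite expr2 -mulrBl mulr_gt0// subr_gt0.
have hpos := is_derive_near_gt dphi pos.
suff : \forall s \near (0 : R)^'+, False by move=> /filter_ex[].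
have nO : \forall s \near (0:R), Omega (x + s *: h).
  have := @continuous_line _ _ x h (0 : R) Omega.
  rewrite scale0r addr0; apply; exact: open_nbhs_nbhs.
have {}nO : \forall s \near (0:R)^'+, Omega (x + s *: h) by exact: cvg_within nO.
near=> s.
have [+ _] : v (x + 0 *: h) - 0 * (L * enorm h) < v (x + (0 + s) *: h) - (0 + s) * (L * enorm h) /\
   v (x + (0 - s) *: h) - (0 - s) * (L * enorm h) < v (x + 0 *: h) - 0 * (L * enorm h).
  by near: s.
rewrite scale0r addr0 mul0r subr0 add0r ltNge => /negP; apply.
have Os : Omega (x + s *: h) by near: s.
have s0 : 0 < s by near: s; exact: nbhs_right_gt.
have := vL _ Os; rewrite addrAC subrr add0r enormZ gtr0_norm//.
by lra.
Unshelve. all: by end_near. Qed.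

Lemma closure_approx Omega f x (eps : R) :
  {within closure Omega, continuous f} -> closure Omega x -> 0 < eps ->
  exists2 x', Omega x' & `|f x' - f x| <= eps /\ enorm (x' - x) <= eps.
Proof.
move=> /subspace_continuousP cf clx eps0.
have n1 : \forall y \near x, closure Omega y -> `|f x - f y| <= eps.
  by have /cvgrPdist_le/(_ _ eps0) := cf _ clx.
have n2 : \forall y \near x, enorm (y - x) <= eps.
  have c := @continuous_enormB _ _ x x.
  move: c; rewrite /prop_for /continuous_at subrr enorm0 => /cvgrPdist_le/(_ _ eps0).
  by apply: filterS => y; rewrite sub0r normrN ger0_norm// enorm_ge0.
have [x' [Ox' [h1 h2]]] := clx _ (filterI n1 n2).
exists x' => //; split=> //; rewrite distrC; apply: h1.
exact: subset_closure.
Qed.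

Lemma lipschitz_closure Omega v (L : R) : 0 <= L ->
  {within closure Omega, continuous v} ->
  (forall x y, Omega x -> Omega y -> `|v y - v x| <= L * enorm (y - x)) ->
  forall x y, closure Omega x -> closure Omega y ->
    `|v y - v x| <= L * enorm (y - x).
Proof.
move=> L0 cv vL x y clx cly; apply/ler_addgt0Pl => eps eps0.
pose d := eps / (2 + 2 * L).
have d0 : 0 < d by rewrite divr_gt0//; lra.
have dE : d * (2 + 2 * L) = eps by rewrite divfK// gt_eqF//; lra.
have [x' Ox' [vx' xx']] := closure_approx cv clx d0.
have [y' Oy' [vy' yy']] := closure_approx cv cly d0.
have tri : enorm (y' - x') <= enorm (y - x) + 2 * d.
  have := enorm_triangle y y' x'; have := enorm_triangle x y x'.
  by rewrite (enormB x x'); lra.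
have := vL _ _ Ox' Oy' => vv.
have {}vv : `|v y' - v x'| <= L * enorm (y - x) + 2 * d * L.
  apply: le_trans vv _; rewrite (mulrC _ L) -mulrDr; exact: ler_wpM2l.
rewrite (_ : v y - v x = (v y' - v x') + ((v x' - v x) - (v y' - v y))); last by ring.
apply: le_trans (ler_normD _ _) _.
have : `|(v x' - v x) - (v y' - v y)| <= d + d.
  by apply: le_trans (ler_normB _ _) _; exact: lerD.
by move: vv; lra.
Qed.

Lemma gradient_extension Omega v (h : 'rV[R]_n -> R) i x :
  {within closure Omega, continuous h} ->
  {in Omega, 'D_(unit_vec i) v =1 h} -> closure Omega x ->
  gradient Omega v x 0 i = h x.
Proof.
move=> /subspace_continuousP ch vh clx; rewrite mxE.
have PF : ProperFilter (within Omega (nbhs x)) by exact: within_nbhs_proper.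
apply: cvg_lim => //.
have hx : h y @[y --> within Omega (nbhs x)] --> h x.
  apply: cvg_trans (ch _ clx); apply: cvg_app.
  exact: within_subset (@subset_closure _ _).
apply: cvg_trans hx; apply: near_eq_cvg.
have := withinT Omega (nbhs_filter x).
by apply: filterS => y Oy; rewrite vh// inE.
Qed.

Lemma gradient_interior Omega v i x : C1_closure Omega v -> Omega x ->
  gradient Omega v x 0 i = 'D_(unit_vec i) v x.
Proof.
move=> [_ _ /(_ i)[h ch vh]] Ox.
rewrite (gradient_extension ch vh (subset_closure Ox)) vh//.
by rewrite inE.
Qed.

Lemma continuous_partial Omega v i x : open Omega -> C1_closure Omega v ->
  Omega x -> {for x, continuous ('D_(unit_vec i) v)}.
Proof.
move=> oO [_ _ /(_ i)[h ch vh]] Ox.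
have nO : nbhs x Omega by exact: open_nbhs_nbhs.
have cx := continuous_interior oO ch Ox.
by apply: continuous_near_eq cx _; apply: filterS nO => y Oy; rewrite vh// inE.
Qed.

(** The gradient at the boundary is the limit of interior gradients, so the
    inequality passes to the closure by continuity. *)
Lemma energy_le_closure Omega (F : R -> R) v (c : R) :
  C1_closure Omega v ->
  {within closure Omega, continuous (F \o v)} ->
  (forall x, Omega x ->
    2^-1 * (\sum_i ('D_(unit_vec i) v x) ^+ 2) + F (v x) <= c) ->
  energy_le Omega F v c.
Proof.
move=> C1v cF H; split => // x clx.
have [_ _ ex] := C1v.
have /choice[h hE] : forall i, exists h : 'rV[R]_n -> R,
    {within closure Omega, continuous h} /\ {in Omega, 'D_(unit_vec i) v =1 h}.
  by move=> i; have [h] := ex i; exists h.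
pose E y := 2^-1 * (\sum_i h i y ^+ 2) + F (v y).
have cE : {within closure Omega, continuous E}.
  apply/subspace_continuousP => y cly; apply: cvgD; last first.
    by move/subspace_continuousP : cF; exact.
  apply: cvgM; first exact: cvg_cst.
  apply: (@cvg_sumr _ _ _ (within (closure Omega) (nbhs y))) => i.
  have /subspace_continuousP/(_ _ cly) := (hE i).1.
  by move=> ci; rewrite expr2; under eq_fun do rewrite expr2; apply: cvgM.
have -> : 2^-1 * sqnorm (gradient Omega v x) + F (v x) = E x.
  congr (_ * _ + _); apply: eq_bigr => i _.
  by rewrite (gradient_extension (hE i).1 (hE i).2).
apply/ler_addgt0Pr => eps eps0.
have [x' Ox' [hx _]] := closure_approx cE clx eps0.
have := H _ Ox'.
have <- : E x' = 2^-1 * (\sum_i ('D_(unit_vec i) v x') ^+ 2) + F (v x').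
  by congr (_ * _ + _); apply: eq_bigr => i _; rewrite (hE i).2// inE.
by move: hx; rewrite ler_norml => /andP[]; lra.
Qed.

End gradient_and_lipschitz.

(** * The one-dimensional stationary profile *)

Lemma is_derive_continuous {R : realType} (phi : R -> R) (x l : R) :
  is_derive x 1 phi l -> {for x, continuous phi}.
Proof.
by case=> /derivable1_diffP dphi _; exact: differentiable_continuous.
Qed.

Section antiderivative.
Context {R : realType}.
Notation mu := (@lebesgue_measure R).

Lemma continuous_integrable (k : R -> R) (b a z : R) : b < a ->
  (forall y, b < y -> {for y, continuous k}) ->
  mu.-integrable `[a, z] (EFin \o k).
Proof.
move=> ba ck; apply: continuous_compact_integrable; first exact: segment_compact.
apply: continuous_in_subspaceT => y; rewrite inE/= in_itv/= => /andP[ay _].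
exact/ck/(lt_le_trans ba).
Qed.

Lemma is_derive_integral (k : R -> R) (b a z : R) : b < a -> a < z ->
  (forall y, b < y -> {for y, continuous k}) ->
  is_derive z 1 (fun x => \int[mu]_(t in `[a, x]) k t) (k z).
Proof.
move=> ba az ck.
have zz : z < z + 1 by rewrite ltrDl.
have [d e] := continuous_FTC1_closed zz (continuous_integrable (z + 1) ba ck) az
  (ck z (lt_trans ba az)).
by split; [exact: d|rewrite -derive1E; exact: e].
Qed.

Lemma integral_itvB (k : R -> R) (b a x z : R) : b < a -> a <= x -> x <= z ->
  (forall y, b < y -> {for y, continuous k}) ->
  \int[mu]_(t in `[x, z]) k t =
  \int[mu]_(t in `[a, z]) k t - \int[mu]_(t in `[a, x]) k t.
Proof.
move=> ba ax xz ck.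
rewrite Rintegral_itvB ?bnd_simp//; last exact: continuous_integrable ba ck.
rewrite Rintegral_itv_obnd_cbnd//.
apply: integrableS (continuous_integrable z ba ck) => //.
by apply: subset_itvr; rewrite bnd_simp.
Qed.

End antiderivative.

Section source_and_primitive.
Context {R : realType} (f : R -> R).
Hypothesis C1f : C1_nonneg f.
Hypothesis f_gt0 : forall s : R, 0 < s -> 0 < f s.

(** A constant extension to [s < 0] makes [f], hence its primitive, regular on both
    sides of [0], where [u] vanishes. *)
Definition ext0 (s : R) : R := f (Num.max s 0).

Lemma ext0E s : 0 <= s -> ext0 s = f s.
Proof. by move=> s0; rewrite /ext0 max_l. Qed.

Lemma C1_nonneg_cvg s : 0 <= s ->
  forall eps, 0 < eps -> exists2 d, 0 < d &
    forall h, `|h| < d -> 0 <= s + h -> `|f (s + h) - f s| <= eps.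
Proof.
have [f' _ df] := C1f; move=> s0 eps eps0.
have /cvgrPdist_lt/(_ _ ltr01)[e /= e0 He] := df s s0.
have k0 : 0 < `|f' s| + 1 by rewrite ltr_wpDl.
exists (Num.min e (eps / (`|f' s| + 1))); first by rewrite lt_min e0 divr_gt0.
move=> h; rewrite lt_min => /andP[he hk] sh.
have [->|h0] := eqVneq h 0; first by rewrite addr0 subrr normr0 ltW.
have := He h; rewrite /= sub0r normrN => /(_ he h0 sh) hlt.
set q := h^-1 * _ in hlt.
have -> : f (s + h) - f s = h * q by rewrite /q mulVKf.
have qk : `|q| <= `|f' s| + 1.
  rewrite -(subrK (f' s) q) addrC; apply: le_trans (ler_normD _ _) _.
  by rewrite lerD2l distrC ltW.
rewrite normrM; apply: le_trans (ler_wpM2l (normr_ge0 _) qk) _.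
by rewrite -ler_pdivlMr// ltW.
Qed.

Lemma continuous_ext0 : continuous ext0.
Proof.
move=> s; apply/cvgrPdist_le => eps eps0.
have m0 : 0 <= Num.max s 0 by rewrite le_max lexx orbT.
have [d d0 Hd] := C1_nonneg_cvg m0 eps0.
exists d => //= y ys.
have -> : ext0 y = f (Num.max s 0 + (Num.max y 0 - Num.max s 0)).
  by rewrite addrC subrK.
rewrite distrC; apply: Hd; last by rewrite addrC subrK le_max lexx orbT.
apply: le_lt_trans ys; rewrite distrC ler_norml.
have := ler_norm (y - s); have := ler_norm (s - y); rewrite (distrC s y).
move=> h1 h2; have := normr_ge0 (y - s) => h3.
by apply/andP; case: (leP s 0) => s0; case: (leP y 0) => y0; split; lra.
Qed.

Let cext (y : R) : -2 < y -> {for y, continuous ext0}.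
Proof. by move=> _; exact: continuous_ext0. Qed.

Let m2 : -2 < -1 :> R. Proof. by lra. Qed.

(** Integrating from [-1], then subtracting, gives a primitive that is differentiable
    at [0] and at points slightly below. *)
Definition primitive_ext (z : R) : R :=
  \int[lebesgue_measure]_(s in `[-1, z]) ext0 s -
  \int[lebesgue_measure]_(s in `[-1, 0]) ext0 s.

Lemma primitive_extE z : 0 <= z -> primitive_ext z = primitive f z.
Proof.
move=> z0; rewrite /primitive_ext -(integral_itvB m2 _ _ cext)//.
apply: eq_Rintegral => s; rewrite inE/= in_itv/= => /andP[s0 _].
exact: ext0E.
Qed.

Lemma is_derive_primitive_ext (z : R) : -1 < z ->
  is_derive z 1 primitive_ext (ext0 z).
Proof.
move=> z1; rewrite /primitive_ext -[ext0 z]subr0.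
by apply: is_deriveB; exact: is_derive_integral m2 z1 cext.
Qed.

Lemma primitive_lt (a b : R) : 0 <= a -> a < b -> primitive f a < primitive f b.
Proof.
move=> a0 ab; have b0 : 0 <= b by lra.
rewrite -!primitive_extE// -subr_gt0.
have [||s sI ->] := @MVT _ primitive_ext ext0 a b ab.
- by move=> s; rewrite in_itv/= => /andP[as_ _]; apply: is_derive_primitive_ext; lra.
- apply: derivable_within_continuous => s; rewrite in_itv/= => /andP[as_ _].
  by have [] : is_derive s 1 primitive_ext (ext0 s) by apply: is_derive_primitive_ext; lra.
- move: sI; rewrite in_itv/= => /andP[as_ _].
  by rewrite mulr_gt0 ?subr_gt0// ext0E ?f_gt0//; lra.
Qed.

Lemma primitive_le (a b : R) : 0 <= a -> a <= b -> primitive f a <= primitive f b.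
Proof.
move=> a0; rewrite le_eqVlt => /predU1P[->//|ab].
exact/ltW/primitive_lt.
Qed.

Lemma primitive_le_inv (a b : R) : 0 <= a -> 0 <= b ->
  primitive f a <= primitive f b -> a <= b.
Proof.
by move=> a0 b0; rewrite leNgt; case: (leP a b) => // ba; rewrite primitive_lt.
Qed.

Lemma primitive_ge0 (a : R) : 0 <= a -> 0 <= primitive f a.
Proof.
move=> a0; have := primitive_le (lexx 0) a0.
by rewrite -(primitive_extE (lexx 0)) /primitive_ext subrr.
Qed.

Section profile.
Variables (m E : R).
Hypotheses (m_ge0 : 0 <= m) (mE : primitive f m < E).

(** The value of [1 / phi'] at the height [phi = z], where [phi] is the stationary
    solution [phi'' + f(phi) = 0] of energy [phi'^2 / 2 + F(phi) = E].  The truncation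
    by [(E - F(m)) / 2] is inactive for [0 <= z <= m] and makes this a continuous
    function of all [z > -1]. *)
Definition slope_inv (z : R) : R :=
  (Num.sqrt (2 * Num.max (E - primitive_ext z) ((E - primitive f m) / 2)))^-1.

(** The inverse of [phi]: the abscissa at which the profile reaches the height [z].
    Starting the integrals at [-1/2] makes it differentiable at [z = 0]. *)
Definition travel (z : R) : R :=
  \int[lebesgue_measure]_(s in `[-(2^-1), z]) slope_inv s -
  \int[lebesgue_measure]_(s in `[-(2^-1), 0]) slope_inv s.

Let arg_gt0 z : 0 < 2 * Num.max (E - primitive_ext z) ((E - primitive f m) / 2).
Proof. by rewrite mulr_gt0// lt_max divr_gt0// ?subr_gt0// orbT. Qed.

Lemma slope_inv_gt0 z : 0 < slope_inv z.
Proof. by rewrite invr_gt0 sqrtr_gt0. Qed.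

Lemma continuous_slope_inv (z : R) : -1 < z -> {for z, continuous slope_inv}.
Proof.
move=> z1; apply: cvgV; first by rewrite gt_eqF// sqrtr_gt0.
apply: (continuous_comp (f := fun z => 2 * Num.max (E - primitive_ext z) ((E - primitive f m) / 2))
  (g := @Num.sqrt R)); last exact: sqrt_continuous.
apply: cvgM; first exact: cvg_cst.
apply: (@continuous_max R _ (fun z => E - primitive_ext z) (fun=> (E - primitive f m) / 2)).
  apply: cvgB; first exact: cvg_cst.
  exact: is_derive_continuous (is_derive_primitive_ext z1).
exact: cvg_cst.
Qed.

Let cslope (y : R) : -1 < y -> {for y, continuous slope_inv}.
Proof. exact: continuous_slope_inv. Qed.

Let m1 : -1 < - (2^-1) :> R. Proof. by lra. Qed.

Lemma travel0 : travel 0 = 0.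
Proof. by rewrite /travel subrr. Qed.

Lemma is_derive_travel (z : R) : - (2^-1) < z -> is_derive z 1 travel (slope_inv z).
Proof.
move=> z1; rewrite /travel -[slope_inv z]subr0.
by apply: is_deriveB; exact: is_derive_integral m1 z1 cslope.
Qed.

Let trunc (z : R) : 0 <= z <= m ->
  E - primitive f m <= E - primitive_ext z.
Proof.
move=> /andP[z0 zm]; rewrite primitive_extE//.
by have := primitive_le z0 zm; lra.
Qed.

Let trunc_half (z : R) : 0 <= z <= m ->
  (E - primitive f m) / 2 < E - primitive_ext z.
Proof.
move=> zm; apply: lt_le_trans (trunc zm).
have : 0 < E - primitive f m by rewrite subr_gt0.
by move: (E - _) => e; lra.
Qed.

Let pos (z : R) : 0 <= z <= m -> 0 < 2 * (E - primitive_ext z).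
Proof.
move=> zm; rewrite mulr_gt0//; apply: lt_le_trans (trunc zm).
by rewrite subr_gt0.
Qed.

Lemma slope_inv_sqr (z : R) : 0 <= z <= m ->
  slope_inv z ^+ 2 * (2 * (E - primitive f z)) = 1.
Proof.
move=> zm; have z0 : 0 <= z by case/andP: zm.
rewrite -(primitive_extE z0) exprVn sqr_sqrtr; last exact/ltW.
by rewrite max_l ?(ltW (trunc_half zm))// mulVf// gt_eqF// pos.
Qed.

(** The equation [phi'' = - f(phi)], written for the inverse function of [phi]. *)
Lemma is_derive_slope_inv (z : R) : 0 <= z <= m ->
  is_derive z 1 slope_inv (f z * slope_inv z ^+ 3).
Proof.
move=> zm; have z0 : 0 <= z by case/andP: zm.
have z1 : -1 < z by lra.
pose s0 z := (Num.sqrt (2 * (E - primitive_ext z)))^-1.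
have hz : 0 < 2 * (E - primitive_ext z).
  exact: pos.
have d0 : is_derive z 1 (fun y => 2 * (E - primitive_ext y)) (- 2 * f z).
  have dP := is_derive_primitive_ext z1.
  rewrite ext0E// in dP.
  have -> : (fun y => 2 * (E - primitive_ext y)) = 2 \*: (cst E \- primitive_ext).
    by apply/funext => y.
  apply: is_derive_eq.
  by rewrite sub0r /GRing.scale/=; ring.
have d1 := is_derive1_comp (f := @Num.sqrt R)
  (g := fun y => 2 * (E - primitive_ext y)) (is_derive1_sqrt hz) d0.
have sq0 : Num.sqrt (2 * (E - primitive_ext z)) != 0 by rewrite gt_eqF// sqrtr_gt0.
have d2 := is_deriveV (f := Num.sqrt \o (fun y => 2 * (E - primitive_ext y))) sq0 d1.
have E0 : slope_inv z = s0 z.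
  by rewrite /slope_inv /s0 max_l// ltW// trunc_half.
have near_eq : \forall y \near z, slope_inv y = s0 y.
  have c : {for z, continuous (fun y => E - primitive_ext y)}.
    apply: (@continuousB _ R _ (cst E) primitive_ext).
      exact: cst_continuous.
    exact: is_derive_continuous (is_derive_primitive_ext z1).
  have he : (E - primitive f m) / 2 < E - primitive_ext z by exact: trunc_half.
  near=> y; rewrite /slope_inv /s0 max_l// ltW//.
  by near: y; exact: cvgr_gt c _ he.
have {}near_eq : \forall y \near z, s0 y = slope_inv y.
  by near=> y; apply/esym; near: y.
apply: (near_eq_is_derive near_eq); apply: is_derive_eq.
rewrite E0 /s0 /GRing.scale/=.
by field.
Unshelve. all: by end_near. Qed.

Lemma travel_lipschitz a b Q : 0 <= a <= m -> 0 <= b <= m ->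
  (forall z, 0 <= z <= m -> slope_inv z <= Q) ->
  `|travel b - travel a| <= Q * `|b - a|.
Proof.
move=> /andP[a0 am] /andP[b0 bm] hQ.
have := @mvt_linear_bound R travel slope_inv a b 0 Q.
rewrite mul0r subr0; apply => s; rewrite ge_min le_max => /andP[s1 s2].
have sm : 0 <= s <= m.
  by apply/andP; split; [case/orP: s1|case/orP: s2]; lra.
split; first by apply: is_derive_travel; lra.
by rewrite subr0 ger0_norm ?hQ// ltW// slope_inv_gt0.
Qed.

Lemma travel_ge0 (z : R) : 0 <= z <= m -> 0 <= travel z.
Proof.
move=> /andP[z0 zm].
have [||s sI] := @MVT_segment _ travel slope_inv 0 z z0.
- by move=> s; rewrite in_itv/= => /andP[s0 _]; apply: is_derive_travel; lra.
- apply: derivable_within_continuous => s; rewrite in_itv/= => /andP[s0 _].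
  by have [] : is_derive s 1 travel (slope_inv s) by apply: is_derive_travel; lra.
- by rewrite travel0 !subr0 => ->; rewrite mulr_ge0// ltW// slope_inv_gt0.
Qed.

(** [Q] bounds both the Lipschitz constant of [travel] and the coefficient [a] of the
    equation solved by [travel (u)]. *)
Lemma slope_inv_bounds : exists Q, forall z, 0 <= z <= m ->
  slope_inv z <= Q /\ f z * slope_inv z <= Q.
Proof.
have cI (k : R -> R) : (forall y, -1 < y -> {for y, continuous k}) ->
    {within `[0, m], continuous k}.
  move=> ck; apply: continuous_in_subspaceT => y; rewrite inE/= in_itv/= => /andP[y0 _].
  by apply: ck; lra.
have [c _ hc] := EVT_max m_ge0 (cI _ cslope).
have [d _ hd] : exists2 d, d \in `[0, m]%R & forall t, t \in `[0, m]%R ->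
    ext0 t * slope_inv t <= ext0 d * slope_inv d.
  apply: (EVT_max m_ge0 (f := fun t => ext0 t * slope_inv t)).
  apply: cI => y y1; apply: cvgM; first exact: continuous_ext0.
  exact: cslope.
exists (Num.max (slope_inv c) (ext0 d * slope_inv d)) => z zm.
rewrite !le_max hc ?in_itv//=; split=> //.
by rewrite -ext0E ?hd ?in_itv ?orbT//; case/andP: zm.
Qed.

End profile.
End source_and_primitive.

(** * Lebesgue measure on Euclidean space *)

Section lebesgue_measure_of_rV.
Context {R : realType}.

Definition cube {n : nat} (c : 'rV[R]_n) (r : R) : set 'rV[R]_n :=
  [set x | forall i, `|x 0 i - c 0 i| < r].

Lemma cube_ball {n : nat} (c : 'rV[R]_n) (r : R) : 0 < r -> cube c r = ball c r.
Proof.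
move=> r0; apply/seteqP; split=> x /=.
  move=> h; split=> // i j; rewrite (ord1 i) -ball_normE/= distrC.
  exact: h.
by move=> [_ h] i; have := h 0 i; rewrite -ball_normE/= distrC.
Qed.

Lemma measurable_cube {n : nat} (c : 'rV[R]_n) (r : R) : measurable (cube c r).
Proof.
have -> : cube c r =
    \bigcap_(i in [set: 'I_n]) ((@rV_coord R n i) @^-1` (ball (c 0 i) r)).
  apply/seteqP; split=> [x h i _|x h i].
    by rewrite -ball_normE/= distrC; exact: h.
  by have := h i I; rewrite -ball_normE/= distrC.
apply: fin_bigcap_measurable => // i _.
rewrite -[X in measurable X]setTI.
by apply: measurable_rV_coord => //; exact: measurable_ball.
Qed.

(** An open set is the union of the countably many cubes with rational centre and
    radius [1 / (k + 1)] that it contains. *)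
Lemma open_measurable_rV {n : nat} (U : set 'rV[R]_n) : open U -> measurable U.
Proof.
move=> oU.
pose F (qk : 'rV[rat]_n * nat) : set 'rV[R]_n :=
  let C := cube (map_mx ratr qk.1) qk.2.+1%:R^-1 in
  if pselect (C `<=` U) then C else set0.
have -> : U = \bigcup_qk F qk.
  apply/seteqP; split=> [x Ux|x [qk _]]; last first.
    by rewrite /F; case: pselect => // CU /CU.
  have /nbhs_ballP[e /= e0 xeU] : nbhs x U by apply: open_nbhs_nbhs.
  have [k hk] : exists k : nat, k.+1%:R^-1 < e / 2.
    exists (Num.truncn (e / 2)^-1).
    by rewrite invf_plt ?posrE ?divr_gt0// truncnS_gt.
  have k0 : 0 < k.+1%:R^-1 :> R by rewrite invr_gt0.
  have kE : exists2 r : R, r = k.+1%:R^-1 & 0 < r < e / 2.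
    by exists k.+1%:R^-1 => //; rewrite k0.
  have {k0 hk}[r rE /andP[r0 re]] := kE.
  have /choice[q hq] : forall i, exists q : rat, `|x 0 i - ratr q| < r.
    move=> i; have [|q] := @rat_in_itvoo R (x 0 i - r) (x 0 i + r).
      by lra.
    by rewrite in_itv/= => /andP[h1 h2]; exists q; rewrite ltr_norml; lra.
  exists (\row_i q i, k) => //; rewrite /F /= -rE.
  have xC : cube (map_mx ratr (\row_i q i)) r x.
    by move=> i; rewrite !mxE.
  case: pselect => // -[]; apply: subset_trans xeU => y yC.
  rewrite -cube_ball// => i; have := yC i; have := xC i; rewrite !mxE => h1 h2.
  rewrite -(subrK (ratr (q i)) (y 0 i)) -addrA; apply: le_lt_trans (ler_normD _ _) _.
  by move: h2; rewrite (distrC (ratr _)); move: h1; lra.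
apply: countable_bigcupT_measurable.
  exact: countableP.
move=> qk.
rewrite /F; case: (pselect (_ `<=` U)) => /= _; last exact: measurable0.
exact: measurable_cube.
Qed.

Lemma continuous_measurable_rV {n : nat} (D : set 'rV[R]_n) (f : 'rV[R]_n -> R) :
  open D -> {in D, continuous f} -> measurable_fun D f.
Proof.
move=> oD cf; apply: (measurability _ (RGenOpens.measurableE R)).
move=> _ [_ [a [b ->] <-]].
apply: open_measurable_rV; rewrite openE => x [Dx fx].
have nf : nbhs x (f @^-1` `]a, b[).
  by apply: (cf x (mem_set Dx)); apply: open_nbhs_nbhs; split=> //; exact: itv_open.
by apply: filterI => //; apply: open_nbhs_nbhs.
Qed.

Lemma lebesgue_measure_translation (c : R) (A : set (measurableTypeR R)) :
  measurable A ->
  lebesgue_measure ((fun x : measurableTypeR R => x + c : measurableTypeR R) @^-1` A)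
  = lebesgue_measure A.
Proof.
pose tr := fun x : measurableTypeR R => x + c : measurableTypeR R.
have mtr : measurable_fun setT tr by apply: measurable_funD.
move=> mA; apply/esym.
apply: (@lebesgue_measure_unique R (pushforward lebesgue_measure tr)) => //.
move=> _ [[a b] _ <-] /=.
have trE : tr @^-1` `]a, b]%classic = `](a - c), (b - c)]%classic.
  by apply/seteqP; split=> x /=; rewrite !in_itv/= ltrBlDr lerBrDr.
rewrite [RHS](_ : _ = lebesgue_measure `](a - c), (b - c)]%classic); last first.
  by rewrite -trE.
rewrite !lebesgue_measure_itv/= !lte_fin ltrBlDr subrK.
case: ifP => // _; congr (_%:E); lra.
Qed.

Lemma lebesgue_rV_cube {n : nat} (c : 'rV[R]_n) (r : R) : 0 < r ->
  (0 < lebesgue_rV n (cube c r) < +oo)%E.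
Proof.
move=> r0; elim: n c => [|n IH] c /=.
  rewrite diracE mem_set ?lte01 ?ltry// => -[]//.
rewrite /lebesgue_rV_step /pushforward.
have -> : rV_cons @^-1` cube c r = ball (c 0 ord0) r `*` cube (rV_behead c) r.
  apply/seteqP; split=> [[a x]|[a x]] /=.
    move=> h; split=> [|i].
      have := h ord0; rewrite rV_cons_coord0 /= -ball_normE /= distrC; exact.
    have := h (rshift 1 i : 'I_(1 + n)); rewrite -!rV_beheadE rV_consK/=.
    exact.
  move=> [h0 h] i.
  have [j ->|j ->] := @split_ordP 1 n i.
    have -> : lshift n j = ord0 :> 'I_n.+1 by apply/val_inj; rewrite /= ord1.
    by rewrite rV_cons_coord0/=; move: h0; rewrite -ball_normE /= distrC.
  by have := h j; rewrite -{1}[x](rV_consK (a, x)) !rV_beheadE.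
rewrite product_measure1E//; [|exact: measurable_ball|exact: measurable_cube].
have /andP[h1 h2] := IH (rV_behead c).
have bE := lebesgue_measure_ball (c 0 ord0) (ltW r0).
rewrite [X in (X * _)%E](_ : _ = (r *+ 2)%:E); last exact: bE.
apply/andP; split; first by rewrite mule_gt0// lte_fin mulrn_wgt0.
by rewrite lte_mul_pinfty// lee_fin mulrn_wge0// ltW.
Qed.

Lemma measurable_rV_translation {n : nat} (v : 'rV[R]_n) :
  measurable_fun setT (fun x : 'rV[R]_n => x + v).
Proof.
apply: measurable_fun_rV => i.
rewrite (_ : _ \o _ = fun x => rV_coord i x + v 0 i).
  apply: measurable_funD => //; exact: measurable_rV_coord.
by apply/funext => x /=; rewrite /rV_coord mxE.
Qed.

(** By induction on the dimension: the translate of a product measure agrees with it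
    on rectangles. *)
Lemma lebesgue_rV_translation {n : nat} (v : 'rV[R]_n) (A : set 'rV[R]_n) :
  measurable A ->
  lebesgue_rV n ((fun x => x + v) @^-1` A) = lebesgue_rV n A.
Proof.
elim: n v A => [|n IH] v A mA /=.
  suff -> : (fun x => x + v) @^-1` A = A by [].
  apply/funext => x /=; congr A.
  by apply/rowP => -[].
rewrite /lebesgue_rV_step /pushforward.
pose tr0 := fun x : measurableTypeR R => x + v 0 ord0 : measurableTypeR R.
pose tr1 := fun x : 'rV[R]_n => x + rV_behead v.
pose tr p := (tr0 p.1, tr1 p.2).
have mtr0 : measurable_fun setT tr0 by apply: measurable_funD.
have mtr1 : measurable_fun setT tr1 by exact: measurable_rV_translation.
have mtr : measurable_fun setT tr.
  apply: (measurable_fun_pair (f := tr0 \o fst) (g := tr1 \o snd)).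
    exact: measurableT_comp mtr0 measurable_fst.
  exact: measurableT_comp mtr1 measurable_snd.
have -> : rV_cons @^-1` ((fun x => x + v) @^-1` A) = tr @^-1` (rV_cons @^-1` A).
  apply/funext => -[a x] /=; congr A.
  apply/rowP => i; rewrite mxE.
  have [j ->|j ->] := @split_ordP 1 n i.
    have -> : lshift n j = ord0 :> 'I_n.+1 by apply/val_inj; rewrite /= ord1.
    by rewrite !rV_cons_coord0.
  by rewrite -!rV_beheadE !rV_consK [RHS]mxE.
have mB : measurable (rV_cons @^-1` A : set (measurableTypeR R * 'rV[R]_n)).
  by rewrite -[X in measurable X]setTI; apply: measurable_rV_cons.
apply/esym.
apply: (@product_measure_unique _ _ _ _ _ lebesgue_measure (lebesgue_rV n)
  (pushforward (lebesgue_measure \x lebesgue_rV n)%E tr)) => //.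
move=> X Y mX mY.
rewrite [LHS](_ : _ = (lebesgue_measure \x lebesgue_rV n)%E
  ((tr0 @^-1` X) `*` (tr1 @^-1` Y)))//.
rewrite product_measure1E.
- congr (_ * _)%E; first exact: lebesgue_measure_translation.
  exact: IH.
- by rewrite -[X in measurable X]setTI; exact: mtr0.
- by rewrite -[X in measurable X]setTI; exact: mtr1.
Qed.

Lemma integral_rV_translation {n : nat} (v : 'rV[R]_n) (f : 'rV[R]_n -> R) :
  measurable_fun setT f ->
  (lebesgue_rV n).-integrable setT (EFin \o (fun x => f (x + v))) ->
  \int[lebesgue_rV n]_x f (x + v) = \int[lebesgue_rV n]_x f x.
Proof.
move=> mf intf; rewrite /Rintegral; congr fine.
have mt := measurable_rV_translation v.
have := @integral_pushforward _ _ _ _ R _ mt (lebesgue_rV n) setT (EFin \o f).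
rewrite preimage_setT => <-//; last exact/measurable_EFinP.
apply: eq_measure_integral => A mA _.
exact: lebesgue_rV_translation.
Qed.

(** A nonempty open set contains a cube, which has positive measure. *)
Lemma ae_lebesgue_rV_dense {n : nat} (P : set 'rV[R]_n) (U : set 'rV[R]_n) :
  {ae lebesgue_rV n, forall x, P x} -> open U -> U !=set0 ->
  exists2 x, U x & P x.
Proof.
move=> [N [mN N0 PN]] oU [x Ux]; apply: contrapT => h.
have /nbhs_ballP[e /= e0 xeU] : nbhs x U by apply: open_nbhs_nbhs.
have /andP[+ _] := lebesgue_rV_cube x e0.
suff -> : lebesgue_rV n (cube x e) = 0%E by rewrite ltxx.
apply: (subset_measure0 (measurable_cube x e) mN _ N0).
rewrite cube_ball// => y /xeU Uy; apply: PN => Py.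
by apply: h; exists y.
Qed.

Lemma lebesgue_rV_setT_gt0 (n : nat) : (0 < lebesgue_rV n [set: 'rV[R]_n])%E.
Proof.
have /andP[h _] := @lebesgue_rV_cube n 0 1 ltr01.
apply: lt_le_trans h _; apply: le_measure; rewrite ?inE//.
exact: measurable_cube.
Qed.

End lebesgue_measure_of_rV.

(** * Integrals of functions of bounded support *)

(** Integrated below with [m = 3], the least exponent that gives a function of class
    [C^2]; its derivatives bring in the smaller exponents. *)
Definition cutp {R : realType} (k : R) (m : nat) (r : R) : R :=
  Num.max (r - k) 0 ^+ m.

Section cutp.
Context {R : realType}.
Implicit Types (k r : R).

Lemma cutp_ge0 k m r : 0 <= cutp k m r.
Proof. by rewrite exprn_ge0// le_max lexx orbT. Qed.

Lemma cutp_eq0 k m r : r <= k -> cutp k m.+1 r = 0.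
Proof. by move=> rk; rewrite /cutp max_r ?subr_le0// expr0n. Qed.

Lemma continuous_cutp k m : continuous (cutp k m).
Proof.
move=> r; apply: (continuous_comp (f := fun r => Num.max (r - k) 0)
  (g := fun y : R => y ^+ m)); last exact: exprn_continuous.
apply: (@continuous_max R _ (fun r => r - k) (fun=> 0)); last exact: cvg_cst.
exact: continuous_translation.
Qed.

Lemma is_derive_shift_exp k m r :
  is_derive r 1 (fun y : R => (y - k) ^+ m.+1) (m.+1%:R * (r - k) ^+ m).
Proof.
have -> : (fun y : R => (y - k) ^+ m.+1) = (id - cst k) ^+ m.+1.
  by apply/funext => y; rewrite exprfctE.
apply: is_derive_eq.
by rewrite subr0 /GRing.scale/= mulr1 mulr_natl.
Qed.

Lemma is_derive_cutp k m r :
  is_derive r 1 (cutp k m.+2) (m.+2%:R * cutp k m.+1 r).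
Proof.
have [rk|kr|->] := ltgtP r k.
- rewrite cutp_eq0 ?(ltW rk)// mulr0.
  apply: (near_eq_is_derive (f := cst (0 : R))).
  near=> y; rewrite cutp_eq0//; apply: ltW.
  by near: y; exact: lt_nbhsl.
- rewrite {2}/cutp max_l ?subr_ge0 ?(ltW kr)//.
  apply: (near_eq_is_derive (f := fun y : R => (y - k) ^+ m.+2)).
    near=> y; rewrite /cutp max_l// subr_ge0; apply: ltW.
    by near: y; exact: lt_nbhsr.
  exact: is_derive_shift_exp.
- rewrite cutp_eq0// mulr0.
  have lim : (fun h : R => h^-1 *: (cutp k m.+2 (h *: 1 + k) - cutp k m.+2 k)) @ 0^' --> 0.
    apply/cvgrPdist_le => e e0.
    exists (Num.min e 1); first by rewrite /= lt_min e0 ltr01.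
    move=> h /=; rewrite sub0r normrN lt_min => /andP[he h1] h0.
    rewrite (cutp_eq0 _ (lexx k)) subr0 sub0r normrN /GRing.scale/= mulr1 normrM.
    rewrite normfV ler_pdivrMl ?normr_gt0// /cutp addrK normrX (mulrC `|h|).
    have M : `|Num.max h 0| <= `|h|.
      by case: (leP h 0) => _; rewrite ?normr0.
    move: M; move: `|Num.max h 0| (normr_ge0 (Num.max h 0)) => M M0 Mh.
    rewrite exprSr; apply: ler_pM => //; first exact: exprn_ge0.
    apply: le_trans (ltW he); rewrite exprS -[leRHS]mulr1.
    apply: ler_pM => //; first exact: exprn_ge0.
    by rewrite exprn_ile1// (le_trans Mh)// ltW.
  by split; [exact: cvgP lim|exact: cvg_lim lim].
Unshelve. all: by end_near. Qed.

End cutp.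

Section integrals_with_bounded_support.
Context {R : realType} {n : nat}.
Notation mu := (lebesgue_rV n).
Implicit Types (f df : R -> 'rV[R]_n -> R) (phi dphi : 'rV[R]_n -> R).

Lemma integrable_cube_cst (C r : R) : 0 < r ->
  mu.-integrable setT (EFin \o (fun x => C * \1_(cube 0 r) x)).
Proof.
move=> r0.
have mB := @measurable_cube R n 0 r.
under [X in _.-integrable _ X]eq_fun do rewrite /= EFinM.
apply: integrableZl => //; apply/integrableP; split.
  by apply/measurable_EFinP; exact: measurable_indic.
under eq_integral do rewrite gee0_abs ?lee_fin//.
rewrite integral_indic// setIT.
by have /andP[] := @lebesgue_rV_cube R n 0 r r0.
Qed.

Lemma integrable_bounded_support phi (C r : R) : 0 < r ->
  measurable_fun setT phi -> (forall x, `|phi x| <= C * \1_(cube 0 r) x) ->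
  mu.-integrable setT (EFin \o phi).
Proof.
move=> r0 mphi hphi.
apply: (@le_integrable _ _ _ _ _ _ _ (EFin \o (fun x => C * \1_(cube 0 r) x))) => //.
- exact/measurable_EFinP.
- move=> x _ /=; rewrite lee_fin (le_trans (hphi x))//.
  exact: ler_norm.
- exact: integrable_cube_cst.
Qed.

(** Differentiation under the integral, the common bounded support providing the
    dominating function. *)
Lemma cvg_quotient_integral f df (C r a b t : R) : 0 < r ->
  a < t -> t < b ->
  (forall s, a < s < b -> measurable_fun setT (f s)) ->
  (forall s x, a < s < b -> `|f s x| <= C * \1_(cube 0 r) x) ->
  (forall s x, a < s < b -> is_derive s 1 (f ^~ x) (df s x)) ->
  (forall s x, a < s < b -> `|df s x| <= C * \1_(cube 0 r) x) ->
  h^-1 *: (\int[mu]_x f (h + t) x - \int[mu]_x f t x) @[h --> 0^'] -->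
    \int[mu]_x df t x.
Proof.
move=> r0 at_ tb mf fC ddf dfC.
have tI : `]a, b[%classic t by rewrite /= in_itv/= at_ tb.
have dE s x : a < s < b -> partial1of2 f s x = df s x.
  by move=> sab; rewrite partial1of2E; have [_ ->] := ddf s x sab.
have G0 (x : 'rV[R]_n) : 0 <= `|C * \1_(cube 0 r) x : R| by exact: normr_ge0.
have := @cvg_differentiation_under_integral R _ _ mu f setT measurableT t a b tI _ _
  (fun x => `|C * \1_(cube 0 r) x|) G0.
rewrite (_ : (\int[mu]_y partial1of2 f t y) = \int[mu]_x df t x); last first.
  by apply: eq_Rintegral => x _; rewrite dE// at_.
apply.
- move=> s; rewrite /= in_itv/= => sab.
  exact: integrable_bounded_support r0 (mf s sab) (fun x => fC s x sab).
- move=> s x; rewrite /= in_itv/= => sab _.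
  by have [] := ddf s x sab.
- apply: (@le_integrable _ _ _ _ _ _ _ (EFin \o (fun x => C * \1_(cube 0 r) x))) => //.
  + apply/measurable_EFinP; apply: measurableT_comp => //.
    apply: measurable_funM => //.
    exact: (measurable_indic (measurable_cube 0 r)).
  + by move=> x _ /=; rewrite normr_id.
  + exact: integrable_cube_cst.
- move=> s x; rewrite /= in_itv/= => sab _.
  by rewrite dE// (le_trans (dfC s x sab))// ler_norm.
Qed.

Lemma is_derive_integral_param f df (C r a b t : R) : 0 < r ->
  a < t -> t < b ->
  (forall s, a < s < b -> measurable_fun setT (f s)) ->
  (forall s x, a < s < b -> `|f s x| <= C * \1_(cube 0 r) x) ->
  (forall s x, a < s < b -> is_derive s 1 (f ^~ x) (df s x)) ->
  (forall s x, a < s < b -> `|df s x| <= C * \1_(cube 0 r) x) ->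
  is_derive t 1 (fun s => \int[mu]_x f s x) (\int[mu]_x df t x).
Proof.
move=> r0 at_ tb mf fC ddf dfC.
have lim := cvg_quotient_integral r0 at_ tb mf fC ddf dfC.
have E : (fun h : R => h^-1 *: (((fun s => \int[mu]_x f s x) \o shift t) (h *: 1)
    - \int[mu]_x f t x)) = (fun h => h^-1 *: (\int[mu]_x f (h + t) x - \int[mu]_x f t x)).
  by apply/funext => h /=; rewrite [h *: 1]mulr1.
split; rewrite ?/derivable ?/derive E; first exact: cvgP lim.
exact: cvg_lim lim.
Qed.

(** By translation invariance the integral of [phi (x + s e_i)] does not depend
    on [s]; differentiate at [s = 0]. *)
Lemma integral_partial_eq0 phi dphi (i : 'I_n) (C r : R) : 0 < r ->
  continuous phi -> (forall x, is_derive x (unit_vec i) phi (dphi x)) ->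
  (forall x, `|phi x| <= C * \1_(cube 0 r) x) ->
  (forall x, `|dphi x| <= C * \1_(cube 0 r) x) ->
  \int[mu]_x dphi x = 0.
Proof.
move=> r0 cphi dphiE phiC dphiC.
have mphi : measurable_fun setT phi.
  by apply: continuous_measurable_rV; [exact: openT|move=> x _; exact: cphi].
have C0 (x : 'rV[R]_n) : 0 <= C * \1_(cube 0 r) x by exact: le_trans (normr_ge0 _) (phiC x).
pose e : 'rV[R]_n := unit_vec i.
have r1 : 0 < r + 1 by rewrite addr_gt0.
have shiftB (g : 'rV[R]_n -> R) (s : R) (x : 'rV[R]_n) : -1 < s < 1 ->
    (forall x, `|g x| <= C * \1_(cube 0 r) x) ->
    `|g (x + s *: e)| <= C * \1_(cube 0 (r + 1)) x.
  move=> s1 gC; apply: le_trans (gC _) _; rewrite !indicE.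
  have [xs|_] := boolP (x + s *: e \in cube 0 r).
    rewrite mem_set//=.
    move: xs; rewrite inE => xs j; have := xs j; rewrite !mxE !subr0 /=.
    set d := (j == i)%:R => h.
    rewrite (_ : x 0 j = (x 0 j + s * d) - s * d); last by ring.
    apply: le_lt_trans (ler_normB _ _) _; apply: ltr_leD => //.
    have s1' : `|s| <= 1 by rewrite ler_norml; lra.
    by rewrite normrM /d; case: (j == i); rewrite ?normr1 ?normr0 ?mulr1 ?mulr0.
  rewrite mulr0; case: (x \in _); rewrite ?mulr1 ?mulr0//.
  by have := C0 0; rewrite indicE mem_set ?mulr1// => j; rewrite subrr normr0.
have int (s : R) : -1 < s < 1 ->
    mu.-integrable setT (EFin \o (fun x => phi (x + s *: e))).
  move=> s1; apply: (integrable_bounded_support (C := C) r1).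
    exact: (measurableT_comp mphi (measurable_rV_translation _)).
  by move=> x; exact: shiftB.
have m1 : -1 < 0 :> R by lra.
have lim := @cvg_quotient_integral (fun s x => phi (x + s *: e))
  (fun s x => dphi (x + s *: e)) C (r + 1) (-1) 1 0 r1 m1 ltr01.
have {}lim : h^-1 *: (\int[mu]_x phi (x + (h + 0) *: e)
    - \int[mu]_x phi (x + 0 *: e)) @[h --> 0^'] --> \int[mu]_x dphi (x + 0 *: e).
  apply: lim.
  - move=> s _.
    exact: (measurableT_comp mphi (measurable_rV_translation _)).
  - by move=> s x s1; exact: shiftB.
  - by move=> s x _; apply: is_derive_line; exact: dphiE.
  - by move=> s x s1; exact: shiftB.
have -> : \int[mu]_x dphi x = \int[mu]_x dphi (x + 0 *: e).
  by apply: eq_Rintegral => x _; rewrite scale0r addr0.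
have lim0 : h^-1 *: (\int[mu]_x phi (x + (h + 0) *: e)
    - \int[mu]_x phi (x + 0 *: e)) @[h --> 0^'] --> (0 : R).
  apply/cvgrPdist_le => eps eps0.
  exists 1 => //= h; rewrite /= sub0r normrN => h1 _.
  have h11 : -1 < h + 0 < 1 by move: h1; rewrite ltr_norml !addr0.
  have h00 : -1 < (0 : R) < 1 by rewrite m1 ltr01.
  rewrite (integral_rV_translation mphi (int _ h11)).
  rewrite (integral_rV_translation mphi (int _ h00)).
  by rewrite subrr scaler0 subrr normr0 ltW.
exact: (cvg_unique _ lim lim0).
Qed.

End integrals_with_bounded_support.

(** * A maximum principle for initial values attained almost everywhere *)

Section slices.
Context {R : realType} {X : topologicalType} {I : set R} {E : set X}.
Implicit Types h : R -> X -> R.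

Lemma within_slice_space h t : {within I `*` E, continuous (fun p => h p.1 p.2)} ->
  I t -> {within E, continuous (h t)}.
Proof.
move=> /subspace_continuousP ch It; apply/subspace_continuousP => x Ex A nA.
have [[U V]/= [Ut Vx] UV] := ch (t, x) (conj It Ex) A nA.
apply: filterS Vx => y Vy Ey; apply: (UV (t, y)) => //.
by split => //=; exact: nbhs_singleton.
Qed.

End slices.

Section integrals_of_sums.
Context {R : realType} {n : nat}.
Notation mu := (lebesgue_rV n).

Lemma integral_sum_eq0 {I : Type} (r : seq I) (g : I -> 'rV[R]_n -> R) :
  (forall i, mu.-integrable setT (EFin \o g i)) ->
  (forall i, \int[mu]_x g i x = 0) ->
  mu.-integrable setT (EFin \o (fun x => \sum_(i <- r) g i x)) /\
  \int[mu]_x (\sum_(i <- r) g i x) = 0.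
Proof.
move=> gi g0; elim: r => [|i r [IH1 IH2]].
  under [X in _.-integrable _ X]eq_fun do rewrite /= big_nil.
  under eq_Rintegral do rewrite big_nil.
  split; first exact: integrable0.
  by rewrite Rintegral_cst// mul0r.
under [X in _.-integrable _ X]eq_fun do rewrite /= big_cons EFinD.
under eq_Rintegral do rewrite big_cons.
split; first by apply: integrableD => //; exact: gi.
by rewrite RintegralD// ?IH2 ?g0 ?addr0//; exact: gi.
Qed.

End integrals_of_sums.

Section weak_maximum_principle.
Context {R : realType} {n : nat} (Omega : set 'rV[R]_n).
Notation mu := (lebesgue_rV n).
Variables (w wt : R -> 'rV[R]_n -> R) (wi wii : 'I_n -> R -> 'rV[R]_n -> R).
Variables (rho K : R) (l : 'rV[R]_n -> R).

Let I : set R := `]0, +oo[.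
Let smooth_up_to_boundary (h : R -> 'rV[R]_n -> R) :=
  {within I `*` closure Omega, continuous (fun p => h p.1 p.2)}.

Hypothesis open_Omega : open Omega.
Hypothesis cw : smooth_up_to_boundary w.
Hypothesis cwt : smooth_up_to_boundary wt.
Hypothesis cwi : forall i, smooth_up_to_boundary (wi i).
Hypothesis cwii : forall i, smooth_up_to_boundary (wii i).
Hypothesis dwt : forall (t : R) x, 0 < t -> Omega x ->
  is_derive t 1 (w^~ x) (wt t x).
Hypothesis dwi : forall (t : R) x i, 0 < t -> Omega x ->
  is_derive x (unit_vec i) (w t) (wi i t x).
Hypothesis dwii : forall (t : R) x i, 0 < t -> Omega x ->
  is_derive x (unit_vec i) (wi i t) (wii i t x).
Hypothesis subcaloric : forall (t : R) x, 0 < t -> Omega x ->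
  wt t x <= \sum_i wii i t x.
Hypothesis w_boundary : forall (t : R) x, 0 < t -> closure Omega x -> ~ Omega x ->
  w t x <= 0.
Hypothesis rho_ge0 : 0 <= rho.
Hypothesis w_support : forall (t : R) x, 0 < t -> Omega x -> 0 < w t x ->
  `|x| <= rho.
Hypothesis w_ub : forall (t : R) x, 0 < t -> Omega x -> w t x <= K.
Hypothesis l_le0 : forall x, Omega x -> l x <= 0.
Hypothesis w_init : {ae mu, forall x, Omega x -> w t x @[t --> 0^'+] --> l x}.

Section level.
Variable k : R.
Hypothesis k_gt0 : 0 < k.

(** Such a function [P] vanishes near the boundary of [Omega], where [w <= 0 < k], so
    that its extension by zero is as regular as [P]. *)
Let vanishing (t : R) (P : 'rV[R]_n -> R) :=
  forall x, Omega x -> w t x <= k -> P x = 0.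

Lemma near_outside t x : 0 < t -> ~ Omega x ->
  \forall y \near x, Omega y -> w t y <= k.
Proof.
move=> t0 nOx.
have It : I t by rewrite /I /= in_itv/= t0.
have [clx|nclx] := pselect (closure Omega x); last first.
  have : nbhs x (~` closure Omega).
    by apply: open_nbhs_nbhs; split => //; apply: closed_openC; exact: closed_closure.
  by apply: filterS => y nc /subset_closure.
have /subspace_continuousP/(_ _ clx) cwx := within_slice_space cw It.
have wk : w t x < k by apply: le_lt_trans k_gt0; exact: w_boundary.
have hn : \forall y \near x, closure Omega y -> w t y < k.
  exact: (cwx [set r | r < k] (lt_nbhsl wk)).
by apply: filterS hn => y hy Oy; apply/ltW/hy; exact: subset_closure.
Qed.

Lemma near_patch_out t x (P : 'rV[R]_n -> R) : 0 < t -> vanishing t P ->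
  ~ Omega x -> \forall y \near x, 0 = (P \_ Omega) y.
Proof.
move=> t0 vP nOx; have := near_outside t0 nOx.
apply: filterS => y hy; rewrite patchE; case: ifPn => // /set_mem Oy.
by rewrite vP// hy.
Qed.

Lemma near_patch_in x (P : 'rV[R]_n -> R) : Omega x ->
  \forall y \near x, P y = (P \_ Omega) y.
Proof.
move=> Ox; have nO : nbhs x Omega by exact: open_nbhs_nbhs.
by near=> y; rewrite patchE mem_set//; near: y.
Unshelve. all: by end_near. Qed.

Lemma continuous_vanishing t (P : 'rV[R]_n -> R) : 0 < t -> vanishing t P ->
  {within closure Omega, continuous P} -> continuous (P \_ Omega).
Proof.
move=> t0 vP cP x; have [Ox|nOx] := pselect (Omega x).
  apply: (@continuous_near_eq _ _ _ P).
    exact: continuous_interior open_Omega cP Ox.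
  by have := near_patch_in P Ox; apply: filterS => y ->.
apply: (@continuous_near_eq _ _ _ (cst 0)); first exact: cst_continuous.
by have := near_patch_out t0 vP nOx; apply: filterS => y <-.
Qed.

Lemma is_derive_vanishing t (P dP : 'rV[R]_n -> R) v : 0 < t ->
  vanishing t P ->
  (forall x, Omega x -> is_derive x v P (dP x)) ->
  forall x, is_derive x v (P \_ Omega) ((dP \_ Omega) x).
Proof.
move=> t0 vP dPE x; have [Ox|nOx] := pselect (Omega x).
  rewrite patchE mem_set//.
  exact: near_eq_is_derive (near_patch_in P Ox) (dPE x Ox).
rewrite patchE memNset//.
exact: near_eq_is_derive (near_patch_out t0 vP nOx) (is_derive_cst _ _ _).
Qed.

(** For times away from [0], [P] is continuous on the compact set of points of the
    closure with [|x| <= rho], outside which it vanishes. *)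
Lemma bounded_vanishing (P : R -> 'rV[R]_n -> R) (a b : R) : 0 < a ->
  (forall t, 0 < t -> vanishing t (P t)) -> smooth_up_to_boundary P ->
  exists C, forall t x, a < t < b ->
    `|(P t \_ Omega) x| <= C * \1_(cube 0 (rho + 1)) x.
Proof.
move=> a0 vP cP.
pose B := closure Omega `&` [set x : 'rV[R]_n | `|x| <= rho].
have cB : compact B.
  apply: bounded_closed_compact.
    exists rho; split; first by rewrite num_real.
    by move=> M rM x [_ /= xr]; rewrite (le_trans xr)// ltW.
  apply: closedI; first exact: closed_closure.
  rewrite (_ : [set x | _] = (@Num.norm _ 'rV[R]_n) @^-1` [set r | r <= rho])//.
  by apply: preimage_closed; [move=> y _; exact: norm_continuous|exact: closed_le].
have cK : compact (`[a, b] `*` B) by apply: compact_setX => //; exact: segment_compact.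
have [C C0 hC] : exists2 C, 0 <= C & forall t x, a < t < b -> B x -> `|P t x| <= C.
  have [K0|K0] := pselect ((`[a, b] `*` B) !=set0); last first.
    exists 0 => // t x tab Bx; exfalso; apply: K0; exists (t, x); split=> //=.
    by rewrite in_itv/=; apply/andP; split; lra.
  have [|c _ hc] := compact_EVT_max K0 cK (f := fun p => `|P p.1 p.2|).
    apply/subspace_continuousP => p Kp; apply: cvg_norm.
    have : {within `[a, b] `*` B, continuous (fun p => P p.1 p.2)}.
      apply: continuous_subspaceW cP => -[t x] [/= + [clx _]].
      by rewrite in_itv/= => /andP[at_ _]; split=> //=; rewrite /I/= in_itv/=; lra.
    by move/subspace_continuousP; exact.
  exists `|P c.1 c.2|; first exact: normr_ge0.
  move=> t x tab Bx; apply: (hc (t, x)); rewrite inE; split=> //=.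
  by rewrite in_itv/=; apply/andP; split; lra.
exists C => t x tab; have t0 : 0 < t by lra.
rewrite patchE; case: ifPn => [/set_mem Ox|_]; last first.
  by rewrite normr0 mulr_ge0.
have [wk|kw] := leP (w t x) k; first by rewrite vP// normr0 mulr_ge0.
have xr : `|x| <= rho := w_support t0 Ox (lt_trans k_gt0 kw).
rewrite indicE mem_set ?mulr1.
  by apply: hC => //; split=> //; exact: subset_closure.
move=> i; rewrite mxE subr0; apply: le_lt_trans (coord_le_norm x i) _.
by apply: le_lt_trans xr _; rewrite ltrDl.
Qed.

Let Psi t := (cutp k 3 \o w t) \_ Omega.
Let Psit t := (fun x => 3%:R * cutp k 2 (w t x) * wt t x) \_ Omega.
Let Psii i t := (fun x => 3%:R * cutp k 2 (w t x) * wi i t x) \_ Omega.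
Let Psiii i t := (fun x => 3%:R * ((2%:R * cutp k 1 (w t x) * wi i t x) * wi i t x
  + cutp k 2 (w t x) * wii i t x)) \_ Omega.

Let cut_smooth m : smooth_up_to_boundary (fun t x => cutp k m (w t x)).
Proof.
apply/subspace_continuousP => p Ip.
have /subspace_continuousP/(_ _ Ip) := cw.
by move=> h; apply: continuous_cvg h; exact: continuous_cutp.
Qed.

Let smoothC (c : R) : smooth_up_to_boundary (fun _ _ => c).
Proof. by apply/subspace_continuousP => p Ip; exact: cvg_cst. Qed.

Let smoothM h1 h2 : smooth_up_to_boundary h1 -> smooth_up_to_boundary h2 ->
  smooth_up_to_boundary (fun t x => h1 t x * h2 t x).
Proof.
move=> /subspace_continuousP c1 /subspace_continuousP c2.
by apply/subspace_continuousP => p Ip; apply: cvgM; [exact: c1|exact: c2].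
Qed.

Let smoothD h1 h2 : smooth_up_to_boundary h1 -> smooth_up_to_boundary h2 ->
  smooth_up_to_boundary (fun t x => h1 t x + h2 t x).
Proof.
move=> /subspace_continuousP c1 /subspace_continuousP c2.
by apply/subspace_continuousP => p Ip; apply: cvgD; [exact: c1|exact: c2].
Qed.

Let rho1 : 0 < rho + 1. Proof. by rewrite ltr_wpDl. Qed.

Let int_smooth (P : R -> 'rV[R]_n -> R) (t : R) : 0 < t ->
  (forall t, 0 < t -> vanishing t (P t)) -> smooth_up_to_boundary P ->
  [/\ continuous (P t \_ Omega), measurable_fun setT (P t \_ Omega) &
    mu.-integrable setT (EFin \o (P t \_ Omega))].
Proof.
move=> t0 vP cP.
have It : I t by rewrite /I /= in_itv/= t0.
have cPt := continuous_vanishing t0 (vP t t0) (within_slice_space cP It).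
have mPt : measurable_fun setT (P t \_ Omega).
  by apply: continuous_measurable_rV; [exact: openT|move=> x _; exact: cPt].
split=> //.
have t20 : 0 < t / 2 by lra.
have [C hC] := bounded_vanishing (t + 1) t20 vP cP.
have t2t : t / 2 < t < t + 1 by apply/andP; split; lra.
exact: integrable_bounded_support rho1 mPt (fun x => hC t x t2t).
Qed.

Let v3 t : 0 < t -> vanishing t (cutp k 3 \o w t).
Proof. by move=> t0 x Ox wk; rewrite /= cutp_eq0. Qed.

Let vt t : 0 < t -> vanishing t (fun x => 3%:R * cutp k 2 (w t x) * wt t x).
Proof. by move=> t0 x Ox wk; rewrite /= cutp_eq0// mulr0 mul0r. Qed.

Let vi i t : 0 < t -> vanishing t (fun x => 3%:R * cutp k 2 (w t x) * wi i t x).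
Proof. by move=> t0 x Ox wk; rewrite /= cutp_eq0// mulr0 mul0r. Qed.

Let vii i t : 0 < t ->
  vanishing t (fun x => 3%:R * ((2%:R * cutp k 1 (w t x) * wi i t x) * wi i t x
  + cutp k 2 (w t x) * wii i t x)).
Proof. by move=> t0 x Ox wk; rewrite /= !cutp_eq0// !mulr0 !mul0r addr0 mulr0. Qed.

Let s3 : smooth_up_to_boundary (fun t => cutp k 3 \o w t).
Proof. exact: cut_smooth. Qed.

Let st : smooth_up_to_boundary (fun t x => 3%:R * cutp k 2 (w t x) * wt t x).
Proof. by apply: smoothM => //; apply: smoothM. Qed.

Let si i : smooth_up_to_boundary (fun t x => 3%:R * cutp k 2 (w t x) * wi i t x).
Proof. by apply: smoothM => //; apply: smoothM. Qed.

Let sii i : smooth_up_to_boundary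
  (fun t x => 3%:R * ((2%:R * cutp k 1 (w t x) * wi i t x) * wi i t x
  + cutp k 2 (w t x) * wii i t x)).
Proof.
apply: smoothM => //; apply: smoothD; last exact: smoothM.
by apply: smoothM => //; apply: smoothM => //; exact: smoothM.
Qed.

Let dPsii i t x : 0 < t -> is_derive x (unit_vec i) (Psii i t) (Psiii i t x).
Proof.
move=> t0; apply: (is_derive_vanishing t0 (@vi i t t0)) => y Oy.
have d1 := is_derive_compl (is_derive_cutp k 0 (w t y)) (dwi i t0 Oy).
have d2 := dwii i t0 Oy.
have -> : (fun x => 3%:R * cutp k 2 (w t x) * wi i t x) =
    3%:R *: ((cutp k 2 \o w t) * wi i t).
  by apply/funext => z; rewrite /= -mulrA.
apply: is_derive_eq.
by rewrite /GRing.scale/=; ring.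
Qed.

Let dPsit (t : R) x : 0 < t -> is_derive t 1 (Psi^~ x) (Psit t x).
Proof.
move=> t0; rewrite /Psi /Psit; have [Ox|nOx] := pselect (Omega x).
  rewrite patchE mem_set//.
  rewrite (_ : (fun y => ((cutp k 3 \o w y) \_ Omega) x) = cutp k 3 \o (w^~ x)).
    exact: is_derive_compl (is_derive_cutp k 1 (w t x)) (dwt t0 Ox).
  by apply/funext => s; rewrite patchE mem_set.
rewrite patchE memNset//.
rewrite (_ : (fun y => ((cutp k 3 \o w y) \_ Omega) x) = cst 0).
  exact: is_derive_cst.
by apply/funext => s; rewrite patchE memNset.
Qed.

(** [Psiii] is the second derivative in the direction [i] of [max(w - k, 0)^3], and
    the first derivative [Psii] has bounded support. *)
Lemma integral_second_partial i t : 0 < t -> \int[mu]_x Psiii i t x = 0.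
Proof.
move=> t0.
have t20 : 0 < t / 2 by lra.
have t2t : t / 2 < t < t + 1 by apply/andP; split; lra.
have [C1 hC1] := bounded_vanishing (t + 1) t20 (@vi i) (@si i).
have [C2 hC2] := bounded_vanishing (t + 1) t20 (@vii i) (@sii i).
have B0 (x : 'rV[R]_n) : 0 <= \1_(cube 0 (rho + 1)) x :> R by rewrite indicE.
have [ci _ _] := int_smooth t0 (@vi i) (@si i).
apply: (@integral_partial_eq0 _ _ (Psii i t) (Psiii i t) i (Num.max C1 C2) (rho + 1)) => //.
- by move=> x; exact: dPsii.
- by move=> x; rewrite (le_trans (hC1 t x t2t))// ler_wpM2r// le_max lexx.
- by move=> x; rewrite (le_trans (hC2 t x t2t))// ler_wpM2r// le_max lexx orbT.
Qed.

Let J t := \int[mu]_x Psi t x.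

Let is_derive_J (t : R) : 0 < t -> is_derive t 1 J (\int[mu]_x Psit t x).
Proof.
move=> t0.
have t20 : 0 < t / 2 by lra.
have [C1 hC1] := bounded_vanishing (t + 1) t20 v3 s3.
have [C2 hC2] := bounded_vanishing (t + 1) t20 vt st.
have B0 (x : 'rV[R]_n) : 0 <= \1_(cube 0 (rho + 1)) x :> R by rewrite indicE.
apply: (@is_derive_integral_param _ _ Psi Psit (Num.max C1 C2) (rho + 1) (t / 2) (t + 1));
  rewrite ?ltrDl//; first by lra.
- move=> s sab; have s0 : 0 < s by lra.
  by have [] := int_smooth s0 v3 s3.
- by move=> s x sab; rewrite (le_trans (hC1 s x sab))// ler_wpM2r// le_max lexx.
- by move=> s x sab; apply: dPsit; lra.
- by move=> s x sab; rewrite (le_trans (hC2 s x sab))// ler_wpM2r// le_max lexx orbT.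
Qed.

(* The remaining term [6 max(w - k, 0) |grad w|^2] of the Laplacian has a sign. *)
Let dJ_le0 (t : R) : 0 < t -> \int[mu]_x Psit t x <= 0.
Proof.
move=> t0.
have [_ _ intt] := int_smooth t0 vt st.
have intii i : mu.-integrable setT (EFin \o Psiii i t).
  by have [] := int_smooth t0 (@vii i) (@sii i).
have [ints s0] := integral_sum_eq0 (index_enum 'I_n) intii
  (fun i => integral_second_partial i t0).
rewrite -s0; apply: le_Rintegral => // x _.
rewrite /Psit patchE; case: ifPn => [/set_mem Ox|nOx]; last first.
  by rewrite big1// => i _; rewrite /Psiii patchE (negbTE nOx).
under eq_bigr do rewrite /Psiii patchE mem_set//.
apply: le_trans (_ : 3%:R * cutp k 2 (w t x) * \sum_i wii i t x <= _).
  by rewrite ler_wpM2l ?subcaloric// mulr_ge0// cutp_ge0.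
rewrite mulr_sumr; apply: ler_sum => i _.
rewrite -mulrA ler_pM2l// lerDr -!mulrA mulr_ge0// mulr_ge0 ?cutp_ge0//.
by rewrite -expr2 sqr_ge0.
Qed.

Let J_noninc (s t : R) : 0 < s -> s <= t -> J t <= J s.
Proof.
move=> s0 st_.
have [||r rI E] := @MVT_segment _ J (fun t => \int[mu]_x Psit t x) s t st_.
- by move=> r; rewrite in_itv/= => /andP[sr _]; apply: is_derive_J; lra.
- apply: derivable_within_continuous => r; rewrite in_itv/= => /andP[sr _].
  by have [] : is_derive r 1 J (\int[mu]_x Psit r x) by apply: is_derive_J; lra.
- move: rI; rewrite in_itv/= => /andP[sr _].
  rewrite -subr_le0 E mulr_le0_ge0 ?subr_ge0//; apply: dJ_le0.
  by lra.
Qed.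

Let J_init : J n0.+1%:R^-1 @[n0 --> \oo] --> 0.
Proof.
pose t_ (m : nat) : R := m.+1%:R^-1.
have t0 m : 0 < t_ m by rewrite invr_gt0.
have tcvg : t_ m @[m --> \oo] --> 0^'+.
  move=> A [e /= e0 hA].
  have /cvgrPdist_lt/(_ _ e0) := @cvg_harmonic R.
  by apply: filterS => m hm; apply: hA.
have m1 m : measurable_fun setT (Psi (t_ m)).
  by have [] := int_smooth (t0 m) v3 s3.
pose C := cutp k 3 K.
have Psi_ub m x : `|Psi (t_ m) x| <= C * \1_(cube 0 (rho + 1)) x.
  rewrite /Psi patchE; case: ifPn => [/set_mem Ox|_]; last first.
    by rewrite normr0 mulr_ge0 ?cutp_ge0// indicE.
  rewrite ger0_norm ?cutp_ge0//.
  have [wk|kw] := leP (w (t_ m) x) k.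
    by rewrite /= cutp_eq0// mulr_ge0 ?cutp_ge0// indicE.
  have xr : `|x| <= rho := w_support (t0 m) Ox (lt_trans k_gt0 kw).
  rewrite indicE mem_set ?mulr1.
    have M0 (r : R) : 0 <= Num.max r 0 by rewrite le_max lexx orbT.
    rewrite /cutp; apply: lerXn2r; rewrite ?nnegrE//=.
    by rewrite ge_max M0 andbT le_max lerD2r w_ub.
  move=> i; rewrite mxE subr0; apply: le_lt_trans (coord_le_norm x i) _.
  by apply: le_lt_trans xr _; rewrite ltrDl.
have := @dominated_convergence _ _ R mu setT measurableT
  (fun m => EFin \o Psi (t_ m)) (cst 0%E)
  (EFin \o (fun x => C * \1_(cube 0 (rho + 1)) x)).
case.
- by move=> m; apply/measurable_EFinP.
- exact: measurable_cst.
- apply: filterS w_init => x hx _ /=.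
  apply: cvg_near_cst.
  rewrite /Psi; have [Ox|nOx] := pselect (Omega x); last first.
    by apply: nearW => m; rewrite patchE memNset.
  have lk : l x < k by apply: le_lt_trans k_gt0; exact: l_le0.
  have wlim : w (t_ m) x @[m --> \oo] --> l x by apply: cvg_comp tcvg (hx Ox).
  have hk : \forall m \near \oo, w (t_ m) x < k.
    exact: (wlim [set r | r < k] (lt_nbhsl lk)).
  by near=> m; rewrite patchE mem_set//= cutp_eq0// ltW//; near: m.
- exact: integrable_cube_cst.
- by apply: aeW => x m _ /=; rewrite lee_fin.
move=> _ _; rewrite integral0 => h.
have : fine (\int[mu]_x (EFin \o Psi (t_ m)) x)%E @[m --> \oo] --> (0 : R).
  exact: fine_cvg h.
by [].
Unshelve. all: by end_near. Qed.

(** The integral [J] of the cube is nonincreasing, nonnegative, and tends to [0] at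
    time [0]; so the cube vanishes almost everywhere, hence everywhere. *)
Lemma level_bound (t : R) x : 0 < t -> Omega x -> w t x <= k.
Proof.
move=> t0 Ox.
have J0 : J t <= 0.
  rewrite leNgt; apply/negP => J0.
  have near1 : \forall m \near \oo, J m.+1%:R^-1 < J t by exact: cvgr_lt J_init _ J0.
  have near2 : \forall m \near \oo, m.+1%:R^-1 <= t.
    have /cvgrPdist_lt/(_ _ t0) := @cvg_harmonic R.
    by apply: filterS => m; rewrite sub0r normrN ger0_norm ?invr_ge0//; exact: ltW.
  have [m [h1 h2]] := filter_ex (filterI near1 near2).
  have := @J_noninc m.+1%:R^-1 t; rewrite invr_gt0 ltr0Sn h2 => /(_ isT isT).
  by rewrite leNgt h1.
have [cPsi mPsi iPsi] := int_smooth t0 v3 s3.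
have Psi_ge0 y : 0 <= Psi t y.
  by rewrite /Psi patchE; case: ifPn => // _; exact: cutp_ge0.
have ae0 : ae_eq mu setT (EFin \o Psi t) (cst 0%E).
  apply/ae_eq_integral_abs => //; first exact/measurable_EFinP.
  under eq_integral do rewrite /= ger0_norm//.
  have fin : (\int[mu]_y (Psi t y)%:E)%E \is a fin_num by exact: integrable_fin_num.
  apply/eqP; rewrite eq_le; apply/andP; split.
    by rewrite -(fineK fin) lee_fin.
  by apply: integral_ge0 => y _; rewrite lee_fin.
rewrite leNgt; apply/negP => kw.
have [|||y Py P0] := @ae_lebesgue_rV_dense R n [set y | Psi t y = 0]
    [set y | Psi t y != 0].
- by apply: filterS ae0 => y h; have [] := h Logic.I.
- rewrite (_ : [set y | _] = Psi t @^-1` [set r | r != 0])//.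
  apply: open_comp; first by move=> y _; exact: cPsi.
  exact: open_neq.
- exists x => /=; rewrite /Psi patchE mem_set//= gt_eqF// /cutp exprn_gt0//.
  by rewrite lt_max subr_gt0 kw.
- by move: Py => /=; rewrite P0 eqxx.
Qed.

End level.

(** With [Psi = max(w - k, 0)^3], extended by zero, the integral of [Psi (t)] is
    nonincreasing because that of each second derivative of [Psi] vanishes, and it
    tends to [0] as [t] goes to [0] by dominated convergence, for which initial values
    almost everywhere suffice.  The cube makes [Psi] twice differentiable, and the
    level [k > 0] keeps its support away from the boundary. *)
Theorem weak_max_principle (t : R) x : 0 < t -> Omega x -> w t x <= 0.
Proof.
move=> t0 Ox; apply/ler_addgt0Pl => k k0; rewrite addr0.
exact: level_bound.
Qed.

End weak_maximum_principle.

(** * The heat flow near the initial time *)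

Lemma cvg_within_snd {X Y Z : topologicalType} (D : set (X * Y)) (h : Y -> Z)
    (p : X * Y) :
  {for p.2, continuous h} -> h q.2 @[q --> within D (nbhs p)] --> h p.2.
Proof.
move=> ch; apply: cvg_within_filter.
by apply: (@cvg_comp _ _ _ snd h _ (nbhs p.2)); [exact: cvg_snd|exact: ch].
Qed.

Section polynomial_derivatives.
Context {R : realType} {n : nat}.
Implicit Types (x c e : 'rV[R]_n).

Lemma is_derive_quadratic (a b c : R) :
  is_derive (0 : R) 1 (fun s => a + b * s + c * s ^+ 2) b.
Proof.
have -> : (fun s : R => a + b * s + c * s ^+ 2) = cst a + b \*: id + c \*: (id * id).
  by apply/funext => s; rewrite /= expr2.
have d := @is_derive_id R R^o 0 1.
have dd := is_deriveZ c (is_deriveM d d).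
have h := is_deriveD (is_deriveD (is_derive_cst a (0:R) 1) (is_deriveZ b d)) dd.
apply: (is_derive_eq h).
by rewrite /GRing.scale/=; ring.
Qed.

Lemma is_derive_sqnormB x c i :
  is_derive x (unit_vec i) (fun y => sqnorm (y - c)) (2 * (x - c) 0 i).
Proof.
apply: line0_is_derive.
rewrite (_ : (fun r : R => _) =
    (fun s => sqnorm (x - c) + (2 * (x - c) 0 i) * s + 1 * s ^+ 2)).
  exact: is_derive_quadratic.
apply/funext => s; rewrite (_ : x + s *: unit_vec i - c = (x - c) + s *: unit_vec i).
  by rewrite sqnormD_unit; ring.
by rewrite addrAC.
Qed.

Lemma is_derive_coordB x c i :
  is_derive x (unit_vec i) (fun y => (y - c) 0 i) 1.
Proof.
apply: line0_is_derive.
rewrite (_ : (fun r : R => _) = (fun s => (x - c) 0 i + 1 * s + 0 * s ^+ 2)).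
  exact: is_derive_quadratic.
by apply/funext => s; rewrite !mxE !eqxx mulr1; ring.
Qed.

Lemma is_derive_vdotB e x c i :
  is_derive x (unit_vec i) (fun y => vdot e (y - c)) (e 0 i).
Proof.
apply: line0_is_derive.
rewrite (_ : (fun r : R => _) = (fun s => vdot e (x - c) + e 0 i * s + 0 * s ^+ 2)).
  exact: is_derive_quadratic.
apply/funext => s; rewrite (_ : x + s *: unit_vec i - c = (x - c) + s *: unit_vec i).
  by rewrite vdotDr vdotZr vdot_unit; ring.
by rewrite addrAC.
Qed.

End polynomial_derivatives.

Section C21_data.
Context {R : realType} {n : nat}.
Implicit Types (Omega : set 'rV[R]_n) (I : set R).

(** Inside [Omega] the derivatives may be replaced by their continuous extensions,
    which stay continuous up to the lateral boundary. *)
Lemma C21_closure_derivatives Omega I u : open Omega -> C21_closure Omega I u ->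
  exists (ut : R -> 'rV[R]_n -> R) (ui uii : 'I_n -> R -> 'rV[R]_n -> R),
  let sm (h : R -> 'rV[R]_n -> R) :=
    {within I `*` closure Omega, continuous (fun p => h p.1 p.2)} in
  [/\ [/\ sm ut, forall i, sm (ui i) & forall i, sm (uii i)],
      forall t x, I t -> Omega x -> is_derive t 1 (u^~ x) (ut t x),
      forall t x i, I t -> Omega x -> is_derive x (unit_vec i) (u t) (ui i t x),
      forall t x i, I t -> Omega x ->
        is_derive x (unit_vec i) (ui i t) (uii i t x) &
      forall t x, I t -> Omega x -> dt u t x = ut t x /\
        laplacian (u t) x = \sum_i uii i t x].
Proof.
move=> oO [_ du_t du_i du_ii [[ht cht eht] ei eii]].
have /choice[hi hiP] : forall i, exists h : R * 'rV[R]_n -> R,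
    {within I `*` closure Omega, continuous h} /\
    {in I `*` Omega, (fun p => 'D_(unit_vec i) (u p.1) p.2) =1 h}.
  by move=> i; have [h] := ei i; exists h.
have /choice[hii hiiP] : forall i, exists h : R * 'rV[R]_n -> R,
    {within I `*` closure Omega, continuous h} /\
    {in I `*` Omega,
      (fun p => 'D_(unit_vec i) ('D_(unit_vec i) (u p.1)) p.2) =1 h}.
  by move=> i; have [h] := eii i i; exists h.
have IO t x : I t -> Omega x -> (t, x) \in I `*` Omega by move=> It Ox; rewrite inE.
have tE t x : I t -> Omega x -> dt u t x = ht (t, x).
  by move=> It Ox; exact: (eht _ (IO _ _ It Ox)).
have iE i t x : I t -> Omega x -> 'D_(unit_vec i) (u t) x = hi i (t, x).
  by move=> It Ox; exact: ((hiP i).2 _ (IO _ _ It Ox)).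
have iiE i t x : I t -> Omega x ->
    'D_(unit_vec i) ('D_(unit_vec i) (u t)) x = hii i (t, x).
  by move=> It Ox; exact: ((hiiP i).2 _ (IO _ _ It Ox)).
have pairE (h : R * 'rV[R]_n -> R) : (fun p => h (p.1, p.2)) = h.
  by apply/funext => -[].
exists (fun t x => ht (t, x)), (fun i t x => hi i (t, x)),
  (fun i t x => hii i (t, x)); split.
- by split=> [|i|i]; rewrite pairE//; [exact: (hiP i).1|exact: (hiiP i).1].
- move=> t x It Ox; apply: DeriveDef; first exact: du_t.
  by rewrite -derive1E -tE.
- by move=> t x i It Ox; apply: DeriveDef; [exact: du_i|exact: iE].
- move=> t x i It Ox.
  apply: (near_eq_is_derive (f := 'D_(unit_vec i) (u t))).
    have nO : \forall y \near x, Omega y by exact: open_nbhs_nbhs.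
    by near=> y; apply: iE => //; near: y.
  by apply: DeriveDef; [exact: du_ii|exact: iiE].
- move=> t x It Ox; split; first exact: tE.
  by apply: eq_bigr => i _; exact: iiE.
Unshelve. all: by end_near. Qed.

End C21_data.

Section initial_layer.
Context {R : realType} {n : nat} (Omega : set 'rV[R]_n).
Variables (u0 : 'rV[R]_n -> R) (v : R -> 'rV[R]_n -> R) (L : R).
Hypothesis open_Omega : open Omega.
Hypothesis L_gt0 : 0 < L.
Hypothesis u0_lip : forall x y, closure Omega x -> closure Omega y ->
  `|u0 y - u0 x| <= L * enorm (y - x).
Hypothesis u0_boundary : forall x, closure Omega x -> ~ Omega x -> u0 x = 0.
Hypothesis heat_flow : Dirichlet_heat_flow Omega u0 v.

(** [alpha + beta |x - x0|^2 + gamma t], with the constants below, is an exact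
    solution of the heat equation that initially lies above [L |x - x0|]; hence
    [v] stays between [u0 x0] minus it and [u0 x0] plus it.  The sign [sg] treats both
    bounds at once. *)
Lemma heat_flow_cone (sg mu_ : R) x0 (t : R) : sg = 1 \/ sg = -1 -> 0 < mu_ ->
  Omega x0 -> 0 < t ->
  sg * (v t x0 - u0 x0) <= L * mu_ / 2 + L / mu_ * n%:R * t.
Proof.
move=> sgE mu0 Ox0 t0.
pose beta := L / (2 * mu_); pose gamma := L / mu_ * n%:R; pose alpha := L * mu_ / 2.
have beta0 : 0 < beta by rewrite divr_gt0// mulr_gt0.
have gamma0 : 0 <= gamma by apply: mulr_ge0 => //; apply: divr_ge0; exact: ltW.
have alpha0 : 0 < alpha by rewrite divr_gt0// mulr_gt0.
have sg1 (r : R) : sg * r <= `|r|.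
  case: sgE => ->; first by rewrite mul1r ler_norm.
  by rewrite mulN1r -normrN ler_norm.
have cone x : L * enorm (x - x0) <= alpha + beta * sqnorm (x - x0).
  rewrite -enorm_sqr -subr_ge0.
  rewrite (_ : _ - _ = L / (2 * mu_) * (enorm (x - x0) - mu_) ^+ 2); last first.
    by rewrite /alpha /beta; field; rewrite gt_eqF.
  by rewrite mulr_ge0 ?sqr_ge0// ltW.
have [C21v [K hK] veq vbd vinit] := heat_flow.
have [ut [ui [uii [[cut cui cuii] dut dui duii eqs]]]] :=
  C21_closure_derivatives open_Omega C21v.
have cv : {within `]0, +oo[ `*` closure Omega, continuous (fun p => v p.1 p.2)}.
  by case: C21v.
pose w s x := sg * (v s x - u0 x0) - (alpha + beta * sqnorm (x - x0) + gamma * s).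
have vK s x : 0 < s -> closure Omega x -> sg * (v s x - u0 x0) <= K + `|u0 x0|.
  move=> s0 clx; apply: le_trans (sg1 _) _; apply: le_trans (ler_normB _ _) _.
  by rewrite lerD2r hK.
have K1 : 0 <= K + `|u0 x0|.
  rewrite addr_ge0//; apply: le_trans (hK t x0 t0 (subset_closure Ox0)).
  exact: normr_ge0.
have sq0 x : 0 <= beta * sqnorm (x - x0) by rewrite mulr_ge0 ?sqnorm_ge0// ltW.
(* Beyond this distance from the origin the quadratic term exceeds the bound of
   [sg * (v - u0 x0)]. *)
pose rho := Num.sqrt ((K + `|u0 x0|) / beta) + `|x0|.
have posI (s : R) : 0 < s -> `]0, +oo[%classic s by rewrite /= in_itv/= andbT.
have lipK x : closure Omega x -> sg * (u0 x - u0 x0) <= alpha + beta * sqnorm (x - x0).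
  move=> clx; apply: le_trans (sg1 _) _; apply: le_trans (cone x).
  exact: u0_lip (subset_closure Ox0) clx.
have csq : continuous (fun x : 'rV[R]_n => sqnorm (x - x0)).
  move=> x; apply: (continuous_comp (f := fun y : 'rV[R]_n => y - x0) (g := @sqnorm R n)).
    exact: continuous_translation.
  exact: continuous_sqnorm.
have ccoord i : continuous (fun x : 'rV[R]_n => (x - x0) 0 i).
  move=> x; apply: (continuous_comp (f := fun y : 'rV[R]_n => y - x0)
    (g := fun y : 'rV[R]_n => y 0 i)); first exact: continuous_translation.
  exact: coord_continuous.
have csnd (h : 'rV[R]_n -> R) (p : R * 'rV[R]_n) : continuous h ->
    h q.2 @[q --> within (`]0, +oo[ `*` closure Omega) (nbhs p)] --> h p.2.
  by move=> ch; exact: (cvg_within_snd _ (ch p.2)).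
have cfst (p : R * 'rV[R]_n) :
    q.1 @[q --> within (`]0, +oo[ `*` closure Omega) (nbhs p)] --> p.1.
  by apply: cvg_within_filter; exact: cvg_fst.
suff : w t x0 <= 0.
  by rewrite /w subrr sqnorm0 mulr0 addr0 subr_le0.
apply: (@weak_max_principle R n Omega w
  (fun s x => sg * ut s x - gamma)
  (fun i s x => sg * ui i s x - beta * (2 * (x - x0) 0 i))
  (fun i s x => sg * uii i s x - beta * 2)
  rho (K + `|u0 x0|)
  (fun x => sg * (u0 x - u0 x0) - (alpha + beta * sqnorm (x - x0)))) => //.
- apply/subspace_continuousP => p Ip; rewrite /from_subspace /w.
  apply: cvgB.
    apply: cvgM; first exact: cvg_cst.
    apply: cvgB; last exact: cvg_cst.
    by move/subspace_continuousP : cv; exact.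
  apply: cvgD.
    apply: cvgD; first exact: cvg_cst.
    by apply: cvgM; [exact: cvg_cst|exact: csnd csq].
  by apply: cvgM; [exact: cvg_cst|exact: cfst].
- apply/subspace_continuousP => p Ip; apply: cvgB; last exact: cvg_cst.
  apply: cvgM; first exact: cvg_cst.
  by move/subspace_continuousP : cut; exact.
- move=> i; apply/subspace_continuousP => p Ip; apply: cvgB.
    apply: cvgM; first exact: cvg_cst.
    by have /subspace_continuousP := cui i; exact.
  apply: cvgM; first exact: cvg_cst.
  apply: cvgM; first exact: cvg_cst.
  exact: csnd (ccoord i).
- move=> i; apply/subspace_continuousP => p Ip; apply: cvgB; last exact: cvg_cst.
  apply: cvgM; first exact: cvg_cst.
  by have /subspace_continuousP := cuii i; exact.
- move=> s x s0 Ox; have d := dut s x (posI s s0) Ox.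
  have -> : w^~ x = sg *: v^~ x
      - cst (sg * u0 x0 + alpha + beta * sqnorm (x - x0)) - gamma *: id.
    apply/funext => r; transitivity (sg * v r x
      - (sg * u0 x0 + alpha + beta * sqnorm (x - x0)) - gamma * r) => //.
    by rewrite /w; ring.
  apply: is_derive_eq.
  by rewrite /GRing.scale/=; ring.
- move=> s x i s0 Ox; have d := dui s x i (posI s s0) Ox.
  have d2 := is_derive_sqnormB x x0 i.
  have -> : w s = sg *: v s - cst (sg * u0 x0 + alpha + gamma * s)
      - beta *: (fun y => sqnorm (y - x0)).
    apply/funext => y; transitivity (sg * v s y
      - (sg * u0 x0 + alpha + gamma * s) - beta * sqnorm (y - x0)) => //.
    by rewrite /w; ring.
  apply: is_derive_eq.
  by rewrite /GRing.scale/=; ring.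
- move=> s x i s0 Ox; have d := duii s x i (posI s s0) Ox.
  have d2 := is_derive_coordB x x0 i.
  have -> : (fun y => sg * ui i s y - beta * (2 * (y - x0) 0 i))
      = sg *: ui i s - beta *: (2 *: (fun y => (y - x0) 0 i)).
    by apply/funext => r.
  apply: is_derive_eq.
  by rewrite /GRing.scale/=; ring.
- move=> s x s0 Ox; have [e1 e2] := eqs s x (posI s s0) Ox.
  rewrite sumrB -mulr_sumr -e2 -e1 veq// sumr_const card_ord lerD2l lerN2.
  rewrite le_eqVlt; apply/orP; left; apply/eqP.
  by rewrite -mulr_natr /gamma /beta; field; rewrite gt_eqF.
- move=> s x s0 clx nOx.
  have bx : boundary Omega x by split => // /interior_subset.
  rewrite /w vbd// subr_le0; apply: le_trans (_ : alpha + beta * sqnorm (x - x0) <= _).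
    by have := lipK x clx; rewrite u0_boundary.
  by rewrite lerDl mulr_ge0// ltW.
- by rewrite addr_ge0 ?sqrtr_ge0.
- move=> s x s0 Ox; rewrite /w subr_gt0 => wx.
  have := vK s x s0 (subset_closure Ox) => vKx.
  have gs : 0 <= gamma * s by rewrite mulr_ge0// ltW.
  have sq : sqnorm (x - x0) <= (K + `|u0 x0|) / beta.
    by rewrite ler_pdivlMr// mulrC; lra.
  rewrite -(subrK x0 x); apply: le_trans (ler_normD _ _) _.
  rewrite lerD2r; apply: le_trans (mx_norm_le_enorm _) _.
  by rewrite ler_wsqrtr.
- move=> s x s0 Ox; rewrite /w lerBlDr; apply: le_trans (vK s x s0 (subset_closure Ox)) _.
  rewrite lerDl addr_ge0//; last by rewrite mulr_ge0// ltW.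
  by rewrite addr_ge0// ltW.
- by move=> x Ox; rewrite subr_le0; apply: lipK; exact: subset_closure.
- apply: filterS vinit => x hx Ox.
  have h := hx Ox.
  rewrite -[X in _ --> _ - X]addr0 -[X in _ - (_ + X)](mulr0 gamma).
  apply: cvgB.
    apply: cvgM; first exact: cvg_cst.
    by apply: cvgB; [exact: h|exact: cvg_cst].
  apply: cvgD; first exact: cvg_cst.
  apply: cvgM; first exact: cvg_cst.
  exact: cvg_at_right_filter cvg_id.
Qed.

Lemma heat_flow_uniform (eps : R) : 0 < eps ->
  exists2 tau, 0 < tau & forall t x, 0 < t -> t < tau -> Omega x ->
    `|v t x - u0 x| <= eps.
Proof.
move=> eps0.
(* This [mu_] makes the term [L mu_ / 2] of the cone equal to [eps / 2]. *)
pose mu_ := eps / L; pose g := L / mu_ * n%:R.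
have mu0 : 0 < mu_ by rewrite divr_gt0.
have g0 : 0 <= g by apply: mulr_ge0 => //; apply: divr_ge0; exact: ltW.
exists (eps / (2 * (g + 1))); first by rewrite divr_gt0// mulr_gt0// ltr_wpDl.
move=> t x t0 tt Ox.
have gt : g * t <= eps / 2.
  have : t * (2 * (g + 1)) < eps by rewrite -ltr_pdivlMr// mulr_gt0// ltr_wpDl.
  by move: t0 g0; nra.
have E : L * mu_ / 2 = eps / 2 by rewrite /mu_; field; rewrite gt_eqF.
have h1 := heat_flow_cone (or_introl erefl) mu0 Ox t0.
have h2 := heat_flow_cone (or_intror erefl) mu0 Ox t0.
rewrite -/g E mul1r in h1; rewrite -/g E mulN1r in h2.
by rewrite ler_norml; apply/andP; split; lra.
Qed.

End initial_layer.

(** * Lipschitz bounds for the gradient equation *)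

Lemma within_continuous_comp {X Y Z : topologicalType} (C : set X) (D : set Y)
    (h : Y -> Z) (pi : X -> Y) :
  {within D, continuous h} -> continuous pi -> (forall x, C x -> D (pi x)) ->
  {within C, continuous (h \o pi)}.
Proof.
move=> /subspace_continuousP ch cpi CD; apply/subspace_continuousP => x Cx U nU.
have hn : \forall y \near x, D (pi y) -> U (h (pi y)).
  exact: cpi x _ (ch (pi x) (CD x Cx) U nU).
suff : \forall y \near x, C y -> U (h (pi y)) by [].
by apply: filterS hn => y hy /CD.
Qed.

Section continuous_pairs.
Context {R : realType} {T : topologicalType} {V : normedModType R}.

Lemma continuous_first_point : continuous (fun q : T * (V * V) => q.2.1).
Proof. by move=> q; apply: (@cvg_comp _ _ _ snd fst); [exact: cvg_snd|exact: cvg_fst]. Qed.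

Lemma continuous_second_point : continuous (fun q : T * (V * V) => q.2.2).
Proof. by move=> q; apply: (@cvg_comp _ _ _ snd snd); [exact: cvg_snd|exact: cvg_snd]. Qed.

Lemma continuous_time_first : continuous (fun q : T * (V * V) => (q.1, q.2.1)).
Proof. by move=> q; apply: cvg_pair; [exact: cvg_fst|exact: continuous_first_point]. Qed.

Lemma continuous_time_second : continuous (fun q : T * (V * V) => (q.1, q.2.2)).
Proof. by move=> q; apply: cvg_pair; [exact: cvg_fst|exact: continuous_second_point]. Qed.

Lemma continuous_points_difference : continuous (fun q : T * (V * V) => q.2.2 - q.2.1).
Proof.
by move=> q; apply: cvgB; [exact: continuous_second_point|exact: continuous_first_point].
Qed.

End continuous_pairs.

Section maxima.
Context {R : realType}.

(** This provides maxima on the unbounded set [S], once a penalty confines the points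
    where [Z] is large to the compact set [K]. *)
Lemma max_over_superlevel {X : topologicalType} (S K : set X) (Z : X -> R)
    (eta : R) (x0 : X) :
  compact K -> K `<=` S -> {within K, continuous Z} ->
  (forall x, S x -> eta < Z x -> K x) -> S x0 -> eta < Z x0 ->
  exists x, [/\ S x, eta < Z x & forall y, S y -> Z y <= Z x].
Proof.
move=> cK KS cZ ZK Sx0 Zx0.
have K0 : K !=set0 by exists x0; exact: ZK.
have [x /set_mem Kx hx] := compact_EVT_max K0 cK cZ.
have Zx : eta < Z x.
  by apply: (lt_le_trans Zx0); apply/hx/mem_set/ZK.
exists x; split=> //; first exact: KS.
move=> y Sy; have [h|h] := leP (Z y) eta; first exact: le_trans h (ltW Zx).
by apply/hx/mem_set/ZK.
Qed.

Context {n : nat}.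
Implicit Types (Omega : set 'rV[R]_n) (Phi : 'rV[R]_n -> R) (x z e : 'rV[R]_n).

Lemma near_line Omega z e : open Omega -> Omega z ->
  \forall s \near (0 : R), Omega (z + s *: e).
Proof.
move=> oO Oz; have := @continuous_line _ _ z e (0 : R) Omega.
by rewrite scale0r addr0; apply; exact: open_nbhs_nbhs.
Qed.

Lemma interior_max_partial Omega Phi z i (l : R) : open Omega -> Omega z ->
  is_derive z (unit_vec i) Phi l -> (forall y, Omega y -> Phi y <= Phi z) -> l = 0.
Proof.
move=> oO Oz dPhi hmax.
apply: (is_derive_max0 (is_derive_line0 dPhi)).
by apply: filterS (near_line (unit_vec i) oO Oz) => s Os; rewrite scale0r addr0 hmax.
Qed.

Lemma is_derive_enormB x c i : x != c ->
  is_derive x (unit_vec i) (fun y => enorm (y - c)) ((x - c) 0 i / enorm (x - c)).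
Proof.
move=> xc; have d0 : 0 < enorm (x - c) by rewrite enorm_gt0// subr_eq0.
have sq : 0 < sqnorm (x - c) by rewrite -enorm_sqr exprn_gt0.
have := @is_derive_compl R _ Num.sqrt (fun y => sqnorm (y - c)) x _ _ _
  (is_derive1_sqrt sq) (is_derive_sqnormB x c i).
rewrite -/(enorm (x - c)); congr is_derive.
by field; rewrite gt_eqF.
Qed.

(** A gradient that differs from the unit vector [e] by the derivative [2 d^2 z] of a
    penalty has almost unit length, as [d |z|] stays bounded. *)
Lemma gradient_defect e z (d m : R) : sqnorm e = 1 -> 0 < d -> d <= 1 ->
  d * enorm z <= m ->
  `|1 - sqnorm (e + (2 * d ^+ 2) *: z)| <= d * (4 * m + 4 * m ^+ 2).
Proof.
move=> e1 d0 d1 dz.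
have z0 := enorm_ge0 z.
have dz0 : 0 <= d * enorm z by rewrite mulr_ge0// ltW.
have m0 : 0 <= m by exact: le_trans dz.
have ve k : vdot e k <= enorm k.
  by apply: le_trans (vdot_le_enorm e k) _; rewrite {1}/enorm e1 sqrtr1 mul1r.
have v1 := ve z; have := ve (- z); rewrite vdotNr enormN => v2.
have dv : `|d * vdot e z| <= m.
  rewrite normrM gtr0_norm//; apply: le_trans dz; rewrite ler_pM2l//.
  by rewrite ler_norml; apply/andP; split; lra.
rewrite sqnormD e1 sqnormZ vdotZr.
rewrite (_ : 1 - _ = - (4 * d * (d * vdot e z) + 4 * (d * d) * (d ^+ 2 * sqnorm z))); last by ring.
rewrite normrN; apply: le_trans (ler_normD _ _) _.
have A : `|4 * d * (d * vdot e z)| <= 4 * d * m.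
  by rewrite normrM ger0_norm ?ler_wpM2l// ?mulr_ge0// ltW.
have q0 : 0 <= d ^+ 2 * sqnorm z by rewrite mulr_ge0 ?sqr_ge0 ?sqnorm_ge0.
have B : d ^+ 2 * sqnorm z <= m ^+ 2.
  by rewrite -enorm_sqr -exprMn lerXn2r// nnegrE.
have C : `|4 * (d * d) * (d ^+ 2 * sqnorm z)| <= 4 * d * m ^+ 2.
  rewrite ger0_norm; last by rewrite mulr_ge0// mulr_ge0// mulr_ge0// ltW.
  apply: ler_pM => //; first by rewrite mulr_ge0// mulr_ge0// ltW.
  by rewrite ler_pM2l// ger_pMr.
have -> : d * (4 * m + 4 * m ^+ 2) = 4 * d * m + 4 * d * m ^+ 2 by ring.
exact: lerD A C.
Qed.

End maxima.

Section gradient_equation.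
Context {R : realType} {n : nat} (Omega : set 'rV[R]_n).
Variables (g gt a : R -> 'rV[R]_n -> R) (gi gii : 'I_n -> R -> 'rV[R]_n -> R).
Variables (tau t0 K A eta : R).

Hypothesis open_Omega : open Omega.
Hypothesis cg : {within `[tau, t0] `*` closure Omega, continuous (fun p => g p.1 p.2)}.
Hypothesis dgt : forall (t : R) x, tau < t <= t0 -> Omega x ->
  is_derive t 1 (g^~ x) (gt t x).
Hypothesis dgi : forall (t : R) x i, tau < t <= t0 -> Omega x ->
  is_derive x (unit_vec i) (g t) (gi i t x).
Hypothesis dgii : forall (t : R) x i, tau < t <= t0 -> Omega x ->
  is_derive x (unit_vec i) (gi i t) (gii i t x).
Hypothesis g_eq : forall (t : R) x, tau < t <= t0 -> Omega x ->
  gt t x = \sum_i gii i t x + a t x * (1 - \sum_i gi i t x ^+ 2).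
Hypothesis a_bound : forall (t : R) x, tau < t <= t0 -> Omega x -> `|a t x| <= A.
Hypothesis g_bound : forall (t : R) x, tau <= t <= t0 -> closure Omega x ->
  0 <= g t x <= K.
Hypothesis g_boundary : forall (t : R) x, tau <= t <= t0 -> closure Omega x ->
  ~ Omega x -> g t x = 0.
Hypothesis A0 : 0 <= A.
(** The number [eta] leaves room for initial values that are only close to a
    [1]-Lipschitz function. *)
Hypothesis eta_ge0 : 0 <= eta.

Let m := K + 1.

Lemma penalty_radius (d : R) (z : 'rV[R]_n) : 0 < d -> d ^+ 2 * sqnorm z <= K -> d * enorm z <= m.
Proof.
move=> d0 h.
have s0 : 0 <= d * enorm z by rewrite mulr_ge0 ?enorm_ge0// ltW.
have K0 : 0 <= K by apply: le_trans h; rewrite mulr_ge0 ?sqr_ge0 ?sqnorm_ge0.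
rewrite leNgt; apply/negP => mz.
have : (d * enorm z) ^+ 2 <= K by rewrite exprMn enorm_sqr.
by move: mz s0; rewrite /m; move: (d * _) => r; nra.
Qed.

Lemma compact_penalty (d : R) : 0 < d ->
  compact (closure Omega `&` [set z : 'rV[R]_n | d ^+ 2 * sqnorm z <= K]).
Proof.
move=> d0; apply: bounded_closed_compact.
  exists (m / d); split; first by rewrite num_real.
  move=> M hM z [_ /= hz]; apply: le_trans (ltW hM).
  apply: le_trans (mx_norm_le_enorm _) _.
  by rewrite ler_pdivlMr// mulrC penalty_radius.
apply: closedI; first exact: closed_closure.
rewrite (_ : [set z | _] = (fun z : 'rV[R]_n => d ^+ 2 * sqnorm z) @^-1` [set r | r <= K])//.
apply: preimage_closed; last exact: closed_le.
move=> z _; apply: (@continuousM _ _ (cst (d ^+ 2)) (@sqnorm R n)).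
  exact: cst_continuous.
exact: continuous_sqnorm.
Qed.

(* [d B] bounds the error that the penalty causes in the equation at a maximum. *)
Let B := 4 * n%:R + 2 * A * (4 * m + 4 * m ^+ 2).

(** [d^2] is the coefficient of the penalty and [sigma] the speed of a correction in
    time: each changes the value at a given point by at most [theta], whereas
    [d B < sigma] makes the equation contradict [sigma <= g_t] at a maximum. *)
Lemma choose_parameters (theta s : R) (q : R) : 0 < theta -> 0 <= s -> 0 <= q ->
  0 <= B -> exists (sigma d : R), [/\ 0 < sigma, 0 < d <= 1,
    sigma * s <= theta, d ^+ 2 * q <= theta & d * B < sigma].
Proof.
move=> th0 s0 q0 B0.
pose sigma := theta / (s + 1).
have s10 : 0 < s + 1 by lra.
have sg0 : 0 < sigma by rewrite divr_gt0.
pose d := Num.min 1 (Num.min (theta / (q + 1)) (sigma / (B + 1))).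
have q10 : 0 < q + 1 by lra.
have B10 : 0 < B + 1 by lra.
have d0 : 0 < d by rewrite !lt_min ltr01 !divr_gt0.
have d1 : d <= 1 by rewrite ge_min lexx.
have dq : d <= theta / (q + 1) by rewrite !ge_min lexx orbT.
have dB : d <= sigma / (B + 1) by rewrite !ge_min lexx !orbT.
exists sigma, d; split=> //.
- by rewrite d0 d1.
- by rewrite /sigma mulrAC ler_pdivrMr//; nra.
- by move: dq; rewrite ler_pdivlMr// => dq; nra.
- by move: dB; rewrite ler_pdivlMr// => dB; nra.
Qed.

(** The affine function [e.(z - p)] is a stationary solution with gradient of length
    [1], nonnegative on [Omega]; in terms of [u] it is the profile [phi (e.(z - p))] of
    a half-space that contains [Omega]. *)
Lemma halfspace_bound p e : sqnorm e = 1 ->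
  (forall z, closure Omega z -> 0 <= vdot e (z - p)) ->
  (forall z, closure Omega z -> g tau z <= vdot e (z - p) + eta) ->
  forall t z, tau <= t <= t0 -> closure Omega z -> g t z <= vdot e (z - p) + eta.
Proof.
move=> e1 ez ginit ts zs tsI clzs; rewrite leNgt; apply/negP => gap.
have [tt Kp] : tau <= ts /\ 0 <= K.
  by have /andP[h _] := tsI; have /andP[h1 /(le_trans h1)] := g_bound tsI clzs.
pose theta := (g ts zs - (vdot e (zs - p) + eta)) / 3.
have th0 : 0 < theta by rewrite divr_gt0// subr_gt0.
have thE : g ts zs - (vdot e (zs - p) + eta) = 3 * theta by rewrite /theta; field.
have m0 : 0 <= m by rewrite /m; lra.
have B0 : 0 <= B by rewrite /B addr_ge0 ?mulr_ge0// ?addr_ge0// ?mulr_ge0// ?exprn_ge0.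
have ts0 : 0 <= ts - tau by rewrite subr_ge0.
have [sigma [d [sg0 /andP[d0 d1] hs hq hB]]] := choose_parameters th0 ts0 (sqnorm_ge0 zs) B0.
pose S : set (R * 'rV[R]_n) := `[tau, t0] `*` closure Omega.
pose C : set (R * 'rV[R]_n) := `[tau, t0] `*` (closure Omega `&` [set z | d ^+ 2 * sqnorm z <= K]).
(* Affine comparison function, penalty at infinity, correction in time. *)
pose Z (q : R * 'rV[R]_n) := g q.1 q.2 - vdot e (q.2 - p) - d ^+ 2 * sqnorm (q.2 - 0)
  - sigma * (q.1 - tau).
have SI s z : S (s, z) -> tau <= s <= t0 /\ closure Omega z.
  by move=> [/=]; rewrite in_itv.
have SC (s : R) (y : 'rV[R]_n) : S (s, y) -> eta < Z (s, y) -> C (s, y).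
  move=> Ssy Zsy; have [sI cly] := SI _ _ Ssy.
  split; first exact: Ssy.1.
  split=> //=.
  have := ez y cly; have /andP[_ gK] := g_bound sI cly.
  have /andP[taus _] := sI.
  have : 0 <= sigma * (s - tau) by apply: mulr_ge0; [exact: ltW|rewrite subr_ge0].
  move: Zsy gK; rewrite /Z /= subr0.
  by move: (g s y) (vdot _ _) (_ * sqnorm y) (sigma * _) eta_ge0 => *; lra.
have [t [z [Stz Ztz Zmax]]] : exists (t : R) (z : 'rV[R]_n),
    [/\ S (t, z), eta < Z (t, z) & forall y, S y -> Z y <= Z (t, z)].
  suff [[t z] h] : exists q, [/\ S q, eta < Z q & forall y, S y -> Z y <= Z q].
    by exists t, z.
  apply: (@max_over_superlevel _ _ _ C _ _ (ts, zs)).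
  - by apply: compact_setX; [exact: segment_compact|exact: compact_penalty].
  - by move=> [s y] [/= h [cly _]].
  - apply/subspace_continuousP => q Cq.
    have Sq : S q by case: q Cq => s y [/= h [cly _]].
    apply: cvgB.
      apply: cvgB.
        apply: cvgB.
          have : {within C, continuous (fun q => g q.1 q.2)}.
            by apply: continuous_subspaceW cg => -[s y] [/= h [cly _]].
          by move/subspace_continuousP; exact.
        apply: (@cvg_within_snd _ _ _ _ (fun y : 'rV[R]_n => vdot e (y - p))).
        apply: (continuous_comp (f := fun y : 'rV[R]_n => y - p) (g := vdot e)).
          exact: continuous_translation.
        exact: continuous_vdot.
      apply: cvgM; first exact: cvg_cst.
      apply: (@cvg_within_snd _ _ _ _ (fun y : 'rV[R]_n => sqnorm (y - 0))).
      apply: (continuous_comp (f := fun y : 'rV[R]_n => y - 0) (g := @sqnorm R n)).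
        exact: continuous_translation.
      exact: continuous_sqnorm.
    apply: cvgM; first exact: cvg_cst.
    by apply: cvgB; [apply: cvg_within_filter; exact: cvg_fst|exact: cvg_cst].
  - by move=> [s y]; exact: SC.
  - by split=> //=; rewrite in_itv.
  - by rewrite /Z /= subr0; lra.
have [tI clz] := SI _ _ Stz.
have ez' := ez z clz.
have dz0 : 0 <= d ^+ 2 * sqnorm z by rewrite mulr_ge0 ?sqr_ge0 ?sqnorm_ge0.
have /andP[g0 gK] := g_bound tI clz.
have st0 : 0 <= sigma * (t - tau).
  by have /andP[h _] := tI; apply: mulr_ge0; [exact: ltW|rewrite subr_ge0].
move: (Ztz); rewrite /Z /= subr0 => Ztz'.
have Oz : Omega z.
  apply: contrapT => nOz; have gz := g_boundary tI clz nOz.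
  move: Ztz' ez' dz0 st0; rewrite gz.
  by move: (vdot _ _) (_ * sqnorm z) (sigma * _) eta_ge0 => *; lra.
have tt0 : tau < t <= t0.
  case/andP: (tI) => h ->; rewrite andbT lt_neqAle h andbT.
  apply/eqP => tE; have := ginit z clz; move: Ztz' dz0 st0; rewrite -tE.
  by move: (g tau z) (vdot _ _) (_ * sqnorm z) (sigma * _) => *; lra.
have dzK : d ^+ 2 * sqnorm z <= K.
  move: Ztz' ez' st0 gK.
  by move: (g t z) (vdot _ _) (_ * sqnorm z) (sigma * _) eta_ge0 => *; lra.
have dz : d * enorm z <= m by exact: penalty_radius.
have first_order i : gi i t z = e 0 i + (2 * d ^+ 2) * z 0 i /\ gii i t z <= 2 * d ^+ 2.
  pose Phi y := g t y - vdot e (y - p) - d ^+ 2 * sqnorm (y - 0) - sigma * (t - tau).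
  pose Phi1 y := gi i t y - e 0 i - d ^+ 2 * (2 * (y - 0) 0 i).
  have dPhi y : Omega y -> is_derive y (unit_vec i) Phi (Phi1 y).
    move=> Oy; have h1 := dgi i tt0 Oy; have h2 := is_derive_vdotB e y p i.
    have h3 := is_derive_sqnormB y 0 i.
    rewrite (_ : Phi = g t - (fun y => vdot e (y - p)) -
      d ^+ 2 *: (fun y => sqnorm (y - 0)) - cst (sigma * (t - tau))); last by apply/funext.
    apply: is_derive_eq.
    by rewrite /GRing.scale/= subr0.
  have dPhi1 : is_derive z (unit_vec i) Phi1 (gii i t z - d ^+ 2 * 2).
    have h1 := dgii i tt0 Oz; have h3 := is_derive_coordB z 0 i.
    rewrite (_ : Phi1 = gi i t - cst (e 0 i) -
      (d ^+ 2 * 2) *: (fun y : 'rV[R]_n => (y - 0) 0 i)); last first.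
      by apply/funext => y; rewrite /Phi1 mulrA.
    apply: is_derive_eq.
    by rewrite /GRing.scale/= subr0 mulr1.
  have := @is_derive2_max R (fun s => Phi (z + s *: unit_vec i))
    (fun s => Phi1 (z + s *: unit_vec i)) 0 _ _ (is_derive_line0 dPhi1) _.
  case.
  - apply: filterS (near_line (unit_vec i) open_Omega Oz) => s Os.
    by apply: is_derive_line; exact: dPhi.
  - apply: filterS (near_line (unit_vec i) open_Omega Oz) => s Os.
    rewrite scale0r addr0; apply: (Zmax (t, _)); split; first exact: Stz.1.
    exact: subset_closure.
  - rewrite scale0r addr0 /Phi1 subr0 => h1 h2; split; last by lra.
    by lra.
have time : sigma <= gt t z.
  have /andP[taut tle] := tt0.
  have d1' : is_derive t 1 (fun s => Z (s, z)) (gt t z - sigma).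
    have h := dgt tt0 Oz.
    rewrite (_ : (fun s => Z (s, z)) = g^~ z - cst (vdot e (z - p)) -
      cst (d ^+ 2 * sqnorm (z - 0)) - sigma *: (id - cst tau)); last by apply/funext.
    apply: is_derive_eq.
    by rewrite /GRing.scale/= !subr0 mulr1.
  rewrite -subr_ge0; apply: (is_derive_ge0_left_max d1').
  near=> h; apply: Zmax; split; last exact: clz.
  rewrite /= in_itv/=.
  have h0 : 0 < h by near: h; exact: nbhs_right_gt.
  have ht : h < t - tau by near: h; apply: nbhs_right_lt; rewrite subr_gt0.
  by apply/andP; split; lra.
have grad : \sum_i gi i t z ^+ 2 = sqnorm (e + (2 * d ^+ 2) *: z).
  by apply: eq_bigr => i _; rewrite (first_order i).1 !mxE.
have lap : \sum_i gii i t z <= 2 * d ^+ 2 * n%:R.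
  rewrite mulr_natr -[n in leRHS]card_ord -sumr_const.
  by apply: ler_sum => i _; exact: (first_order i).2.
have defect : a t z * (1 - \sum_i gi i t z ^+ 2) <= A * (d * (4 * m + 4 * m ^+ 2)).
  rewrite grad; apply: le_trans (ler_norm _) _; rewrite normrM.
  by apply: ler_pM => //; [exact: a_bound|exact: gradient_defect].
have := g_eq tt0 Oz => E; rewrite E in time.
have dd : d ^+ 2 * n%:R <= d * n%:R by rewrite ler_wpM2r// expr2 ger_pMr.
have P0 : 0 <= A * (d * (4 * m + 4 * m ^+ 2)).
  by rewrite mulr_ge0// mulr_ge0 ?(ltW d0)// addr_ge0// mulr_ge0// exprn_ge0.
have dn : 0 <= d * n%:R by rewrite mulr_ge0// ltW.
have BE : d * B = 4 * (d * n%:R) + 2 * (A * (d * (4 * m + 4 * m ^+ 2))).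
  by rewrite /B; ring.
rewrite -mulrA in lap.
by lra.
Unshelve. all: by end_near. Qed.

(** The flow of [g_t = Lap g + a (1 - |grad g|^2)] preserves the Lipschitz constant
    [1].  At a positive maximum of [g(y) - g(x) - |y - x|] both gradients are the unit
    vector [(y - x) / |y - x|], so the terms in [a] vanish, while translating both
    points does not change [|y - x|] and gives [Lap g(y) <= Lap g(x)].  Pairs with [y]
    on the boundary are harmless because [g(y) = 0 <= g(x)]; those with [x] on the
    boundary are the second assumption. *)
Lemma two_point_bound :
  (forall x y, closure Omega x -> closure Omega y ->
    g tau y - g tau x <= enorm (y - x) + eta) ->
  (forall t x y, tau <= t <= t0 -> closure Omega x -> ~ Omega x -> Omega y ->
    g t y <= enorm (y - x) + eta) ->
  forall t x y, tau <= t <= t0 -> closure Omega x -> closure Omega y ->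
    g t y - g t x <= enorm (y - x) + eta.
Proof.
move=> ginit gbd ts xs ys tsI clxs clys; rewrite leNgt; apply/negP => gap.
have [tt Kp] : tau <= ts /\ 0 <= K.
  by have /andP[h _] := tsI; have /andP[h1 /(le_trans h1)] := g_bound tsI clxs.
pose theta := (g ts ys - g ts xs - (enorm (ys - xs) + eta)) / 3.
have th0 : 0 < theta by rewrite divr_gt0// subr_gt0.
have thE : g ts ys - g ts xs - (enorm (ys - xs) + eta) = 3 * theta.
  by rewrite /theta; field.
have m0 : 0 <= m by rewrite /m; lra.
have B0 : 0 <= B by rewrite /B addr_ge0 ?mulr_ge0// ?addr_ge0// ?mulr_ge0// ?exprn_ge0.
have ts0 : 0 <= ts - tau by rewrite subr_ge0.
have qs0 : 0 <= sqnorm xs + sqnorm ys by rewrite addr_ge0// sqnorm_ge0.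
have [sigma [d [sg0 /andP[d0 d1] hs hq hB]]] := choose_parameters th0 ts0 qs0 B0.
pose D (k : R) : set 'rV[R]_n := closure Omega `&` [set z | d ^+ 2 * sqnorm z <= k].
pose S : set (R * ('rV[R]_n * 'rV[R]_n)) := `[tau, t0] `*` (closure Omega `*` closure Omega).
pose C : set (R * ('rV[R]_n * 'rV[R]_n)) := `[tau, t0] `*` (D K `*` D K).
pose Z (q : R * ('rV[R]_n * 'rV[R]_n)) := g q.1 q.2.2 - g q.1 q.2.1
  - enorm (q.2.2 - q.2.1) - d ^+ 2 * (sqnorm (q.2.1 - 0) + sqnorm (q.2.2 - 0))
  - sigma * (q.1 - tau).
have SI (s : R) (x y : 'rV[R]_n) : S (s, (x, y)) ->
    [/\ tau <= s <= t0, closure Omega x & closure Omega y].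
  by move=> [/= + [clx cly]]; rewrite in_itv.
have SC (s : R) (x y : 'rV[R]_n) : S (s, (x, y)) -> eta < Z (s, (x, y)) ->
    C (s, (x, y)).
  move=> Ss Zs; have [sI clx cly] := SI _ _ _ Ss.
  have /andP[gx0 _] := g_bound sI clx; have /andP[_ gyK] := g_bound sI cly.
  have /andP[taus _] := sI.
  have st : 0 <= sigma * (s - tau) by apply: mulr_ge0; [exact: ltW|rewrite subr_ge0].
  have e0 := enorm_ge0 (y - x).
  have dx : 0 <= d ^+ 2 * sqnorm x by rewrite mulr_ge0 ?sqr_ge0 ?sqnorm_ge0.
  have dy : 0 <= d ^+ 2 * sqnorm y by rewrite mulr_ge0 ?sqr_ge0 ?sqnorm_ge0.
  have : d ^+ 2 * sqnorm x <= K /\ d ^+ 2 * sqnorm y <= K.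
    move: Zs gx0 gyK st e0 dx dy; rewrite /Z /= !subr0 mulrDr.
    by move: (g s x) (g s y) (enorm _) (_ * sqnorm x) (_ * sqnorm y) (sigma * _) eta_ge0
      => *; split; lra.
  by move=> [hx hy]; split; first exact: Ss.1.
have [t [x [y [Sm Zm Zmax]]]] : exists (t : R) (x y : 'rV[R]_n),
    [/\ S (t, (x, y)), eta < Z (t, (x, y)) & forall q, S q -> Z q <= Z (t, (x, y))].
  suff [[t [x y]] h] : exists q, [/\ S q, eta < Z q & forall y, S y -> Z y <= Z q].
    by exists t, x, y.
  apply: (@max_over_superlevel _ _ _ C _ _ (ts, (xs, ys))).
  - apply: compact_setX; first exact: segment_compact.
    by apply: compact_setX; exact: compact_penalty.
  - by move=> [s [x y]] [/= h [[clx _] [cly _]]].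
  - have cgy : {within C, continuous (fun q => g q.1 q.2.2)}.
      apply: (within_continuous_comp (pi := fun q => (q.1, q.2.2)) cg).
        exact: continuous_time_second.
      by move=> [s [x y]] [h [_ [cly _]]].
    have cgx : {within C, continuous (fun q => g q.1 q.2.1)}.
      apply: (within_continuous_comp (pi := fun q => (q.1, q.2.1)) cg).
        exact: continuous_time_first.
      by move=> [s [x y]] [h [[clx _] _]].
    have csq (i : R * ('rV[R]_n * 'rV[R]_n) -> 'rV[R]_n) : continuous i ->
        continuous (fun q => sqnorm (i q - 0)).
      move=> ci q; apply: (continuous_comp (f := i) (g := fun z => sqnorm (z - 0))).
        exact: ci.
      apply: (continuous_comp (f := fun y : 'rV[R]_n => y - 0) (g := @sqnorm R n)).
        exact: continuous_translation.
      exact: continuous_sqnorm.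
    have cen : continuous (fun q : R * ('rV[R]_n * 'rV[R]_n) => enorm (q.2.2 - q.2.1)).
      move=> q; apply: (continuous_comp (f := fun q : R * ('rV[R]_n * 'rV[R]_n) =>
        q.2.2 - q.2.1) (g := @enorm R n)).
        exact: continuous_points_difference.
      exact: continuous_enorm.
    apply/subspace_continuousP => q Cq.
    apply: cvgB.
      apply: cvgB.
        apply: cvgB; last by apply: cvg_within_filter; exact: cen.
        apply: cvgB; first by move/subspace_continuousP : cgy; exact.
        by move/subspace_continuousP : cgx; exact.
      apply: cvgM; first exact: cvg_cst.
      apply: cvgD; apply: cvg_within_filter.
        by apply: csq; exact: continuous_first_point.
      by apply: csq; exact: continuous_second_point.
    apply: cvgM; first exact: cvg_cst.
    by apply: cvgB; [apply: cvg_within_filter; exact: cvg_fst|exact: cvg_cst].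
  - by move=> [s [x y]]; exact: SC.
  - by split=> //=; rewrite in_itv.
  - by rewrite /Z /= !subr0; lra.
have [tI clx cly] := SI _ _ _ Sm.
have /andP[gx0 gxK] := g_bound tI clx; have /andP[gy0 gyK] := g_bound tI cly.
have e0 := enorm_ge0 (y - x).
have dx0 : 0 <= d ^+ 2 * sqnorm x by rewrite mulr_ge0 ?sqr_ge0 ?sqnorm_ge0.
have dy0 : 0 <= d ^+ 2 * sqnorm y by rewrite mulr_ge0 ?sqr_ge0 ?sqnorm_ge0.
have st0 : 0 <= sigma * (t - tau).
  by have /andP[h _] := tI; apply: mulr_ge0; [exact: ltW|rewrite subr_ge0].
move: (Zm); rewrite /Z /= !subr0 mulrDr => Zm'.
have [dxK dyK] : d ^+ 2 * sqnorm x <= K /\ d ^+ 2 * sqnorm y <= K.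
  by have [_ [[_ h1] [_ h2]]] := SC _ _ _ Sm Zm; split.
have far : enorm (y - x) + eta < g t y - g t x.
  move: Zm' dx0 dy0 st0.
  by move: (g t x) (g t y) (enorm _) (_ * sqnorm x) (_ * sqnorm y) (sigma * _) => *; lra.
have yx : y != x.
  apply/eqP => yxE; move: far; rewrite yxE !subrr enorm0 add0r => h.
  by have := lt_le_trans h eta_ge0; rewrite ltxx.
have Oy : Omega y.
  apply: contrapT => nOy; move: far; rewrite (g_boundary tI cly nOy).
  by move: gx0 e0 eta_ge0; move: (g t x) (enorm _) => *; lra.
have Ox : Omega x.
  apply: contrapT => nOx; have := gbd t x y tI clx nOx Oy.
  by move: far gx0; move: (g t x) (g t y) (enorm _) => *; lra.
have tt0 : tau < t <= t0.
  case/andP: (tI) => h ->; rewrite andbT lt_neqAle h andbT.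
  apply/eqP => tE; have := ginit x y clx cly; rewrite tE.
  by move: far; move: (g t x) (g t y) (enorm _) => *; lra.
have It : `[tau, t0]%classic t by rewrite /= in_itv.
have dx : d * enorm x <= m by exact: penalty_radius.
have dy : d * enorm y <= m by exact: penalty_radius.
pose e : 'rV[R]_n := (enorm (y - x))^-1 *: (y - x).
have yx0 : 0 < enorm (y - x) by rewrite enorm_gt0// subr_eq0.
have e1 : sqnorm e = 1.
  by rewrite sqnormZ -enorm_sqr exprVn mulVf// lt0r_neq0// exprn_gt0.
have eE i : e 0 i = (y - x) 0 i / enorm (y - x) by rewrite [LHS]mxE mulrC.
have first_order_y i : gi i t y = e 0 i + (2 * d ^+ 2) * y 0 i.
  pose Phi z := g t z - g t x - enorm (z - x)
    - d ^+ 2 * (sqnorm (x - 0) + sqnorm (z - 0)) - sigma * (t - tau).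
  have dPhi : is_derive y (unit_vec i) Phi (gi i t y - e 0 i - d ^+ 2 * (2 * y 0 i)).
    have h1 := dgi i tt0 Oy; have h2 := is_derive_enormB i yx.
    have h3 := is_derive_sqnormB y 0 i.
    rewrite (_ : Phi = g t - cst (g t x) - (fun z => enorm (z - x)) -
      d ^+ 2 *: (cst (sqnorm (x - 0)) + (fun z => sqnorm (z - 0)))
      - cst (sigma * (t - tau))); last by apply/funext.
    apply: is_derive_eq.
    by rewrite eE /GRing.scale/= !subr0 add0r.
  have E := interior_max_partial open_Omega Oy dPhi.
  have -> : gi i t y = (gi i t y - e 0 i - d ^+ 2 * (2 * y 0 i)) + (e 0 i + 2 * d ^+ 2 * y 0 i).
    by ring.
  rewrite E; first by rewrite add0r.
  move=> z Oz; apply: (Zmax (t, (x, z))).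
  by split=> //; split=> //; exact: subset_closure.
have first_order_x i : gi i t x = e 0 i + (2 * d ^+ 2) * (- x) 0 i.
  pose Phi z := g t y - g t z - enorm (z - y)
    - d ^+ 2 * (sqnorm (z - 0) + sqnorm (y - 0)) - sigma * (t - tau).
  have xy : x != y by rewrite eq_sym.
  have dPhi : is_derive x (unit_vec i) Phi (- gi i t x + e 0 i - d ^+ 2 * (2 * x 0 i)).
    have h1 := dgi i tt0 Ox; have h2 := is_derive_enormB i xy.
    have h3 := is_derive_sqnormB x 0 i.
    rewrite (_ : Phi = cst (g t y) - g t - (fun z => enorm (z - y)) -
      d ^+ 2 *: ((fun z => sqnorm (z - 0)) + cst (sqnorm (y - 0)))
      - cst (sigma * (t - tau))); last by apply/funext.
    apply: is_derive_eq.
    rewrite eE (enormB x y) -(opprB y x) [(- (y - x)) 0 i]mxE mulNr.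
    by rewrite /GRing.scale/= !subr0 addr0 sub0r opprK.
  have E := interior_max_partial open_Omega Ox dPhi.
  have -> : gi i t x = (e 0 i + 2 * d ^+ 2 * (- x) 0 i)
      - (- gi i t x + e 0 i - d ^+ 2 * (2 * x 0 i)).
    have -> : (- x) 0 i = - x 0 i by rewrite mxE.
    by ring.
  rewrite E; first by rewrite subr0.
  move=> z Oz; rewrite /Phi (enormB z y) (enormB x y); apply: (Zmax (t, (z, y))).
  by split=> //; split=> //; exact: subset_closure.
(* Both points move with the same velocity, so [|y - x|] is constant along [phi]. *)
have second_order i : gii i t y - gii i t x <= 4 * d ^+ 2.
  pose u := unit_vec i : 'rV[R]_n.
  pose phi (s : R) := Z (t, (x + s *: u, y + s *: u)).
  pose dphi (s : R) := gi i t (y + s *: u) - gi i t (x + s *: u)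
    - d ^+ 2 * (2 * (x + s *: u - 0) 0 i + 2 * (y + s *: u - 0) 0 i).
  have nx := near_line u open_Omega Ox; have ny := near_line u open_Omega Oy.
  have dphiE : \forall s \near (0 : R), is_derive (s : R) 1 phi (dphi s).
    near=> s.
    have Oxs : Omega (x + s *: u) by near: s.
    have Oys : Omega (y + s *: u) by near: s.
    have h1 := is_derive_line (dgi i tt0 Oxs).
    have h2 := is_derive_line (dgi i tt0 Oys).
    have h3 := is_derive_line (is_derive_sqnormB (x + s *: u) 0 i).
    have h4 := is_derive_line (is_derive_sqnormB (y + s *: u) 0 i).
    rewrite (_ : phi = (fun r => g t (y + r *: u)) - (fun r => g t (x + r *: u))
      - cst (enorm (y - x))
      - d ^+ 2 *: ((fun r => sqnorm (x + r *: u - 0)) + (fun r => sqnorm (y + r *: u - 0)))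
      - cst (sigma * (t - tau))); last first.
      apply/funext => r; rewrite /phi /Z /=.
      by rewrite (_ : y + r *: u - (x + r *: u) = y - x)// opprD addrACA subrr addr0.
    apply: is_derive_eq.
    by rewrite /dphi /GRing.scale/= !subr0.
  have ddphi : is_derive (0 : R) 1 dphi (gii i t y - gii i t x - d ^+ 2 * 2 * (1 + 1)).
    have h1 := is_derive_line0 (dgii i tt0 Ox).
    have h2 := is_derive_line0 (dgii i tt0 Oy).
    have h3 := is_derive_line0 (is_derive_coordB x 0 i).
    have h4 := is_derive_line0 (is_derive_coordB y 0 i).
    rewrite (_ : dphi = (fun r => gi i t (y + r *: u)) - (fun r => gi i t (x + r *: u))
      - (d ^+ 2 * 2) *: ((fun r : R => (x + r *: u - 0) 0 i)
                 + (fun r : R => (y + r *: u - 0) 0 i))); last first.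
      by apply/funext => r; rewrite /dphi -mulrDr mulrA.
    apply: is_derive_eq.
    by rewrite /GRing.scale/=.
  have := is_derive2_max dphiE ddphi; case.
    near=> s.
    have Oxs : Omega (x + s *: u) by near: s.
    have Oys : Omega (y + s *: u) by near: s.
    rewrite /phi !scale0r !addr0; apply: Zmax.
    by split=> //; split; exact: subset_closure.
  by move=> _; move: (gii i t y) (gii i t x) (d ^+ 2) => *; lra.
have time : sigma <= gt t y - gt t x.
  have /andP[taut tle] := tt0.
  have d1' : is_derive t 1 (fun s => Z (s, (x, y))) (gt t y - gt t x - sigma).
    have h1 := dgt tt0 Ox; have h2 := dgt tt0 Oy.
    rewrite (_ : (fun s => Z (s, (x, y))) = g^~ y - g^~ x - cst (enorm (y - x)) -
      cst (d ^+ 2 * (sqnorm (x - 0) + sqnorm (y - 0))) - sigma *: (id - cst tau));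
      last by apply/funext.
    apply: is_derive_eq.
    by rewrite /GRing.scale/= !subr0 mulr1.
  rewrite -subr_ge0; apply: (is_derive_ge0_left_max d1').
  near=> h; apply: Zmax; split=> //.
  rewrite /= in_itv/=.
  have h0 : 0 < h by near: h; exact: nbhs_right_gt.
  have ht : h < t - tau by near: h; apply: nbhs_right_lt; rewrite subr_gt0.
  by apply/andP; split; lra.
have grady : \sum_i gi i t y ^+ 2 = sqnorm (e + (2 * d ^+ 2) *: y).
  by apply: eq_bigr => i _; rewrite first_order_y; congr (_ ^+ 2); rewrite !mxE.
have gradx : \sum_i gi i t x ^+ 2 = sqnorm (e + (2 * d ^+ 2) *: (- x)).
  by apply: eq_bigr => i _; rewrite first_order_x; congr (_ ^+ 2); rewrite !mxE.
have lap : \sum_i gii i t y - \sum_i gii i t x <= 4 * (d ^+ 2 * n%:R).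
  rewrite -sumrB mulrA mulr_natr -[n in leRHS]card_ord -sumr_const.
  by apply: ler_sum => i _; exact: second_order.
pose P := A * (d * (4 * m + 4 * m ^+ 2)).
have defect z z' : Omega z -> \sum_i gi i t z ^+ 2 = sqnorm (e + (2 * d ^+ 2) *: z') ->
    d * enorm z' <= m -> `|a t z * (1 - \sum_i gi i t z ^+ 2)| <= P.
  move=> Oz -> hz; rewrite normrM.
  by apply: ler_pM => //; [exact: a_bound|exact: gradient_defect].
have defy := defect y y Oy grady dy.
have defx : `|a t x * (1 - \sum_i gi i t x ^+ 2)| <= P.
  by apply: defect Ox gradx _; rewrite enormN.
move: defy defx; rewrite !ler_norml => /andP[_ defy] /andP[defx _].
rewrite (g_eq tt0 Oy) (g_eq tt0 Ox) in time.
have dd : d ^+ 2 * n%:R <= d * n%:R by rewrite ler_wpM2r// expr2 ger_pMr.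
have BE : d * B = 4 * (d * n%:R) + 2 * P by rewrite /B /P; ring.
move: time lap defy defx dd hB; rewrite BE.
move: (\sum_i gii i t x) (\sum_i gii i t y) (a t x * _) (a t y * _) (d * n%:R)
  (d ^+ 2 * _) => r1 r2 r3 r4 r5 r6.
move: (P) => P' *.
by lra.
Unshelve. all: by end_near. Qed.

(** A zero at an interior point would become negative one step further along [-e]. *)
Lemma halfspace_positive p e z : sqnorm e = 1 ->
  (forall y, closure Omega y -> 0 <= vdot e (y - p)) -> Omega z -> 0 < vdot e (z - p).
Proof.
move=> e1 ep Oz; rewrite lt_def ep ?andbT; last exact: subset_closure.
apply/eqP => z0.
have nO := near_line (- e) open_Omega Oz.
have {}nO : \forall s \near (0 : R)^'+, Omega (z + s *: - e) by exact: cvg_within nO.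
suff : \forall s \near (0 : R)^'+, False by move=> /filter_ex[].
near=> s.
have Os : Omega (z + s *: - e) by near: s.
have s0 : 0 < s by near: s; exact: nbhs_right_gt.
have := ep _ (subset_closure Os).
rewrite addrAC vdotDr z0 vdotZr vdotNr -sqnorm_vdot e1 add0r mulrN1.
by rewrite oppr_ge0 leNgt s0.
Unshelve. all: by end_near. Qed.

(** A walk from [z] perpendicularly to the hyperplane leaves [Omega], before reaching
    the hyperplane or upon reaching it, at a point where [g0] vanishes. *)
Lemma halfspace_initial (g0 : 'rV[R]_n -> R) p e z : sqnorm e = 1 ->
  (forall y, closure Omega y -> 0 <= vdot e (y - p)) ->
  (forall x y, closure Omega x -> closure Omega y ->
    `|g0 y - g0 x| <= enorm (y - x)) ->
  (forall x, closure Omega x -> ~ Omega x -> g0 x = 0) ->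
  closure Omega z -> g0 z <= vdot e (z - p).
Proof.
move=> e1 ep lip bd clz; have [Oz|nOz] := pselect (Omega z); last first.
  by rewrite bd// ep.
set c := vdot e (z - p); have c0 : 0 < c by exact: halfspace_positive.
pose z' := z - c *: e.
have nOz' : ~ Omega z'.
  move=> /(halfspace_positive e1 ep); rewrite /z' addrAC vdotDr vdotNr vdotZr.
  by rewrite -sqnorm_vdot e1 mulr1 subrr ltxx.
have [s [/andP[s0 s1] clw nOw]] := first_exit open_Omega Oz nOz'.
have E : z' - z = - (c *: e) by rewrite /z' addrAC subrr add0r.
have := lip _ _ clw clz; rewrite (bd _ clw nOw) subr0 => h.
apply: le_trans (ler_norm _) _; apply: le_trans h _.
have e1' : enorm e = 1 by rewrite /enorm e1 sqrtr1.
rewrite opprD addrA subrr add0r E scalerN opprK !enormZ e1' mulr1.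
by rewrite !gtr0_norm// ger_pMl.
Qed.

(** Pairs with [x] on the boundary are settled by a half-space whose hyperplane passes
    within [eps] of [x], for every [eps]. *)
Theorem gradient_equation_lipschitz (g0 : 'rV[R]_n -> R) :
  segment_closed Omega -> Omega !=set0 ->
  (forall x y, closure Omega x -> closure Omega y ->
    `|g0 y - g0 x| <= enorm (y - x)) ->
  (forall x, closure Omega x -> ~ Omega x -> g0 x = 0) ->
  (forall x, closure Omega x -> `|g tau x - g0 x| <= eta / 2) ->
  forall t x y, tau <= t <= t0 -> closure Omega x -> closure Omega y ->
    g t y - g t x <= enorm (y - x) + eta.
Proof.
move=> cO O0 lip bd near0; apply: two_point_bound.
  move=> x y clx cly; have := lip x y clx cly.
  have := near0 x clx; have := near0 y cly; rewrite !ler_norml.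
  by move=> /andP[h1 h2] /andP[h3 h4] /andP[h5 h6]; lra.
move=> t x y tI clx nOx Oy; apply/ler_addgt0Pl => eps eps0.
have [p [e [px e1 ep]]] := supporting_halfspace open_Omega cO O0 clx nOx eps0.
have init z : closure Omega z -> g tau z <= vdot e (z - p) + eta.
  move=> clz; have := halfspace_initial e1 ep lip bd clz.
  by have := near0 z clz; rewrite ler_norml => /andP[h1 h2]; lra.
have := halfspace_bound e1 ep init tI (subset_closure Oy).
have : vdot e (y - p) <= enorm (y - p).
  by apply: le_trans (vdot_le_enorm _ _) _; rewrite {1}/enorm e1 sqrtr1 mul1r.
have := enorm_triangle x y p; rewrite (enormB x p).
by move: (vdot _ _) (enorm (y - p)) (enorm (y - x)) px => *; lra.
Qed.

End gradient_equation.

(** * The supremum norm of a continuous function *)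

Section supremum_norm.
Context {R : realType} {n : nat}.
Implicit Types (Omega : set 'rV[R]_n) (h : 'rV[R]_n -> R).

Lemma Linfty_norm_ae Omega h (c : R) :
  (Linfty_norm Omega h <= c%:E)%E <->
  {ae lebesgue_rV n, forall x, `|(h \_ Omega) x| <= c}.
Proof.
rewrite /Linfty_norm unlock /Lnorm lebesgue_rV_setT_gt0; split.
  by move=> /ess_supP; apply: filterS => x; rewrite /= lee_fin.
by move=> H; apply/ess_supP; apply: filterS H => x; rewrite /= lee_fin.
Qed.

(** A continuous function obeys its essential bound everywhere, since a null set
    contains no nonempty open set. *)
Lemma le_Linfty_norm Omega h (c : R) : open Omega ->
  (forall x, Omega x -> {for x, continuous h}) ->
  (Linfty_norm Omega h <= c%:E)%E -> forall x, Omega x -> `|h x| <= c.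
Proof.
move=> oO ch /Linfty_norm_ae hc x Ox; rewrite leNgt; apply/negP => gap.
pose V := [set y | Omega y /\ c < `|h y|].
have nV : nbhs x V.
  apply: filterI; first exact: open_nbhs_nbhs.
  have cn : {for x, continuous (fun y => `|h y|)}.
    by apply: (continuous_comp (f := h) (g := Num.norm)); [exact: ch|exact: norm_continuous].
  by apply: (cn [set r | c < r]); apply: open_nbhs_nbhs; split=> //; exact: open_gt.
have [y Vy] := @ae_lebesgue_rV_dense R n _ V° hc (open_interior V)
  (ex_intro _ x nV).
have [Oy cy] := interior_subset Vy.
by rewrite patchE mem_set// leNgt cy.
Qed.

Lemma Linfty_norm_le Omega h (c : R) : 0 <= c ->
  (forall x, Omega x -> `|h x| <= c) -> (Linfty_norm Omega h <= c%:E)%E.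
Proof.
move=> c0 hc; apply/Linfty_norm_ae; apply: nearW => x; rewrite patchE.
by case: ifPn => [/set_mem/hc//|_]; rewrite normr0.
Qed.

Lemma in_Linfty_fin_num Omega h : in_Linfty Omega h ->
  Linfty_norm Omega h = (fine (Linfty_norm Omega h))%:E /\
  0 <= fine (Linfty_norm Omega h).
Proof.
move=> [_ hoo]; have h0 : (0 <= Linfty_norm Omega h)%E by exact: Lnorm_ge0.
by split; [rewrite fineK// ge0_fin_numE|exact: fine_ge0].
Qed.

End supremum_norm.

Section continuity_on_closure.
Context {R : realType} {n : nat}.
Implicit Types (Omega : set 'rV[R]_n) (h : 'rV[R]_n -> R).

Lemma within_continuous_post {X Y Z : topologicalType} (D : set X)
    (h : X -> Y) (G : Y -> Z) :
  {within D, continuous h} -> (forall x, D x -> {for h x, continuous G}) ->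
  {within D, continuous (G \o h)}.
Proof.
move=> /subspace_continuousP ch cG; apply/subspace_continuousP => x Dx.
by apply: cvg_comp (ch x Dx) _; exact: cG.
Qed.

Lemma C21_closure_C1 Omega (I : set R) u t : open Omega -> C21_closure Omega I u -> I t ->
  C1_closure Omega (u t).
Proof.
move=> oO C2 It.
have [ut [ui [uii [[_ cui _] _ dui _ _]]]] := C21_closure_derivatives oO C2.
have [cu _ du _ _] := C2; split.
- exact: within_slice_space cu It.
- by move=> i x Ox; exact: du.
- move=> i; exists (ui i t); first exact: within_slice_space (cui i) It.
  by move=> x /set_mem Ox; rewrite (@derive_val _ _ _ _ _ _ _ (dui t x i It Ox)).
Qed.

End continuity_on_closure.

(** * The energy inequality *)

Lemma energy_slope {R : realType} (s a E : R) :
  (2^-1 * s + a <= E) = (s <= 2 * (E - a)).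
Proof. by apply/idP/idP => h; lra. Qed.

Section energy_bound.
Context {R : realType} {n : nat}.
Variables (Omega : set 'rV[R]_n) (f : R -> R) (u0 : 'rV[R]_n -> R) (T : \bar R).
Variables (u : R -> 'rV[R]_n -> R) (t0 m : R).

Hypothesis open_Omega : open Omega.
Hypothesis C1f : C1_nonneg f.
Hypothesis f0_ge0 : 0 <= f 0.
Hypothesis f_gt0 : forall s : R, 0 < s -> 0 < f s.
Hypothesis sol : maximal_solution Omega f u0 T u.
Hypothesis t0T : (t0%:E < T)%E.

Let I := [set t : R | 0 < t /\ (t%:E < T)%E].

Let in_lifespan (t : R) : 0 < t -> t <= t0 -> I t.
Proof. by move=> tp tt0; split=> //; apply: le_lt_trans t0T; rewrite lee_fin. Qed.

Hypothesis cO : segment_closed Omega.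
Hypothesis O0 : Omega !=set0.
Hypothesis m_ge0 : 0 <= m.
Hypothesis u_bound : forall (t : R) x, 0 <= t -> t <= t0 -> closure Omega x ->
  0 <= u t x <= m.
Hypothesis C1u0 : C1_closure Omega u0.
Hypothesis u0_boundary : forall x, closure Omega x -> ~ Omega x -> u0 x = 0.
Hypothesis u0_energy : forall x, Omega x ->
  2^-1 * (\sum_i ('D_(unit_vec i) u0 x) ^+ 2) + primitive f (u0 x) <= primitive f m.

Let u0_bound x : 0 <= t0 -> closure Omega x -> 0 <= u0 x <= m.
Proof. by move=> t00 clx; rewrite -(sol_init sol); exact: u_bound. Qed.

Let f_ge0 (s : R) : 0 <= s -> 0 <= f s.
Proof. by rewrite le_eqVlt => /predU1P[<-//|/f_gt0/ltW]. Qed.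

Let partial_u0 i x : Omega x -> is_derive x (unit_vec i) u0 ('D_(unit_vec i) u0 x).
Proof. by case: C1u0 => _ d _ /d dx; exact: derivableP. Qed.

(** The energy inequality bounds [|grad u0|^2] by [2 F(m)], which is at most
    [(1 + 2 F(m))^2]; the added [1] makes the constant positive. *)
Lemma initial_lipschitz : 0 <= t0 -> exists2 L : R, 0 < L &
  forall x y, closure Omega x -> closure Omega y -> `|u0 y - u0 x| <= L * enorm (y - x).
Proof.
move=> t00; have Fm : 0 <= primitive f m by exact: primitive_ge0.
exists (1 + 2 * primitive f m); first by lra.
have L0 : 0 <= 1 + 2 * primitive f m by lra.
apply: lipschitz_closure => //; first by case: C1u0.
apply: (lipschitz_of_partials (p := fun i => 'D_(unit_vec i) u0)) => //.
- by move=> i y Oy; exact: (@continuous_partial _ _ Omega u0 i y open_Omega C1u0 Oy).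
move=> y Oy; have := u0_energy Oy.
have /andP[uy _] := u0_bound t00 (subset_closure Oy).
have := primitive_ge0 C1f f_gt0 uy.
by move: (\sum_i _) (primitive f (u0 y)) => *; nra.
Qed.

Let continuous_u : {within I `*` closure Omega, continuous (fun p => u p.1 p.2)}.
Proof. by case: (sol_regular sol). Qed.

(** The initial trace is attained uniformly: by definition of the solution [u] stays
    close to the heat flow of [u0], and the latter converges uniformly because [u0] is
    Lipschitz and vanishes on the boundary. *)
Lemma uniform_initial_trace (t eps : R) : 0 < t -> t <= t0 -> 0 < eps ->
  exists2 tau, 0 < tau < t &
    forall x, closure Omega x -> `|u tau x - u0 x| <= eps.
Proof.
move=> tp tt0 eps0; have e20 : 0 < eps / 2 by rewrite divr_gt0.
have t00 : 0 <= t0 by apply: le_trans tt0; exact: ltW.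
have [L L0 lip] := initial_lipschitz t00.
have [v hv uv] := sol_initial_limit sol.
have [s s0 hs] := heat_flow_uniform open_Omega L0 lip u0_boundary hv e20.
have near_uv : \forall tau \near (0 : R)^'+,
    (Linfty_norm Omega (u tau \- v tau)%R <= (eps / 2)%:E)%E.
  have : \forall tau \near (0 : R)^'+,
      (Linfty_norm Omega (u tau \- v tau)%R < (eps / 2)%:E)%E.
    apply: (uv [set r | (r < (eps / 2)%:E)%E]).
    by apply: open_ereal_lt'; rewrite lte_fin.
  by apply: filterS => tau; exact: ltW.
have [tau [tau0 taut taus huv]] : exists tau : R, [/\ 0 < tau, tau < t, tau < s &
    (Linfty_norm Omega (u tau \- v tau)%R <= (eps / 2)%:E)%E].
  apply: (@filter_ex _ (0 : R)^'+); near=> tau; split.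
  - by near: tau; exact: nbhs_right_gt.
  - by near: tau; exact: nbhs_right_lt.
  - by near: tau; exact: nbhs_right_lt.
  - by near: tau.
exists tau; first by rewrite tau0.
have tau_le : tau <= t0 by apply: le_trans tt0; exact: ltW.
move=> x clx; have [Ox|nOx] := pselect (Omega x); last first.
  have bx : boundary Omega x by split => // /interior_subset.
  rewrite (sol_boundary sol tau0 (in_lifespan tau0 tau_le).2 bx).
  by rewrite u0_boundary// subrr normr0 ltW.
have cu : {within closure Omega, continuous (u tau)}.
  exact: within_slice_space continuous_u (in_lifespan tau0 tau_le).
have cv : {within closure Omega, continuous (v tau)}.
  have [[cv _ _ _ _] _ _ _ _] := hv.
  by apply: (within_slice_space cv); rewrite /= in_itv/= tau0.
have h1 : `|(u tau \- v tau) x| <= eps / 2.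
  apply: (le_Linfty_norm open_Omega _ huv Ox) => y Oy.
  have c1 := continuous_interior open_Omega cu Oy.
  have c2 := continuous_interior open_Omega cv Oy.
  exact: continuousB c1 c2.
have h2 := hs tau x tau0 taus Ox.
rewrite [eps]splitr -(subrKA (v tau x)).
by apply: le_trans (ler_normD _ _) _; apply: lerD.
Unshelve. all: by end_near. Qed.

Section level.
Variable E : R.
Hypothesis mE : primitive f m < E.

Let q := slope_inv f m E.
Let G := travel f m E.

Let derive_G (z : R) : 0 <= z -> is_derive z 1 G (q z).
Proof. by move=> z0; apply: is_derive_travel => //; lra. Qed.

Let continuous_q (z : R) : 0 <= z -> {for z, continuous q}.
Proof. by move=> z0; apply: continuous_slope_inv => //; lra. Qed.

(** The energy inequality for [u0] is the bound [|grad G(u0)| <= 1]. *)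
Lemma initial_travel_lipschitz x y : 0 <= t0 -> closure Omega x -> closure Omega y ->
  `|G (u0 y) - G (u0 x)| <= enorm (y - x).
Proof.
move=> t00 clx cly; rewrite -[enorm _]mul1r; move: x y clx cly.
have u0_ge0 x : closure Omega x -> 0 <= u0 x by move=> /(u0_bound t00)/andP[].
have [cu0 _ _] := C1u0.
apply: lipschitz_closure => //.
  apply: (within_continuous_post (G := G) cu0) => x clx.
  exact: is_derive_continuous (derive_G (u0_ge0 x clx)).
apply: (@lipschitz_of_partials _ _ _ (G \o u0)
  (fun i x => q (u0 x) * 'D_(unit_vec i) u0 x)) => //.
- move=> i y Oy; apply: (@is_derive_compl R _ G u0 y (unit_vec i)); last exact: (partial_u0 i Oy).
  exact/derive_G/u0_ge0/subset_closure.
- move=> i y Oy.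
  have c1 : {for y, continuous (q \o u0)}.
    apply: (continuous_comp (f := u0) (g := q)); first exact: continuous_interior cu0 Oy.
    exact/continuous_q/u0_ge0/subset_closure.
  by have c2 := @continuous_partial _ _ Omega u0 i y open_Omega C1u0 Oy; exact: continuousM c1 c2.
move=> y Oy; have um := u0_bound t00 (subset_closure Oy).
under eq_bigr do rewrite exprMn.
rewrite -mulr_sumr expr1n -(slope_inv_sqr C1f f_gt0 mE um) ler_wpM2l ?sqr_ge0//.
by have := le_trans (u0_energy Oy) (ltW mE); rewrite energy_slope.
Qed.

(** [G(u)] solves the gradient equation with [a = f(u) G'(u)], because
    [G'' = f G'^3].  The equation holds for positive times only, so the comparison
    starts at a small [tau] at which [G(u)] is within [eta / 2] of [G(u0)]. *)
Lemma travel_flow_lipschitz (t : R) x y : 0 < t -> t <= t0 ->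
  closure Omega x -> closure Omega y -> G (u t y) - G (u t x) <= enorm (y - x).
Proof.
move=> tp tt0 clx cly; apply/ler_addgt0Pr => eta eta0.
have t00 : 0 <= t0 by apply: le_trans tt0; exact: ltW.
have [Q hQ] := slope_inv_bounds C1f m_ge0 mE.
have qQ z : 0 <= z <= m -> q z <= Q by move=> /hQ[].
have Q0 : 0 < Q.
  have /qQ : 0 <= (0 : R) <= m by rewrite lexx.
  exact: lt_le_trans (slope_inv_gt0 mE _).
have d0 : 0 < eta / (2 * Q) by rewrite divr_gt0// mulr_gt0.
have [tau /andP[tau0 taut] near0] := uniform_initial_trace tp tt0 d0.
have [ut [ui [uii [_ dut dui duii equ]]]] :=
  C21_closure_derivatives open_Omega (sol_regular sol).
have ge_tau (s : R) : tau <= s -> 0 < s by exact: lt_le_trans.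
have bnd (s : R) z : tau <= s <= t0 -> closure Omega z -> 0 <= u s z <= m.
  by move=> /andP[/ge_tau/ltW]; exact: u_bound.
have lip z : 0 <= z <= m -> G z <= Q * m.
  move=> zm; have m0 : 0 <= (0 : R) <= m by rewrite lexx.
  have := travel_lipschitz C1f mE m0 zm qQ; rewrite travel0 !subr0 => h.
  apply: le_trans (ler_norm _) _; apply: le_trans h _.
  by have /andP[z0 zle] := zm; rewrite ger0_norm// ler_pM2l.
have gt_tau (s : R) : tau < s <= t0 -> I s.
  by move=> /andP[/(lt_trans tau0)]; exact: in_lifespan.
have bnd' (s : R) z : tau < s <= t0 -> Omega z -> 0 <= u s z <= m.
  by move=> /andP[/ltW h1 h2] /subset_closure; apply: bnd; rewrite h1.
have key := @gradient_equation_lipschitz R n Omega (fun s z => G (u s z))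
  (fun s z => q (u s z) * ut s z) (fun s z => f (u s z) * q (u s z))
  (fun i s z => q (u s z) * ui i s z)
  (fun i s z => q (u s z) * uii i s z + f (u s z) * q (u s z) ^+ 3 * ui i s z ^+ 2)
  tau t0 (Q * m) Q eta open_Omega.
apply: (key _ _ _ _ _ _ _ _ _ _ (G \o u0)) => //.
- have cu : {within `[tau, t0] `*` closure Omega, continuous (fun p => u p.1 p.2)}.
    apply: continuous_subspaceW continuous_u => -[s z] [/= sI clz]; split=> //=.
    by move: sI; rewrite in_itv/= => /andP[/ge_tau]; exact: in_lifespan.
  apply: (within_continuous_post (G := G) cu) => -[s z] [/= sI clz].
  apply: is_derive_continuous (derive_G _).
  by move: sI; rewrite in_itv/= => /bnd/(_ clz)/andP[].
- move=> s z sI Oz; apply: (@is_derive_compl R R^o G (u^~ z) s 1).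
    by apply: derive_G; have /andP[] := bnd' _ _ sI Oz.
  exact: dut (gt_tau _ sI) Oz.
- move=> s z i sI Oz; apply: (@is_derive_compl R _ G (u s) z (unit_vec i)).
    by apply: derive_G; have /andP[] := bnd' _ _ sI Oz.
  exact: dui (gt_tau _ sI) Oz.
- move=> s z i sI Oz.
  have h1 : is_derive z (unit_vec i) (q \o u s) (f (u s z) * q (u s z) ^+ 3 * ui i s z).
    apply: (@is_derive_compl R _ q (u s) z (unit_vec i)).
      exact: is_derive_slope_inv (bnd' _ _ sI Oz).
    exact: dui (gt_tau _ sI) Oz.
  have h2 := duii s z i (gt_tau _ sI) Oz.
  rewrite (_ : (fun z => _) = (q \o u s) * ui i s); last by apply/funext.
  apply: is_derive_eq.
  by rewrite /GRing.scale/=; ring.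
- move=> s z sI Oz; have Is := gt_tau _ sI.
  have [e1 e2] := equ s z Is Oz.
  have := sol_eq sol Is.1 Is.2 Oz; rewrite e1 e2 => e3.
  have -> : ut s z = \sum_i uii i s z + f (u s z) by rewrite -e3; ring.
  rewrite big_split/= -!mulr_sumr.
  under [in RHS]eq_bigr do rewrite exprMn.
  by rewrite -mulr_sumr; ring.
- move=> s z sI Oz; have b := bnd' _ _ sI Oz.
  rewrite ger0_norm ?mulr_ge0//; first exact: (hQ _ b).2.
    by apply: f_ge0; case/andP: b.
  exact/ltW/slope_inv_gt0.
- move=> s z sI clz; have b := bnd _ _ sI clz.
  by rewrite (travel_ge0 C1f mE b) lip.
- move=> s z /andP[taus sle] clz nOz.
  have bz : boundary Omega z by split => // /interior_subset.
  have sp := ge_tau _ taus.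
  by rewrite (sol_boundary sol sp (in_lifespan sp sle).2 bz) /G travel0.
- exact: ltW.
- exact: ltW.
- by move=> a b cla clb; exact: initial_travel_lipschitz.
- by move=> z clz nOz; rewrite /= u0_boundary// /G travel0.
- move=> z clz.
  have b1 : 0 <= u tau z <= m.
    by apply: bnd => //; rewrite lexx; apply: le_trans tt0; exact: ltW.
  apply: le_trans (travel_lipschitz C1f mE (u0_bound t00 clz) b1 qQ) _.
  rewrite -ler_pdivlMl//; apply: le_trans (near0 z clz) _.
  by rewrite le_eqVlt; apply/orP; left; apply/eqP; field; rewrite gt_eqF.
- by rewrite (ltW taut).
Qed.

(** Read the Lipschitz bound of [G(u)] at one point as a bound of its gradient. *)
Lemma level_energy (t : R) x : 0 < t -> t <= t0 -> Omega x ->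
  2^-1 * (\sum_i ('D_(unit_vec i) (u t) x) ^+ 2) + primitive f (u t x) <= E.
Proof.
move=> tp tt0 Ox; have It := in_lifespan tp tt0.
have C1u := C21_closure_C1 open_Omega (sol_regular sol) It.
have [cu du _] := C1u.
have um y : Omega y -> 0 <= u t y <= m.
  by move=> Oy; apply: u_bound => //; [exact: ltW|exact: subset_closure].
have u0' y : Omega y -> 0 <= u t y by move=> /um/andP[].
have : \sum_i (q (u t x) * 'D_(unit_vec i) (u t) x) ^+ 2 <= 1 ^+ 2.
  apply: (@partials_of_lipschitz _ _ Omega (G \o u t)
    (fun i y => q (u t y) * 'D_(unit_vec i) (u t) y) 1 x) => //.
  - move=> i y Oy; apply: (@is_derive_compl R _ G (u t) y (unit_vec i)).
      exact/derive_G/u0'.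
    by apply: derivableP; exact: du.
  - move=> i.
    have c1 : {for x, continuous (q \o u t)}.
      apply: (continuous_comp (f := u t) (g := q)); first exact: continuous_interior cu Ox.
      exact/continuous_q/u0'.
    by have c2 := @continuous_partial _ _ Omega (u t) i x open_Omega C1u Ox;
      exact: continuousM c1 c2.
  - move=> y Oy; rewrite mul1r; apply: travel_flow_lipschitz => //; exact: subset_closure.
under eq_bigr do rewrite exprMn.
rewrite -mulr_sumr expr1n energy_slope => h.
rewrite -(ler_pM2l (exprn_gt0 2 (slope_inv_gt0 mE (u t x)))).
by rewrite (slope_inv_sqr C1f f_gt0 mE (um x Ox)).
Qed.

End level.

Lemma energy_interior (t : R) x : 0 < t -> t <= t0 -> Omega x ->
  2^-1 * (\sum_i ('D_(unit_vec i) (u t) x) ^+ 2) + primitive f (u t x) <= primitive f m.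
Proof.
move=> tp tt0 Ox; apply/ler_addgt0Pr => eps eps0.
by apply: level_energy => //; rewrite ltrDl.
Qed.
End energy_bound.

Section consequences.
Context {R : realType} {n : nat}.
Variables (Omega : set 'rV[R]_n) (f : R -> R) (u0 : 'rV[R]_n -> R) (T : \bar R).
Variables (u : R -> 'rV[R]_n -> R) (t0 : R).

Hypothesis open_Omega : open Omega.
Hypothesis C1f : C1_nonneg f.
Hypothesis f0_ge0 : 0 <= f 0.
Hypothesis f_gt0 : forall s : R, 0 < s -> 0 < f s.
Hypothesis u0_ge0 : {ae lebesgue_rV n, forall x, Omega x -> 0 <= u0 x}.
Hypothesis sol : maximal_solution Omega f u0 T u.
Hypothesis t0_gt0 : 0 < t0.
Hypothesis t0T : (t0%:E < T)%E.

Let U (t : R) := Linfty_norm Omega (u t).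
Let m := fine (U t0).

Let Um : U t0 = m%:E /\ 0 <= m.
Proof. exact: in_Linfty_fin_num (sol_Linfty sol t0_gt0 t0T). Qed.

(** At [t = 0] the sign of [u0] is known almost everywhere only; continuity extends
    it to all of [Omega]. *)
Lemma solution_ge0 (t : R) x : 0 <= t -> (t%:E < T)%E -> C1_closure Omega (u t) ->
  Omega x -> 0 <= u t x.
Proof.
rewrite le_eqVlt => /predU1P[<-|tp] tT [cu _ _] Ox; last first.
  by apply: (sol_ge0 sol) => //; exact: subset_closure.
rewrite leNgt; apply/negP => neg; rewrite (sol_init sol) in cu neg.
pose V := [set y | Omega y /\ u0 y < 0].
have nV : nbhs x V.
  apply: filterI; first exact: open_nbhs_nbhs.
  have c := continuous_interior open_Omega cu Ox.
  by apply: (c [set r | r < 0]); apply: open_nbhs_nbhs; split=> //; exact: open_lt.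
have [y Vy] := @ae_lebesgue_rV_dense R n _ V° u0_ge0 (open_interior V)
  (ex_intro _ x nV).
by have [Oy yneg] := interior_subset Vy; move=> /(_ Oy); rewrite leNgt yneg.
Qed.

(** The inequality yields [F(u) <= F(m)], and [F] is strictly increasing. *)
Lemma energy_le_norm (t : R) : 0 <= t -> (t%:E < T)%E ->
  energy_le Omega (primitive f) (u t) (primitive f m) -> (U t <= U t0)%E.
Proof.
have [-> m0] := Um; move=> tp tT [C1u en].
apply: Linfty_norm_le => // x Ox.
have ux := solution_ge0 tp tT C1u Ox.
rewrite ger0_norm//; apply: (primitive_le_inv C1f f_gt0 ux m0).
apply: le_trans (en x (subset_closure Ox)).
by rewrite lerDr mulr_ge0 ?invr_ge0 ?sqnorm_ge0.
Qed.

(** The bounds on the norms say that [u <= m] up to time [t0], so the profile is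
    defined at every value of [u]. *)
Lemma norm_le_energy : segment_closed Omega -> Omega !=set0 -> in_Y Omega u0 ->
  energy_le Omega (primitive f) u0 (primitive f m) ->
  (forall t, 0 <= t -> t <= t0 -> (U t <= U t0)%E) ->
  forall t, 0 <= t -> t <= t0 ->
    energy_le Omega (primitive f) (u t) (primitive f m).
Proof.
move=> cO O0 [C1u0 u0_ge u0_bd _] [_ en0] hU.
have [Ut0 m0] := Um.
have boundaryE x : closure Omega x -> ~ Omega x -> boundary Omega x.
  by move=> clx nOx; split=> // /interior_subset.
have tT (t : R) : t <= t0 -> (t%:E < T)%E.
  by move=> tt0; apply: le_lt_trans t0T; rewrite lee_fin.
have C1u (t : R) : 0 <= t -> t <= t0 -> C1_closure Omega (u t).
  rewrite le_eqVlt => /predU1P[<-|tp] tt0; first by rewrite (sol_init sol).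
  by apply: C21_closure_C1 (sol_regular sol) _ => //; split=> //; exact: tT.
have u_bd (t : R) x : 0 <= t -> t <= t0 -> boundary Omega x -> u t x = 0.
  rewrite le_eqVlt => /predU1P[<-|tp] tt0 bx; first by rewrite (sol_init sol) u0_bd.
  by apply: (sol_boundary sol) => //; exact: tT.
have u_bound (t : R) x : 0 <= t -> t <= t0 -> closure Omega x -> 0 <= u t x <= m.
  move=> tp tt0 clx; have [cu _ _] := C1u t tp tt0.
  have [Ox|nOx] := pselect (Omega x); last first.
    by rewrite u_bd ?lexx//; exact: boundaryE.
  rewrite (solution_ge0 tp (tT t tt0) (C1u t tp tt0) Ox)/=.
  apply: le_trans (ler_norm _) _; apply: (le_Linfty_norm open_Omega _ _ Ox).
    by move=> y Oy; exact: continuous_interior cu Oy.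
  by rewrite -Ut0; exact: hU.
move=> t tp tt0; move: (tp); rewrite le_eqVlt => /predU1P[<-|t_gt0].
  by rewrite (sol_init sol); split.
have C1ut := C1u t tp tt0; have [cu _ _] := C1ut.
have ext y : closure Omega y -> primitive_ext f (u t y) = primitive f (u t y).
  by move=> cly; apply: primitive_extE => //; have /andP[] := u_bound t y tp tt0 cly.
suff [_ en] : energy_le Omega (primitive_ext f) (u t) (primitive f m).
  by split=> // x clx; rewrite -ext//; exact: en.
apply: energy_le_closure => //.
  apply: (within_continuous_post (G := primitive_ext f) cu) => y cly.
  apply: is_derive_continuous (is_derive_primitive_ext C1f _).
  by apply: lt_le_trans (_ : 0 <= _); rewrite ?ltrN10//; have /andP[] := u_bound t y tp tt0 cly.
move=> x Ox; rewrite ext; last exact: subset_closure.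
apply: (energy_interior open_Omega C1f f0_ge0 f_gt0 sol t0T cO O0 m0 u_bound C1u0) => //.
- by move=> y cly nOy; apply: u0_bd; exact: boundaryE.
- move=> y Oy; have := en0 y (subset_closure Oy); rewrite /sqnorm.
  by under eq_bigr do rewrite (gradient_interior _ C1u0 Oy).
Qed.

End consequences.

Theorem proposition3p2 (R : realType) (n : nat) (Omega : set 'rV[R]_n.+1)
    (f : R -> R) (u0 : 'rV[R]_n.+1 -> R) (T : \bar R)
    (u : R -> 'rV[R]_n.+1 -> R) (t1 t0 : R) :
  uniformly_smooth_domain Omega ->
  C1_nonneg f -> 0 <= f 0 -> (forall s : R, 0 < s -> 0 < f s) ->
  in_Linfty Omega u0 ->
  {ae lebesgue_rV n.+1, forall x, Omega x -> 0 <= u0 x} ->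
  maximal_solution Omega f u0 T u ->
  0 <= t1 -> t1 < t0 -> (t0%:E < T)%E ->
  let F := primitive f in
  let U := fun t : R => Linfty_norm Omega (u t) in
  let M := fun s : R => ereal_sup [set U t | t in `[0, s]] in
  (energy_le Omega F (u t1) (F (fine (U t0))) -> (U t1 <= U t0)%E) /\
  (convex_set (Omega : set (convex_lmodType 'rV[R]_n.+1)) -> in_Y Omega u0 ->
   energy_le Omega F u0 (F (fine (U t0))) ->
   ((forall t : R, 0 <= t <= t0 -> energy_le Omega F (u t) (F (fine (U t0)))) <->
    M t0 = U t0)).
Proof.
move=> [oO _ O0 _] C1f f0 f_gt0 _ u0_ge0 sol t10 t1t0 t0T F U M.
have t0_gt0 : 0 < t0 by exact: le_lt_trans t1t0.
have tT (t : R) : t <= t0 -> (t%:E < T)%E.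
  by move=> tt0; apply: le_lt_trans t0T; rewrite lee_fin.
split; first by apply: (energy_le_norm oO C1f f_gt0 u0_ge0 sol) => //; exact/tT/ltW.
move=> /convex_segment_closed cO Yu0 en0; split=> [en|MU t /andP[t_ge0 tt0]].
  apply/eqP; rewrite eq_le; apply/andP; split.
    apply: ge_ereal_sup => _ [t /= + <-]; rewrite in_itv/= => /andP[t_ge0 tt0].
    apply: (energy_le_norm oO C1f f_gt0 u0_ge0 sol) => //; first exact: tT.
    by apply: en; rewrite t_ge0.
  by apply: ereal_sup_ubound; exists t0; rewrite //= in_itv/= lexx andbT ltW.
apply: (norm_le_energy oO C1f f0 f_gt0 u0_ge0 sol) => // s s_ge0 st0.
by rewrite -[leRHS]MU; apply: ereal_sup_ubound; exists s; rewrite //= in_itv/= s_ge0.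
Qed.
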